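(* Let $\alpha>0$, $G(x)=\frac{1}{2\alpha}e^{-|x|/\alpha}$, let $m_0\in\mathcal{M}^+(\mathbb{R})$ with $\|m_0\|_1=1$, let $u_0=G*m_0$, and let $(m^{(N)})_{N\in\mathbb{N}}\subseteq\mathcal{X}$ be the sequence of particle solutions described in the context, whose initial values satisfy $m^{(N)}(0)\to m_0$ in the weak$^*$-topology as $N\to\infty$. Then there exist a subsequence $(m^{(N_k)})_k$ of $(m^{(N)})$ and $m\in\mathcal{X}$ such that $$m^{(N_k)}(t)\stackrel{w^*}{\longrightarrow} m(t)\quad\text{as }k\to\infty,\qquad\text{for all }t\in\mathbb{R}^+.$$ Moreover, if we define $u$ on $\mathbb{R}^+$ by $u(t)=G*(m(t))$ and identify $u$ with a function on $\Omega=\mathbb{R}^+\times\mathbb{R}$ via $u(t,x)=u(t)(x)$, then $u$ is a weak solution of the Camassa-Holm equation with initial condition $u_0$ (as defined in the context), and $u\in C^{0,\frac12}_b(\mathbb{R}^+;H^1(\mathbb{R}))$.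
   Context: Notation. $\mathbb{R}^+=[0,\infty)$ and $\Omega=\mathbb{R}^+\times\mathbb{R}$. $C_c^\infty(\Omega)$ is the space of compactly supported functions on $\Omega$ having derivatives of all orders (they need not vanish at $t=0$). $\mathcal{M}(\mathbb{R})$ is the space of finite signed Radon measures on $\mathbb{R}$ with total variation norm $\|\cdot\|_1$, identified with the dual of $C_0(\mathbb{R})$ (continuous functions vanishing at infinity, with the sup norm $\|\cdot\|_\infty$); $w^*$ is the corresponding weak$^*$-topology: $\mu_N\stackrel{w^*}{\to}\mu$ means $\int f\,d\mu_N\to\int f\,d\mu$ for all $f\in C_0(\mathbb{R})$. $\mathcal{M}^+(\mathbb{R})$ denotes the positive measures and $B_{\mathcal{M}^+(\mathbb{R})}$ the positive measures of total variation at most $1$. $\delta_x$ is the Dirac measure at $x$. $(G*\mu)(x)=\int_{\mathbb{R}}G(x-y)\,d\mu(y)$. Bounded Lipschitz metric: $\|\mu\|_{BL}=\sup\{\int f\,d\mu: f\in C_0(\mathbb{R}),\ \|f\|_\infty+\mathrm{Lip}(f)\leqslant 1\}$, where $\mathrm{Lip}(f)$ is the Lipschitz constant of $f$, and $d(\mu,\nu)=\|\mu-\nu\|_{BL}$. $\mathcal{X}$ is the set of all $d$-continuous maps $m:\mathbb{R}^+\to B_{\mathcal{M}^+(\mathbb{R})}$. Particle solutions: for each $N\in\mathbb{N}$ choose initial positions $x_1(0)<\dots<x_N(0)$ and non-negative initial momenta $p_1(0),\dots,p_N(0)$ (all depending on $N$) with $\sum_{i=1}^N p_i(0)=1$. Let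 $(x_i(t),p_i(t))_{i=1}^N$, $t\in\mathbb{R}^+$, be the corresponding global $C^1$ solution, with $x_1(t)<\dots<x_N(t)$ for all $t$, of the system (with $\mathrm{sgn}(0)=0$) $$\dot{x}_j=\frac{1}{2\alpha}\sum_{i=1}^N p_i e^{-|x_j-x_i|/\alpha},\qquad \dot{p}_j=\frac{1}{2\alpha^2}p_j\sum_{i\neq j}p_i\,\mathrm{sgn}(x_j-x_i)e^{-|x_j-x_i|/\alpha},$$ for $1\leqslant j\leqslant N$. The total momentum is conserved, so $\sum_{i=1}^N p_i(t)=1$ for all $t$. Define $m^{(N)}(t)=\sum_{i=1}^N p_i(t)\delta_{x_i(t)}$. The initial data are arranged so that $m^{(N)}(0)\stackrel{w^*}{\to}m_0$ as $N\to\infty$. Weak solution: $u$ is a weak solution of the Camassa-Holm equation $m_t+(um)_x+u_xm=0$, $m=(1-\alpha^2\partial_{xx})u$, with initial condition $u_0$, where $m_0=(1-\alpha^2\frac{d^2}{dx^2})u_0$, if $u(0)=u_0$ and for all $\phi\in C_c^\infty(\Omega)$ $$\int_{\mathbb{R}}\phi(0,x)\,dm_0(x)+\int_0^\infty\!\!\int_{\mathbb{R}}(\phi_t-\alpha^2\phi_{txx})u\,dx\,dt+\int_0^\infty\!\!\int_{\mathbb{R}}\left(\tfrac32\phi_x-\tfrac12\alpha^2\phi_{xxx}\right)u^2\,dx\,dt+\int_0^\infty\!\!\int_{\mathbb{R}}\tfrac12\alpha^2\phi_x u_x^2\,dx\,dt=0.$$ $C^{0,\frac12}_b(\mathbb{R}^+;H^1(\mathbb{R}))$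 is the space of $\frac12$-H\''older continuous functions $u:\mathbb{R}^+\to H^1(\mathbb{R})$ with $\sup_{t\in\mathbb{R}^+}\|u(t)\|_{H^1}<\infty$. *)

(* Defs.v *)
(* Time in [0, oo[ is a real [t] with [0 <= t]; no notion below depends on values
   at negative times. *)
From HB Require Import structures.
From mathcomp Require Import all_boot all_order all_algebra.
From mathcomp Require Import all_classical all_reals all_analysis.
Set Implicit Arguments.
Unset Strict Implicit.
Unset Printing Implicit Defensive.
Import Order.TTheory GRing.Theory Num.Theory.
Import numFieldNormedType.Exports.
Local Open Scope classical_set_scope.
Local Open Scope ring_scope.

Section Measures.
Variable R : realType.

(* The real line with its Borel sigma-algebra. *)
Notation BR := (measurableTypeR R).

Definition C0 (f : R -> R) : Prop :=
  [/\ continuous f, f x @[x --> +oo] --> (0 : R) & f x @[x --> -oo] --> (0 : R)].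

(* Weak-star convergence tested against C_0.  The arguments are plain set
   functions, so that it applies to [particle_measure] below without a proof
   that the momenta are nonnegative. *)
Definition weak_star_cvg (mu : nat -> set BR -> \bar R) (nu : set BR -> \bar R)
    : Prop :=
  forall f : R -> R, C0 f ->
    (\int[mu n]_x (f x)%:E)%E @[n --> \oo] --> (\int[nu]_x (f x)%:E)%E.

Definition sup_norm (f : R -> R) : \bar R :=
  ereal_sup [set `|f x|%:E | x in [set: R]].

Definition lip_const (f : R -> R) : \bar R :=
  ereal_sup [set (`|f z.1 - f z.2| / `|z.1 - z.2|)%:E
            | z in [set z : R * R | z.1 != z.2]].

(* The bounded Lipschitz norm of mu - nu, for finite positive measures. *)
Definition BL_dist (mu nu : {finite_measure set BR -> \bar R}) : \bar R :=
  ereal_sup [set (\int[mu]_x f x - \int[nu]_x f x)%:E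
            | f in [set f : R -> R |
                     C0 f /\ (sup_norm f + lip_const f <= 1)%E]].

(* The maps in the space X: [subprobability BR R] is the set of positive Borel
   measures of total mass, i.e. total variation, at most 1. *)
Definition BL_continuous (m : R -> subprobability BR R) : Prop :=
  forall t, 0 <= t ->
    BL_dist (m s) (m t) @[s --> within `[0, +oo[ (nbhs t)] --> 0%E.

Definition Green (alpha x : R) : R :=
  (2 * alpha)^-1 * expR (- `|x| / alpha).

Definition convolution (g : R -> R) (mu : {measure set BR -> \bar R}) (x : R) : R :=
  \int[mu]_y g (x - y).

End Measures.

Section Particles.
Variable R : realType.

(* Derivative of [f] relative to [0, oo[: two-sided at t > 0 and one-sided at
   t = 0. *)
Definition quot_Rplus (f : R -> R) (t s : R) : R := (f s - f t) / (s - t).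

Definition is_deriv_Rplus (f : R -> R) (t l : R) : Prop :=
  quot_Rplus f t s @[s --> within `[0, +oo[ t^'] --> l.

Definition derivable_Rplus (f : R -> R) (t : R) : Prop :=
  cvg (quot_Rplus f t s @[s --> within `[0, +oo[ t^']).

Definition deriv_Rplus (f : R -> R) (t : R) : R :=
  lim (quot_Rplus f t s @[s --> within `[0, +oo[ t^']).

Definition C1_Rplus (f : R -> R) : Prop :=
  (forall t, 0 <= t -> derivable_Rplus f t) /\
  {within `[0, +oo[, continuous (deriv_Rplus f)}.

Record particle_solution (alpha : R) (N : nat) (x p : 'I_N -> R -> R) : Prop :=
  ParticleSolution {
    ps_C1_x : forall j, C1_Rplus (x j) ;
    ps_C1_p : forall j, C1_Rplus (p j) ;
    ps_order : forall t, 0 <= t ->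
      forall i j : 'I_N, (i < j)%N -> x i t < x j t ;
    ps_eq_x : forall j t, 0 <= t ->
      is_deriv_Rplus (x j) t
        ((2 * alpha)^-1 *
         \sum_(i < N) p i t * expR (- `|x j t - x i t| / alpha)) ;
    ps_eq_p : forall j t, 0 <= t ->
      is_deriv_Rplus (p j) t
        ((2 * alpha ^+ 2)^-1 * p j t *
         \sum_(i < N | i != j)
           p i t * Num.sg (x j t - x i t) * expR (- `|x j t - x i t| / alpha)) ;
    ps_p0_ge0 : forall i, 0 <= p i 0 ;
    ps_p0_sum : \sum_(i < N) p i 0 = 1
  }.

Definition particle_measure (N : nat) (x p : 'I_N -> R -> R) (t : R)
    (A : set (measurableTypeR R)) : \bar R :=
  (\sum_(i < N) (p i t)%:E * \d_(x i t : measurableTypeR R) A)%E.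

End Particles.

Section WeakSolutions.
Variable R : realType.
Notation BR := (measurableTypeR R).
Notation leb := (@lebesgue_measure R).

Definition Cc_smooth (psi : R -> R) : Prop :=
  (forall n x, derivable (derive1n n psi) x 1) /\
  compact (closure [set x | psi x != 0]).

(* [g] is the (almost everywhere unique) weak derivative of [f]. *)
Definition is_weak_deriv (f g : R -> R) : Prop :=
  [/\ locally_integrable setT f, locally_integrable setT g &
    forall psi, Cc_smooth psi ->
      \int[leb]_x (f x * derive1 psi x) = - \int[leb]_x (g x * psi x)].

Definition L2_norm (f : R -> R) : \bar R := 'N[leb]_2%:E [EFin \o f]%E.

Definition in_H1 (f : R -> R) : Prop :=
  (L2_norm f < +oo)%E /\ exists2 g, is_weak_deriv f g & (L2_norm g < +oo)%E.

(* As weak derivatives of [f] agree almost everywhere, the infimum is over a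
   single value; it is +oo if [f] has no weak derivative. *)
Definition H1_norm (f : R -> R) : \bar R :=
  ereal_inf [set ((L2_norm f ^+ 2 + L2_norm g ^+ 2) `^ 2^-1)%E
            | g in [set g | is_weak_deriv f g]].

(* The space C_b^{0,gamma}([0, oo[; H^1(R)). *)
Definition Cb_holder_H1 (gamma : R) (u : R -> R -> R) : Prop :=
  [/\ forall t, 0 <= t -> in_H1 (u t),
      exists C : R, forall s t, 0 <= s -> 0 <= t ->
        (H1_norm (fun x => u s x - u t x)%R <= (C * `|s - t| `^ gamma)%:E)%E
    & exists M : R, forall t, 0 <= t -> (H1_norm (u t) <= M%:E)%E].

Definition Omega : set (R * R) := [set z | 0 <= z.1].

Definition Dt (phi : R -> R -> R) : R -> R -> R :=
  fun t x => deriv_Rplus (phi ^~ x) t.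

Definition Dx (phi : R -> R -> R) : R -> R -> R :=
  fun t x => derive1 (phi t) x.

(* The iterated partial derivative along a word, [true] standing for Dt and
   [false] for Dx. *)
Definition partial (w : seq bool) (phi : R -> R -> R) : R -> R -> R :=
  foldr (fun b f => if b then Dt f else Dx f) phi w.

(* All iterated partial derivatives exist and are jointly continuous on Omega,
   one-sided in t on the boundary, where [phi] need not vanish. *)
Definition Cc_smooth_Omega (phi : R -> R -> R) : Prop :=
  (forall w : seq bool,
    [/\ forall t x, 0 <= t -> derivable_Rplus (partial w phi ^~ x) t,
        forall t x, 0 <= t -> derivable (partial w phi t) x 1 &
        {within Omega, continuous (fun z : R * R => partial w phi z.1 z.2)}]) /\
  compact (closure [set z : R * R | Omega z /\ phi z.1 z.2 != 0]).

(* m0 = (1 - alpha^2 d^2/dx^2) u0 in the sense of distributions. *)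
Definition is_helmholtz (alpha : R) (u0 : R -> R)
    (m0 : {measure set BR -> \bar R}) : Prop :=
  locally_integrable setT u0 /\
  forall psi, Cc_smooth psi ->
    \int[leb]_x (u0 x * (psi x - alpha ^+ 2 * derive1n 2 psi x)) =
    \int[m0]_x psi x.

(* [ux t] is the weak derivative of [u t]; the inner integral in which it
   occurs does not depend on the chosen representative. *)
Definition weak_CH_solution (alpha : R) (u0 : R -> R)
    (m0 : {measure set BR -> \bar R}) (u : R -> R -> R) : Prop :=
  [/\ is_helmholtz alpha u0 m0,
      u 0 = u0 &
      exists ux : R -> R -> R,
        (forall t, 0 <= t -> is_weak_deriv (u t) (ux t)) /\
        forall phi, Cc_smooth_Omega phi ->
          \int[m0]_x phi 0 x
          + \int[leb]_(t in `[0, +oo[) \int[leb]_x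
              ((Dt phi t x - alpha ^+ 2 * Dx (Dx (Dt phi)) t x) * u t x)
          + \int[leb]_(t in `[0, +oo[) \int[leb]_x
              ((3 / 2 * Dx phi t x - 1 / 2 * alpha ^+ 2 * Dx (Dx (Dx phi)) t x)
               * u t x ^+ 2)
          + \int[leb]_(t in `[0, +oo[) \int[leb]_x
              (1 / 2 * alpha ^+ 2 * Dx phi t x * ux t x ^+ 2)
          = 0].

End WeakSolutions.

(* Main.v *)
(* Testing the particle system against phi and symmetrizing the double sum of
   interactions gives d/dt sum_i p_i phi(t, x_i) = sum_i p_i phi_t(t, x_i)
   + sum_ij p_i p_j K(x_i, x_j), where
     K(a, b) = (phi_x(a) + phi_x(b))/2 G(a - b) - (phi(a) - phi(b))/2 G'(a - b)
   is continuous although G' is not, because the factor phi(a) - phi(b) vanishes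
   on the diagonal.  Integrating products of exponentials piece by piece shows
   that K(a, b) is the integral of
     (3/2 phi_x - alpha^2/2 phi_xxx) G(. - a) G(. - b)
     + alpha^2/2 phi_x G'(. - a) G'(. - b),
   so that for any measure m the double integral of K against m x m is the
   nonlinear part of the weak Camassa-Holm equation for u = G * m.

   Momenta stay nonnegative with sum 1, hence velocities and relative momentum
   rates are bounded uniformly in N.  Helly selection, applied to the quantile
   functions at rational times, and this equicontinuity in time give a
   subsequence converging weak-star at every time.  The double sums of K converge
   because a -> int K(a, b) dm(a) is again in C_0 and convergence is uniform in b.

   For w = u(t) - u(s) one has |w|_{L^2}^2 + alpha^2 |w_x|_{L^2}^2
   = int w d(m(t) - m(s)), which is at most 2 sup |w| = O(|t - s|), as the
   translates G(z - .) are Lipschitz elements of C_0; this is the exponent 1/2. *)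
Require Import Defs.
From HB Require Import structures.
From mathcomp Require Import all_boot all_order all_algebra.
From mathcomp Require Import all_classical all_reals all_analysis.
From mathcomp Require Import measurable_realfun ring lra.
Import Order.TTheory GRing.Theory Num.Theory.
Import numFieldNormedType.Exports.
Local Open Scope classical_set_scope.
Local Open Scope ring_scope.
Set Implicit Arguments.
Unset Strict Implicit.

(** * Integration of piecewise smooth functions *)

(** The limit [m t] is only known to have mass at most 1, so every passage to the limit is tested
    against [C_0]. This is why the pair kernel and its average must vanish at infinity, and why
    [u 0 = u_0] is read off from [G(z - .)], itself in [C_0]. At an arbitrary time a candidate limit
    comes from a further subsequence depending on that time; comparison with a nearby rational time
    then gives convergence along the common subsequence. [G'] jumps at 0. Its value 0 there matches
    [sgn(0) = 0]; along particle paths the jump is never crossed, since the order of the particles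
    is strict. The bounds uniform in N rest on the sign of the momenta, which comes from a Gronwall
    comparison on a bounded time interval, with a constant that depends on N. Splitting the time
    integral requires each x-integral to be integrable in [t]. For the [u_x^2] term no regularity in
    time is available directly: it is written as a combination of three integrable functions. The
    full limit term and the linear term are bounded limits of continuous particle terms, and the
    [u^2] term is continuous in [t]. *)

Definition has_derivative (R : realType) (f : R -> R) (z df : R) : Prop :=
  is_derive z (1 : R) f df.

Section itv.
Variable R : realType.
Notation leb := (@lebesgue_measure R).

Lemma cvg_uniqueR (u : nat -> R) (a b : R) :
  u n @[n --> \oo] --> a -> u n @[n --> \oo] --> b -> a = b.
Proof. exact: (@cvg_unique _ (@Rhausdorff R)). Qed.

Lemma cvg_norm_le (u : nat -> R) (l C : R) :
  u n @[n --> \oo] --> l -> (forall n, `|u n| <= C) -> `|l| <= C.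
Proof.
move=> /cvg_norm ul uC; rewrite -(cvg_lim (@Rhausdorff R) ul).
by apply: limr_le; [apply/cvg_ex; eexists; exact: ul|exact: nearW].
Qed.

(** The endpoints are null sets, so agreement of [q] with the continuous [q'] inside the interval
    suffices. This admits integrands such as [dGreen], which jump at the break points. *)
Lemma Rintegral_FTC (q q' g : R -> R) (s t : R) : s <= t ->
  leb.-integrable setT (EFin \o q) ->
  (forall z : R, has_derivative g z (q' z)) -> continuous q' ->
  (forall z, s < z < t -> q z = q' z) ->
  \int[leb]_(z in `[s, t]) q z = g t - g s.
Proof.
move=> st iq dg cq' qq'.
have [<-|nst] := eqVneq s t.
  by rewrite set_itv1 Rintegral_set1 subrr.
have {}st : s < t by rewrite lt_neqAle nst.
have iqS (A : set R) : measurable A -> leb.-integrable A (EFin \o q).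
  by move=> mA; exact: integrableS iq.
have iq' : leb.-integrable `[s, t] (EFin \o q').
  apply: continuous_compact_integrable; first exact: segment_compact.
  exact: continuous_subspaceT.
have iqo' : leb.-integrable `]s, t[ (EFin \o q').
  by apply: integrableS iq' => //; exact: subset_itv_oo_cc.
rewrite -Rintegral_itv_obnd_cbnd; last exact: iqS.
rewrite -Rintegral_itv_bndo_bndc; last exact: iqS.
transitivity (\int[leb]_(z in `]s, t[) q' z).
  by apply: eq_Rintegral => z; rewrite inE/= in_itv/=; exact: qq'.
rewrite Rintegral_itv_bndo_bndc//.
rewrite Rintegral_itv_obnd_cbnd; last first.
  by apply: integrableS iq' => //; exact: subset_itv_oc_cc.
rewrite /Rintegral (@continuous_FTC2 _ q' g)//.
- exact: continuous_subspaceT.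
- have cg : continuous g.
    by move=> z; apply/differentiable_continuous/derivable1_diffP; case: (dg z).
  split; first by move=> z _; case: (dg z).
    exact/cvg_at_right_filter/cg.
  exact/cvg_at_left_filter/cg.
- by move=> z _; rewrite derive1E; exact: (@derive_val _ _ _ _ _ _ _ (dg z)).
Qed.

Lemma cvg_Rintegral_itvNn (q : R -> R) : leb.-integrable setT (EFin \o q) ->
  \int[leb]_(z in `[- n%:R, n%:R]) q z @[n --> \oo] --> \int[leb]_z q z.
Proof.
move=> iq.
have mq : measurable_fun setT q.
  by apply/measurable_EFinP; exact: (measurable_int leb iq).
under eq_cvg do rewrite Rintegral_mkcond.
apply: fine_cvg; rewrite fineK; last exact: integrable_fin_num.
pose f_ := fun n : nat => EFin \o (q \_ `[- n%:R, n%:R]).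
have [] := @dominated_convergence _ _ _ leb setT measurableT
   f_ (EFin \o q) (abse \o (EFin \o q)); last first.
- by move=> _ _; exact.
- apply/aeW => z n _ /=; rewrite /f_/= patchE; case: ifP => _ //=.
  by rewrite [point](_ : _ = 0 :> R)// normr0 lee_fin.
- exact: integrable_abse.
- apply/aeW => z _; apply: cvg_EFin; first by apply: nearW.
  apply: cvg_near_cst; near=> n; apply/eqP; rewrite /comp/= patchE mem_set//= in_itv/=.
  by rewrite -ler_norml; near: n; exact: nbhs_infty_ger.
- by apply/measurable_EFinP.
- move=> n; apply/measurable_EFinP; apply/(measurable_restrict _ _ _) => //.
  exact: measurable_funS mq.
Unshelve. all: by end_near. Qed.

(** Each piece is integrated by its own primitive, smooth on the whole line. With [a = b] the middle
    piece is void, which is how kernels with a single kink are treated. *)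
Lemma Rintegral_piecewise (q qL qM qR gL gM gR : R -> R) (a b : R) : a <= b ->
  leb.-integrable setT (EFin \o q) ->
  (forall z : R, has_derivative gL z (qL z)) -> continuous qL ->
  (forall z : R, has_derivative gM z (qM z)) -> continuous qM ->
  (forall z : R, has_derivative gR z (qR z)) -> continuous qR ->
  (forall z, z < a -> q z = qL z) ->
  (forall z, a < z < b -> q z = qM z) ->
  (forall z, b < z -> q z = qR z) ->
  gL z @[z --> -oo] --> (0 : R) -> gR z @[z --> +oo] --> (0 : R) ->
  \int[leb]_z q z = gL a + (gM b - gM a) - gR b.
Proof.
move=> ab iq dL cL dM cM dR cR eL eM eR gL0 gR0.
have iqS (A : set R) : measurable A -> leb.-integrable A (EFin \o q).
  by move=> mA; exact: integrableS iq.
apply: (cvg_uniqueR (cvg_Rintegral_itvNn iq)).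
have : (fun n : nat => gL a - gL (- n%:R) + (gM b - gM a) + (gR n%:R - gR b)) @ \oo -->
   gL a - 0 + (gM b - gM a) + (0 - gR b).
  have cn : (n%:R : R) @[n --> \oo] --> +oo by exact: cvgr_idn.
  have H1 : gL (- n%:R) @[n --> \oo] --> (0 : R).
    by apply: (cvg_comp _ _ _ gL0); apply/cvgNrNy; exact: cn.
  have H2 : gR (n%:R) @[n --> \oo] --> (0 : R) by exact: cvg_comp cn gR0.
  by apply: cvgD; [apply: cvgD; [apply: cvgB => //; exact: cvg_cst|exact: cvg_cst]|
     apply: cvgB => //; exact: cvg_cst].
rewrite subr0 sub0r; apply: cvg_trans; apply: near_eq_cvg; near=> n.
have nab : `|a| + `|b| <= n%:R by near: n; exact: nbhs_infty_ger.
have [h1 h2] : - n%:R <= a /\ b <= n%:R.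
  have := normr_ge0 a; have := normr_ge0 b.
  by move: nab (ler_norm b) (ler_norm (- a)); rewrite normrN; lra.
have := @Rintegral_itvB _ q (BLeft (- n%:R)) (BRight n%:R) b (iqS _ _).
rewrite !bnd_simp => /(_ _ _ h2) H.
have := @Rintegral_itvB _ q (BLeft (- n%:R)) (BRight b) a (iqS _ _).
rewrite !bnd_simp => /(_ _ h1 ab) H'.
have E1 : \int[leb]_(z in `[- n%:R, a]) q z = gL a - gL (- n%:R).
  by apply: (@Rintegral_FTC _ qL) => // z /andP[_]; exact: eL.
have E2 : \int[leb]_(z in `[a, b]) q z = gM b - gM a.
  by apply: (@Rintegral_FTC _ qM).
have E3 : \int[leb]_(z in `[b, n%:R]) q z = gR n%:R - gR b.
  by apply: (@Rintegral_FTC _ qR) => // z /andP[+ _]; exact: eR.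
rewrite -E1 -E2 -E3.
rewrite -(@Rintegral_itv_obnd_cbnd _ b); last exact: iqS.
rewrite -(@Rintegral_itv_obnd_cbnd _ a); last exact: iqS.
rewrite -H -?H' //; last by move: h1 ab; lra.
ring.
Unshelve. all: by end_near. Qed.

End itv.

(** * Exponential kernels *)

Section derivative_rules.
Variable R : realType.
Implicit Types f g : R -> R.

Lemma has_derivative_addr f g (z df dg : R) : has_derivative f z df ->
  has_derivative g z dg -> has_derivative (fun y => f y + g y) z (df + dg).
Proof. by rewrite /has_derivative => Hf Hg; exact: is_deriveD. Qed.

Lemma has_derivative_subr f g (z df dg : R) : has_derivative f z df ->
  has_derivative g z dg -> has_derivative (fun y => f y - g y) z (df - dg).
Proof. by rewrite /has_derivative => Hf Hg; exact: is_deriveB. Qed.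

Lemma has_derivative_oppr f (z df : R) : has_derivative f z df ->
  has_derivative (fun y => - f y) z (- df).
Proof. by rewrite /has_derivative => Hf; exact: is_deriveN. Qed.

Lemma has_derivative_mulr f g (z df dg : R) : has_derivative f z df ->
  has_derivative g z dg ->
  has_derivative (fun y => f y * g y) z (f z * dg + g z * df).
Proof. by rewrite /has_derivative => Hf Hg; exact: is_deriveM. Qed.

Lemma has_derivative_mull f (k z df : R) : has_derivative f z df ->
  has_derivative (fun y => k * f y) z (k * df).
Proof. by rewrite /has_derivative => Hf; exact: is_deriveZ. Qed.

Lemma has_derivative_const (k z : R) : has_derivative (fun=> k) z 0.
Proof. by rewrite /has_derivative; exact: is_derive_cst. Qed.

Lemma has_derivative_idr (z : R) : has_derivative (fun y => y) z 1.
Proof. by rewrite /has_derivative; exact: is_derive_id. Qed.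

Lemma has_derivative_conv f (z df df' : R) : has_derivative f z df -> df = df' ->
  has_derivative f z df'.
Proof. by move=> + <-. Qed.

Lemma has_derivative_continuous f f1 : (forall z : R, has_derivative f z (f1 z)) ->
  continuous f.
Proof.
by move=> df z; apply/differentiable_continuous/derivable1_diffP; case: (df z).
Qed.

Lemma continuous_addr f g : continuous f -> continuous g ->
  continuous (fun y => f y + g y).
Proof. by move=> cf cg z; apply: cvgD; [exact: cf|exact: cg]. Qed.

Lemma continuous_subr f g : continuous f -> continuous g ->
  continuous (fun y => f y - g y).
Proof. by move=> cf cg z; apply: cvgB; [exact: cf|exact: cg]. Qed.

Lemma continuous_oppr f : continuous f -> continuous (fun y => - f y).
Proof. by move=> cf z; apply: cvgN; exact: cf. Qed.

Lemma continuous_mulr f g : continuous f -> continuous g ->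
  continuous (fun y => f y * g y).
Proof. by move=> cf cg z; apply: cvgM; [exact: cf|exact: cg]. Qed.

Lemma continuous_const (k : R) : continuous (fun _ : R => k).
Proof. by move=> z; exact: cvg_cst. Qed.

End derivative_rules.

(** Differentiation directed by syntax. Subtraction is tried before addition because [x - y] is the
    sum of [x] and [- y]; a constant left factor takes the scalar rule. *)
Ltac derive_step := cbv beta; lazymatch goal with
  | |- has_derivative (fun x => x) _ _ => exact: has_derivative_idr
  | |- has_derivative (fun _ => ?c) _ _ => exact: has_derivative_const
  | |- has_derivative (fun x => @GRing.add _ (@?f x) (@GRing.opp _ (@?g x))) _ _ =>
      apply: (@has_derivative_subr _ f g)
  | |- has_derivative (fun x => @GRing.add _ (@?f x) (@?g x)) _ _ =>
      apply: (@has_derivative_addr _ f g)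
  | |- has_derivative (fun x => @GRing.opp _ (@?f x)) _ _ =>
      apply: (@has_derivative_oppr _ f)
  | |- has_derivative (fun x => @GRing.mul _ (@?f x) (@?g x)) _ _ =>
      lazymatch f with
      | fun _ => ?k => apply: (@has_derivative_mull _ g k)
      | _ => apply: (@has_derivative_mulr _ f g)
      end
  | H : forall y, has_derivative ?f y _ |- has_derivative (fun x => ?f x) _ _ =>
      exact: H
  | H : forall y, has_derivative ?f y _ |- has_derivative ?f _ _ => exact: H
  end.

Ltac cont_step := cbv beta; lazymatch goal with
  | |- continuous (fun _ => ?c) => exact: continuous_const
  | |- continuous (fun x => @GRing.add _ (@?f x) (@GRing.opp _ (@?g x))) =>
      apply: (@continuous_subr _ f g)
  | |- continuous (fun x => @GRing.add _ (@?f x) (@?g x)) =>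
      apply: (@continuous_addr _ f g)
  | |- continuous (fun x => @GRing.opp _ (@?f x)) => apply: (@continuous_oppr _ f)
  | |- continuous (fun x => @GRing.mul _ (@?f x) (@?g x)) =>
      apply: (@continuous_mulr _ f g)
  | H : continuous ?f |- continuous (fun x => ?f x) => exact: H
  | H : continuous ?f |- continuous ?f => exact: H
  end.

Section Green_calculus.
Variable R : realType.
Variable alpha : R.
Hypothesis alpha_gt0 : 0 < alpha.
Notation leb := (@lebesgue_measure R).

Let alpha_neq0 : alpha != 0. Proof. by rewrite gt_eqF. Qed.

Definition Eabs (d : R) : R := expR (- `|d| / alpha).
(** This is [G'] away from 0. The value 0 at the origin, due to [sgn 0 = 0], agrees with the
    convention of the particle system. *)
Definition dGreen (d : R) : R := - ((2 * alpha ^+ 2)^-1 * Num.sg d * Eabs d).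
(** [exp_left c] and [exp_right c] are the two branches of [Eabs (z - c)], each continued smoothly
    past the kink at [c], so that piecewise integration has primitives on the whole line. *)
Definition exp_left (c z : R) : R := expR ((z - c) / alpha).
Definition exp_right (c z : R) : R := expR (- (z - c) / alpha).

Lemma GreenE d : Green alpha d = (2 * alpha)^-1 * Eabs d.
Proof. by []. Qed.

Lemma has_derivative_exp_left c z : has_derivative (exp_left c) z (exp_left c z / alpha).
Proof.
have h : has_derivative (fun z => (z - c) / alpha) z alpha^-1.
  apply: has_derivative_conv; first by do !derive_step.
  by rewrite /=; ring.
apply: has_derivative_conv; first exact: (@is_derive1_comp _ expR _ _ _ _ _ h).
by rewrite mulrC.
Qed.

Lemma has_derivative_exp_right c z : has_derivative (exp_right c) z (- (exp_right c z / alpha)).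
Proof.
have h : has_derivative (fun z => - (z - c) / alpha) z (- alpha^-1).
  apply: has_derivative_conv; first by do !derive_step.
  by rewrite /=; ring.
apply: has_derivative_conv; first exact: (@is_derive1_comp _ expR _ _ _ _ _ h).
by rewrite mulrN.
Qed.

Lemma continuous_exp_left c : continuous (exp_left c).
Proof. exact: has_derivative_continuous (has_derivative_exp_left c). Qed.

Lemma continuous_exp_right c : continuous (exp_right c).
Proof. exact: has_derivative_continuous (has_derivative_exp_right c). Qed.

Lemma cvg_exp_righty c : exp_right c z @[z --> +oo] --> (0 : R).
Proof.
rewrite /exp_right; under eq_cvg do rewrite mulNr.
have := @cvgr_expR R; apply: cvg_comp.
apply/cvgryPge => A; near=> z; rewrite ler_pdivlMr// lerBrDr.
by near: z; apply: nbhs_pinfty_ge; rewrite num_real.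
Unshelve. all: by end_near. Qed.

Lemma cvg_exp_leftNy c : exp_left c z @[z --> -oo] --> (0 : R).
Proof.
rewrite /exp_left; under eq_cvg do rewrite -[X in expR X]opprK.
have := @cvgr_expR R; apply: cvg_comp.
apply/cvgryPge => A; near=> z; rewrite -mulNr ler_pdivlMr// opprB lerBrDl -lerBrDr.
by near: z; apply: nbhs_ninfty_le; rewrite num_real.
Unshelve. all: by end_near. Qed.

Lemma EabsL c z : z <= c -> Eabs (z - c) = exp_left c z.
Proof. by move=> zc; rewrite /Eabs ler0_norm ?subr_le0// opprK. Qed.

Lemma EabsR c z : c <= z -> Eabs (z - c) = exp_right c z.
Proof. by move=> zc; rewrite /Eabs ger0_norm ?subr_ge0. Qed.

Lemma EabsN d : Eabs (- d) = Eabs d.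
Proof. by rewrite /Eabs normrN. Qed.

Lemma Eabs_gt0 d : 0 < Eabs d. Proof. exact: expR_gt0. Qed.

Lemma Eabs_ge0 d : 0 <= Eabs d. Proof. exact: expR_ge0. Qed.

Lemma Eabs_le1 d : Eabs d <= 1.
Proof. by rewrite /Eabs expR_le1 mulNr oppr_le0 divr_ge0 ?normr_ge0// ltW. Qed.

Lemma dGreenL c z : z < c -> dGreen (z - c) = (2 * alpha ^+ 2)^-1 * exp_left c z.
Proof.
move=> zc; rewrite /dGreen EabsL ?ltW// ltr0_sg ?subr_lt0//.
by rewrite mulrN1 mulNr opprK.
Qed.

Lemma dGreenR c z : c < z -> dGreen (z - c) = - ((2 * alpha ^+ 2)^-1 * exp_right c z).
Proof.
by move=> zc; rewrite /dGreen EabsR ?ltW// gtr0_sg ?subr_gt0// mulr1.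
Qed.

Lemma measurable_Eabs : measurable_fun setT Eabs.
Proof.
apply: measurableT_comp => //; apply: measurable_funM => //.
by apply: measurable_funN; exact: normr_measurable.
Qed.

Lemma measurable_sgr : measurable_fun setT (@Num.sg R).
Proof.
apply: nondecreasing_measurable => // x y xy; rewrite /Num.sg.
case: (ltrgt0P x) => x0; case: (ltrgt0P y) => y0 //; lra.
Qed.

Lemma measurable_Green : measurable_fun setT (Green alpha).
Proof. by apply: measurable_funM => //; exact: measurable_Eabs. Qed.

Lemma measurable_dGreen : measurable_fun setT dGreen.
Proof.
apply: measurable_funN; apply: measurable_funM; last exact: measurable_Eabs.
by apply: measurable_funM => //; exact: measurable_sgr.
Qed.

Let integral_exp_right c : (\int[leb]_(z in `[c, +oo[) (Eabs (z - c))%:E = alpha%:E)%E.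
Proof.
transitivity (\int[leb]_(z in `[c, +oo[) (exp_right c z)%:E)%E.
  by apply: eq_integral => z; rewrite inE/= in_itv/= andbT => /EabsR ->.
rewrite (@ge0_continuous_FTC2y _ _ (fun z => - alpha * exp_right c z) _ 0).
- by rewrite /exp_right subrr oppr0 mul0r expR0 mulr1 -EFinB sub0r opprK.
- by move=> z _; exact: expR_ge0.
- by apply: continuous_subspaceT; exact: continuous_exp_right.
- rewrite -(mulr0 (- alpha)); apply: cvgM; [exact: cvg_cst|exact: cvg_exp_righty].
- by move=> z _; case: (has_derivative_mull (- alpha) (has_derivative_exp_right c z)).
- apply/cvg_at_right_filter; apply: (has_derivative_continuous
    (fun z => has_derivative_mull (- alpha) (has_derivative_exp_right c z))).
- move=> z _; rewrite derive1E.
  rewrite (@derive_val _ _ _ _ _ _ _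
    (has_derivative_mull (- alpha) (has_derivative_exp_right c z))).
  by field.
Qed.

(** The left half-line is reflected onto a right one; each half contributes [alpha]. *)
Lemma integral_Eabs c : (\int[leb]_z (Eabs (z - c))%:E = (2 * alpha)%:E)%E.
Proof.
have cE : continuous (fun z => Eabs (z - c)).
  move=> z; rewrite /Eabs; apply: continuous_comp; last exact: continuous_expR.
  apply: cvgM; last exact: cvg_cst; apply: cvgN; apply: cvg_norm.
  by apply: cvgB; [exact: cvg_id|exact: cvg_cst].
have mE := continuous_measurable_fun cE.
have -> : [set: R] = `]-oo, c] `|` `]c, +oo[.
  apply/seteqP; split => // z _.
  by case: (leP z c) => zc; [left|right]; rewrite /= in_itv/= ?andbT.
rewrite ge0_integral_setU//=; last 3 first.
- by apply/measurable_EFinP; exact: measurable_funS mE.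
- by move=> z _; rewrite lee_fin Eabs_ge0.
- apply/disj_setPS => z [] /=; rewrite !in_itv/= andbT => zc cz.
  by move: (lt_le_trans cz zc); rewrite ltxx.
rewrite integral_itv_obnd_cbnd; last first.
  by apply/measurable_EFinP; exact: measurable_funS mE.
rewrite integral_exp_right -[X in `]-oo, X]](opprK c).
rewrite (@ge0_integration_by_substitutionNy _ (fun z => Eabs (z - c)) (- c)).
- transitivity (\int[leb]_(z in `[(- c)%R, +oo[) (Eabs (z - - c))%:E + alpha%:E)%E.
    congr (_ + _)%E; apply: eq_integral => z _ /=.
    by rewrite -EabsN; congr (Eabs _)%:E; ring.
  by rewrite integral_exp_right -EFinD; congr EFin; ring.
- exact: continuous_subspaceT.
- by move=> z _; exact: Eabs_ge0.
Qed.

Lemma integrable_le_Eabs (q : R -> R) (C c : R) : measurable_fun setT q ->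
  (forall z, `|q z| <= C * Eabs (z - c)) -> leb.-integrable setT (EFin \o q).
Proof.
move=> mq qC.
have iE : leb.-integrable setT (fun z => (Eabs (z - c))%:E).
  apply/integrableP; split.
    apply/measurable_EFinP; apply: (measurableT_comp measurable_Eabs) => //.
    exact: measurable_funB.
  under eq_integral do rewrite /= ger0_norm ?Eabs_ge0//.
  by rewrite integral_Eabs ltry.
have iCE := integrableZl measurableT C iE.
apply: (le_integrable measurableT _ _ iCE); first exact/measurable_EFinP.
by move=> z _; rewrite lee_fin/= (le_trans (qC z))// ler_norm.
Qed.

End Green_calculus.

(** * Identities for the Green function *)

Section compact_support.
Variable R : realType.
Implicit Types (f : R -> R) (A : R).

(** The set where [A < |z|] is open, so [f] vanishes in a neighbourhood of each of its points. *)
Lemma has_derivative_supp f f1 A : (forall z, has_derivative f z (f1 z)) ->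
  (forall z, A < `|z| -> f z = 0) -> forall z, A < `|z| -> f1 z = 0.
Proof.
move=> df f0 z Az.
have h : \forall y \near z, (fun=> 0 : R) y = f y.
  near=> y; apply/esym/f0; near: y.
  have : `|y| @[y --> z] --> `|z| by apply: cvg_norm; exact: cvg_id.
  by move/cvgr_gt; exact.
have d0 : has_derivative (fun=> 0 : R) z 0 by exact: has_derivative_const.
have := @near_eq_is_derive _ _ _ _ _ _ _ _ h d0.
by move/@derive_val => <-; have /@derive_val := df z.
Unshelve. all: by end_near. Qed.

Lemma compact_support_bounded f A : continuous f ->
  (forall z, A < `|z| -> f z = 0) -> exists2 M : R, 0 <= M & forall z, `|f z| <= M.
Proof.
move=> cf f0.
have cnf : continuous (fun z => `|f z|).
  by move=> z; apply: cvg_norm; exact: cf.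
(* [A] may be negative; the segment with ends [- |A|] and [|A|] is never empty. *)
have AA : - `|A| <= `|A| by rewrite ge0_cp.
have [c _ cmax] := EVT_max AA (continuous_subspaceT cnf).
exists `|f c| => // z; have [zA|Az] := leP `|z| `|A|.
  by apply: cmax; rewrite in_itv/= -ler_norml.
by rewrite f0 ?normr0// (le_lt_trans _ Az)// ler_norm.
Qed.

Lemma compact_support_cvgy f A : (forall z, A < `|z| -> f z = 0) ->
  f z @[z --> +oo] --> (0 : R).
Proof.
move=> f0; apply: cvg_near_cst; near=> z; rewrite f0//.
rewrite (lt_le_trans _ (ler_norm _))//; near: z; apply: nbhs_pinfty_gt; rewrite num_real.
Unshelve. all: by end_near. Qed.

Lemma compact_support_cvgNy f A : (forall z, A < `|z| -> f z = 0) ->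
  f z @[z --> -oo] --> (0 : R).
Proof.
move=> f0; apply: cvg_near_cst; near=> z; rewrite f0//.
rewrite -normrN (lt_le_trans _ (ler_norm _))// ltrNr.
by near: z; apply: nbhs_ninfty_lt; rewrite num_real.
Unshelve. all: by end_near. Qed.

End compact_support.

Section Green_identities.
Variable R : realType.
Variable alpha : R.
Hypothesis alpha_gt0 : 0 < alpha.
Notation leb := (@lebesgue_measure R).
Notation G := (Green alpha).
Notation DG := (dGreen alpha).
Notation EL := (exp_left alpha).
Notation ER := (exp_right alpha).

Let alpha_neq0 : alpha != 0. Proof. by rewrite gt_eqF. Qed.

Lemma GreenL c z : z <= c -> G (z - c) = (2 * alpha)^-1 * EL c z.
Proof. by move=> zc; rewrite GreenE EabsL. Qed.

Lemma GreenR c z : c <= z -> G (z - c) = (2 * alpha)^-1 * ER c z.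
Proof. by move=> zc; rewrite GreenE EabsR. Qed.

Lemma Green_ge0 d : 0 <= G d.
Proof. by rewrite GreenE mulr_ge0 ?Eabs_ge0// invr_ge0 mulr_ge0// ltW. Qed.

Lemma norm_Green d : `|G d| <= (2 * alpha)^-1 * Eabs alpha d.
Proof. by rewrite ger0_norm ?Green_ge0. Qed.

Lemma norm_dGreen d : `|DG d| <= (2 * alpha ^+ 2)^-1 * Eabs alpha d.
Proof.
rewrite /dGreen normrN !normrM (ger0_norm (Eabs_ge0 _ _)).
rewrite ler_wpM2r ?Eabs_ge0//.
rewrite (@ger0_norm _ (_^-1)); last by rewrite invr_ge0 mulr_ge0// exprn_ge0// ltW.
rewrite ler_piMr//; last by rewrite normr_sg; case: (_ == _).
by rewrite invr_ge0 mulr_ge0// exprn_ge0// ltW.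
Qed.

Lemma integrable_bounded_kernel (W h : R -> R) (M C c : R) :
  measurable_fun setT W -> (forall z, `|W z| <= M) ->
  measurable_fun setT h -> (forall z, `|h z| <= C * Eabs alpha z) ->
  leb.-integrable setT (EFin \o (fun z => W z * h (z - c))).
Proof.
move=> mW WM mh hC.
apply: (@integrable_le_Eabs _ _ alpha_gt0 _ (M * C) c).
  apply: measurable_funM => //; apply: (measurableT_comp mh).
  exact: measurable_funB.
by move=> z; rewrite normrM -mulrA ler_pM.
Qed.

Let expRl a : EL a a = 1. Proof. by rewrite /exp_left subrr mul0r expR0. Qed.
Let expRr a : ER a a = 1. Proof. by rewrite /exp_right subrr oppr0 mul0r expR0. Qed.
Let ELR a b : EL b a = ER a b.
Proof. by rewrite /exp_left /exp_right opprB. Qed.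

Ltac derive_exp := cbv beta; lazymatch goal with
  | |- has_derivative (fun x => exp_left ?a ?c x) _ _ => exact: has_derivative_exp_left
  | |- has_derivative (fun x => exp_right ?a ?c x) _ _ => exact: has_derivative_exp_right
  | _ => derive_step end.
Ltac derive := apply: has_derivative_conv; [by do !derive_exp | rewrite /=; field].
Ltac cont_exp := cbv beta; lazymatch goal with
  | |- continuous (fun x => exp_left ?a ?c x) => exact: continuous_exp_left
  | |- continuous (fun x => exp_right ?a ?c x) => exact: continuous_exp_right
  | _ => cont_step end.
Ltac cont := by do !cont_exp.

(** On either side of [c] the sum of the two integrands is the derivative of [f G(. - c)]. This
    product is continuous at [c], so the boundary terms there cancel and no Dirac term appears. *)
Lemma integral_dGreen (f f1 : R -> R) (A c : R) :
  (forall z, has_derivative f z (f1 z)) -> continuous f1 ->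
  (forall z, A < `|z| -> f z = 0) ->
  \int[leb]_z (f1 z * G (z - c)) = - \int[leb]_z (f z * DG (z - c)).
Proof.
move=> df cf1 f0; have cf := has_derivative_continuous df.
have f10 := has_derivative_supp df f0.
have [M M0 fM] := compact_support_bounded cf f0.
have [M1 M10 f1M] := compact_support_bounded cf1 f10.
have i1 : leb.-integrable setT (EFin \o (fun z => f1 z * G (z - c))).
  apply: integrable_bounded_kernel f1M _ norm_Green.
    exact: continuous_measurable_fun.
  exact: measurable_Green.
have i2 : leb.-integrable setT (EFin \o (fun z => f z * DG (z - c))).
  apply: integrable_bounded_kernel fM _ norm_dGreen.
    exact: continuous_measurable_fun.
  exact: measurable_dGreen.
apply/eqP; rewrite -subr_eq0 opprK -RintegralD//; apply/eqP.
rewrite (@Rintegral_piecewise _ _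
  (fun z => (2 * alpha)^-1 * (f1 z * EL c z + f z * (EL c z / alpha)))
  (fun=> 0 : R)
  (fun z => (2 * alpha)^-1 * (f1 z * ER c z - f z * (ER c z / alpha)))
  (fun z => (2 * alpha)^-1 * (f z * EL c z)) (fun=> 0 : R)
  (fun z => (2 * alpha)^-1 * (f z * ER c z)) c c).
- by rewrite expRl expRr; ring.
- exact: lexx.
- exact: (integrableD measurableT i1 i2).
- by move=> z; derive.
- cont.
- by move=> z; exact: has_derivative_const.
- exact: continuous_const.
- by move=> z; derive.
- cont.
- move=> z zc; rewrite GreenL ?ltW// dGreenL//; field => //.
- by move=> z /andP[cz zc]; move: (lt_trans cz zc); rewrite ltxx.
- move=> z zc; rewrite GreenR ?ltW// dGreenR//; field => //.
- apply: (@compact_support_cvgNy _ _ A) => z /f0 ->; ring.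
- apply: (@compact_support_cvgy _ _ A) => z /f0 ->; ring.
Qed.

(** [G] is the fundamental solution of [1 - alpha^2 d^2/dx^2]. The primitives are
    [(alpha f - alpha^2 f1)] times the left exponential and [(- alpha f - alpha^2 f1)] times the
    right one; their gap at [c] is [2 alpha f c], up to the factor [(2 alpha)^-1]. *)
Lemma integral_helmholtz_Green (f f1 f2 : R -> R) (A c : R) :
  (forall z, has_derivative f z (f1 z)) ->
  (forall z, has_derivative f1 z (f2 z)) -> continuous f2 ->
  (forall z, A < `|z| -> f z = 0) ->
  \int[leb]_z ((f z - alpha ^+ 2 * f2 z) * G (z - c)) = f c.
Proof.
move=> df df1 cf2 f0; have cf := has_derivative_continuous df.
have cf1 := has_derivative_continuous df1.
have f10 := has_derivative_supp df f0.
have f20 := has_derivative_supp df1 f10.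
have cW : continuous (fun z => f z - alpha ^+ 2 * f2 z) by cont.
have [M M0 WM] : exists2 M : R, 0 <= M & forall z, `|f z - alpha ^+ 2 * f2 z| <= M.
  apply: (@compact_support_bounded _ _ A) => // z Az.
  by rewrite f0// f20// mulr0 subr0.
rewrite (@Rintegral_piecewise _ _
  (fun z => (2 * alpha)^-1 * ((f z - alpha ^+ 2 * f2 z) * EL c z))
  (fun=> 0 : R)
  (fun z => (2 * alpha)^-1 * ((f z - alpha ^+ 2 * f2 z) * ER c z))
  (fun z => (2 * alpha)^-1 * ((alpha * f z - alpha ^+ 2 * f1 z) * EL c z))
  (fun=> 0 : R)
  (fun z => (2 * alpha)^-1 * ((- alpha * f z - alpha ^+ 2 * f1 z) * ER c z))
  c c).
- by rewrite expRl expRr; field.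
- exact: lexx.
- apply: integrable_bounded_kernel WM _ norm_Green.
    exact: continuous_measurable_fun.
  exact: measurable_Green.
- by move=> z; derive.
- cont.
- by move=> z; exact: has_derivative_const.
- exact: continuous_const.
- by move=> z; derive.
- cont.
- by move=> z zc; rewrite GreenL ?ltW//; ring.
- by move=> z /andP[cz zc]; move: (lt_trans cz zc); rewrite ltxx.
- by move=> z zc; rewrite GreenR ?ltW//; ring.
- by apply: (@compact_support_cvgNy _ _ A) => z Az; rewrite f0// f10//; ring.
- by apply: (@compact_support_cvgy _ _ A) => z Az; rewrite f0// f10//; ring.
Qed.

Definition CH_kernel (f f1 : R -> R) (a b : R) : R :=
  2^-1 * (f1 a + f1 b) * G (a - b) - 2^-1 * (f a - f b) * DG (a - b).

Lemma CH_kernelC f f1 a b : CH_kernel f f1 a b = CH_kernel f f1 b a.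
Proof.
rewrite /CH_kernel /dGreen !GreenE -(opprB b a) EabsN sgrN; ring.
Qed.

(** Left of its kink [DG] equals [G / alpha], right of it [- G / alpha]. Outside [[a, b]] the two
    slopes have the same sign, and [f1] gets the coefficient [3/2 + 1/2 = 2]; between [a] and [b] it
    gets [3/2 - 1/2 = 1]. *)
Lemma integral_CH_kernel (f f1 f2 f3 : R -> R) (A a b : R) :
  (forall z, has_derivative f z (f1 z)) ->
  (forall z, has_derivative f1 z (f2 z)) ->
  (forall z, has_derivative f2 z (f3 z)) -> continuous f3 ->
  (forall z, A < `|z| -> f z = 0) ->
  \int[leb]_z ((3 / 2 * f1 z - 1 / 2 * alpha ^+ 2 * f3 z) * G (z - a) * G (z - b)
               + 1 / 2 * alpha ^+ 2 * f1 z * DG (z - a) * DG (z - b))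
  = CH_kernel f f1 a b.
Proof.
move=> df df1 df2 cf3 f0.
wlog ab : a b / a <= b.
  move=> H; have [|/ltW] := leP a b; first exact: H.
  by move/H => E; rewrite CH_kernelC -E; apply: eq_Rintegral => z _; ring.
have cf := has_derivative_continuous df.
have cf1 := has_derivative_continuous df1.
have cf2 := has_derivative_continuous df2.
have f10 := has_derivative_supp df f0.
have f20 := has_derivative_supp df1 f10.
have f30 := has_derivative_supp df2 f20.
have [M1 M10 f1M] := compact_support_bounded cf1 f10.
have [M3 M30 f3M] := compact_support_bounded cf3 f30.
have c1 : 0 <= 3 / 2 :> R by lra.
have c2 : 0 <= 1 / 2 * alpha ^+ 2 by rewrite mulr_ge0 ?sqr_ge0//; lra.
have Gb y : `|G y| <= (2 * alpha)^-1.
  rewrite (le_trans (norm_Green y))// ler_piMr ?Eabs_le1//.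
  by rewrite invr_ge0 mulr_ge0// ltW.
have DGb y : `|DG y| <= (2 * alpha ^+ 2)^-1.
  rewrite (le_trans (norm_dGreen y))// ler_piMr ?Eabs_le1//.
  by rewrite invr_ge0 mulr_ge0// exprn_ge0// ltW.
have mG : measurable_fun setT (fun z : R => G (z - a)).
  by apply: (measurableT_comp (measurable_Green alpha)); exact: measurable_funB.
have mDG : measurable_fun setT (fun z : R => DG (z - a)).
  by apply: (measurableT_comp (measurable_dGreen alpha)); exact: measurable_funB.
have i1 : leb.-integrable setT (EFin \o (fun z =>
    (3 / 2 * f1 z - 1 / 2 * alpha ^+ 2 * f3 z) * G (z - a) * G (z - b))).
  apply: (@integrable_bounded_kernel _ _
    ((3 / 2 * M1 + 1 / 2 * alpha ^+ 2 * M3) * (2 * alpha)^-1)) norm_Green.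
  - by apply: measurable_funM => //; apply: continuous_measurable_fun; cont.
  - move=> z; rewrite normrM ler_pM//.
    rewrite (le_trans (ler_normB _ _))// lerD//.
      by rewrite normrM ger0_norm// ler_wpM2l.
    by rewrite normrM ger0_norm// ler_wpM2l.
  - exact: measurable_Green.
have i2 : leb.-integrable setT (EFin \o (fun z =>
    1 / 2 * alpha ^+ 2 * f1 z * DG (z - a) * DG (z - b))).
  apply: (@integrable_bounded_kernel _ _
    ((1 / 2 * alpha ^+ 2 * M1) * (2 * alpha ^+ 2)^-1)) norm_dGreen.
  - by apply: measurable_funM => //; apply: continuous_measurable_fun; cont.
  - move=> z; rewrite normrM ler_pM//.
    by rewrite normrM ger0_norm// ler_wpM2l.
  - exact: measurable_dGreen.
(* Outside [[a, b]], differentiating the product of exponentials cancels the [f2] terms of the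
   primitive; between [a] and [b] that product is constant and [f1], [f3] are integrated
   directly. *)
rewrite (@Rintegral_piecewise _ _
  (fun z => (2 * alpha)^-1 ^+ 2 * ((2 * f1 z - 1 / 2 * alpha ^+ 2 * f3 z) * (EL a z * EL b z)))
  (fun z => (2 * alpha)^-1 ^+ 2 * ((f1 z - 1 / 2 * alpha ^+ 2 * f3 z) * (ER a z * EL b z)))
  (fun z => (2 * alpha)^-1 ^+ 2 * ((2 * f1 z - 1 / 2 * alpha ^+ 2 * f3 z) * (ER a z * ER b z)))
  (fun z => (2 * alpha)^-1 ^+ 2 * ((alpha * f1 z - 1 / 2 * alpha ^+ 2 * f2 z) * (EL a z * EL b z)))
  (fun z => (2 * alpha)^-1 ^+ 2 * ((f z - 1 / 2 * alpha ^+ 2 * f2 z) * (ER a z * EL b z)))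
  (fun z => (2 * alpha)^-1 ^+ 2 *
    ((- alpha * f1 z - 1 / 2 * alpha ^+ 2 * f2 z) * (ER a z * ER b z)))
  a b).
- rewrite /CH_kernel GreenL// !expRl !expRr ELR.
  have [->|nab] := eqVneq a b; first by rewrite expRr; field.
  rewrite dGreenL ?lt_neqAle ?nab// ELR; field => //.
- exact: ab.
- exact: (integrableD measurableT i1 i2).
- by move=> z; derive.
- cont.
- by move=> z; derive.
- cont.
- by move=> z; derive.
- cont.
- move=> z za; have zb := lt_le_trans za ab.
  by rewrite !GreenL ?ltW// !dGreenL//; field.
- move=> z /andP[az zb].
  by rewrite GreenR ?GreenL ?ltW// dGreenR// dGreenL//; field.
- move=> z bz; have az := le_lt_trans ab bz.
  by rewrite !GreenR ?ltW// !dGreenR//; field.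
- by apply: (@compact_support_cvgNy _ _ A) => z Az; rewrite f10// f20//; ring.
- by apply: (@compact_support_cvgy _ _ A) => z Az; rewrite f10// f20//; ring.
Qed.

(** The bilinear form of [1 - alpha^2 d^2/dx^2] on two translates of its fundamental solution.
    Between [a] and [b] the two products cancel, outside they are equal and add up. *)
Lemma integral_Green_energy a b :
  \int[leb]_z (G (z - a) * G (z - b) + alpha ^+ 2 * DG (z - a) * DG (z - b))
  = G (a - b).
Proof.
wlog ab : a b / a <= b.
  move=> H; have [|/ltW] := leP a b; first exact: H.
  move/H; rewrite !GreenE -(opprB a b) EabsN => <-.
  by apply: eq_Rintegral => z _; ring.
have Gb y : `|G y| <= (2 * alpha)^-1.
  rewrite (le_trans (norm_Green y))// ler_piMr ?Eabs_le1//.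
  by rewrite invr_ge0 mulr_ge0// ltW.
have DGb y : `|DG y| <= (2 * alpha ^+ 2)^-1.
  rewrite (le_trans (norm_dGreen y))// ler_piMr ?Eabs_le1//.
  by rewrite invr_ge0 mulr_ge0// exprn_ge0// ltW.
have mG : measurable_fun setT (fun z : R => G (z - a)).
  by apply: (measurableT_comp (measurable_Green alpha)); exact: measurable_funB.
have mDG : measurable_fun setT (fun z : R => DG (z - a)).
  by apply: (measurableT_comp (measurable_dGreen alpha)); exact: measurable_funB.
have i1 : leb.-integrable setT (EFin \o (fun z => G (z - a) * G (z - b))).
  apply: (@integrable_bounded_kernel _ _ ((2 * alpha)^-1)) norm_Green => //.
  exact: measurable_Green.
have i2 : leb.-integrable setT (EFin \o (fun z =>
    alpha ^+ 2 * DG (z - a) * DG (z - b))).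
  apply: (@integrable_bounded_kernel _ _ (alpha ^+ 2 * (2 * alpha ^+ 2)^-1)) norm_dGreen.
  - exact: measurable_funM.
  - by move=> z; rewrite normrM ger0_norm ?sqr_ge0// ler_wpM2l// sqr_ge0.
  - exact: measurable_dGreen.
rewrite (@Rintegral_piecewise _ _
  (fun z => (2 * alpha)^-1 ^+ 2 * (2 * (EL a z * EL b z)))
  (fun=> 0 : R)
  (fun z => (2 * alpha)^-1 ^+ 2 * (2 * (ER a z * ER b z)))
  (fun z => (2 * alpha)^-1 ^+ 2 * (alpha * (EL a z * EL b z)))
  (fun=> 0 : R)
  (fun z => (2 * alpha)^-1 ^+ 2 * (- alpha * (ER a z * ER b z)))
  a b).
- by rewrite GreenL// !expRl !expRr ELR; field.
- exact: ab.
- exact: (integrableD measurableT i1 i2).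
- by move=> z; derive.
- cont.
- by move=> z; exact: has_derivative_const.
- cont.
- by move=> z; derive.
- cont.
- move=> z za; have zb := lt_le_trans za ab.
  by rewrite !GreenL ?ltW// !dGreenL//; field.
- move=> z /andP[az zb].
  by rewrite GreenR ?GreenL ?ltW// dGreenR// dGreenL//; field.
- move=> z bz; have az := le_lt_trans ab bz.
  by rewrite !GreenR ?ltW// !dGreenR//; field.
- have h : EL a z * EL b z @[z --> -oo] --> (0 * 0 : R).
    by apply: cvgM; exact: cvg_exp_leftNy.
  rewrite mulr0 in h.
  have h1 : alpha * (EL a z * EL b z) @[z --> -oo] --> (alpha * 0 : R).
    by apply: cvgM h; exact: cvg_cst.
  rewrite mulr0 in h1; rewrite -(mulr0 ((2 * alpha)^-1 ^+ 2)).
  by apply: cvgM h1; exact: cvg_cst.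
- have h : ER a z * ER b z @[z --> +oo] --> (0 * 0 : R).
    by apply: cvgM; exact: cvg_exp_righty.
  rewrite mulr0 in h.
  have h1 : - alpha * (ER a z * ER b z) @[z --> +oo] --> (- alpha * 0 : R).
    by apply: cvgM h; exact: cvg_cst.
  rewrite mulr0 in h1; rewrite -(mulr0 ((2 * alpha)^-1 ^+ 2)).
  by apply: cvgM h1; exact: cvg_cst.
Qed.

End Green_identities.

(** * Convolution with a finite measure *)

Section finite_measure_integrals.
Variable R : realType.
Notation BR := (measurableTypeR R).
Variable mu : {finite_measure set BR -> \bar R}.

Lemma integrable_bounded (f : R -> R) (C : R) : measurable_fun setT f ->
  (forall z, `|f z| <= C) -> mu.-integrable setT (EFin \o f).
Proof.
move=> mf fC; apply: measurable_bounded_integrable => //.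
  by rewrite ltey_eq fin_num_measure.
exists C; split; first exact: num_real.
by move=> x Cx z _ /=; rewrite (le_trans (fC z))// ltW.
Qed.

Definition mass : R := fine (mu setT).

Lemma Rintegral_le_bound (f : R -> R) (C : R) : measurable_fun setT f ->
  (forall z, `|f z| <= C) -> `|\int[mu]_z f z| <= C * mass.
Proof.
move=> mf fC.
have intf := integrable_bounded mf fC.
rewrite (le_trans (le_normr_Rintegral _ _))// /mass -Rintegral_cst//.
apply: le_Rintegral => //; first exact: integrable_norm.
exact: (@integrable_bounded _ `|C|).
Qed.

End finite_measure_integrals.

Lemma mass_sub_le1 (R : realType) (mu : subprobability (measurableTypeR R) R) :
  mass mu <= 1.
Proof.
rewrite /mass -[1]/(fine (1%E : \bar R)); apply: fine_le => //.
  exact: fin_num_measure.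
exact: sprobability_setT.
Qed.

Section convolution_Fubini.
Variable R : realType.
Variable alpha : R.
Hypothesis alpha_gt0 : 0 < alpha.
Notation leb := (@lebesgue_measure R).
Notation BR := (measurableTypeR R).
(** [h] stands for [Green] and for [dGreen] alike; only measurability and exponential decay
    enter. *)
Variables (h : R -> R) (C : R).
Hypothesis mh : measurable_fun setT h.
Hypothesis hC : forall z, `|h z| <= C * Eabs alpha z.

Let C_ge0 : 0 <= C.
Proof.
have := le_trans (normr_ge0 _) (hC 0); rewrite pmulr_lge0//; exact: Eabs_gt0.
Qed.

Let h_bounded z : `|h z| <= C.
Proof. by rewrite (le_trans (hC z))// ler_piMr ?Eabs_le1. Qed.

Let mh_sub y : measurable_fun setT (fun z : R => h (z - y)).
Proof. by apply: (measurableT_comp mh); exact: measurable_funB. Qed.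

Let mh_rsub z : measurable_fun setT (fun y : R => h (z - y)).
Proof. by apply: (measurableT_comp mh); exact: measurable_funB. Qed.

Variable mu : {finite_measure set BR -> \bar R}.

Let mh2 : measurable_fun setT (fun zy : BR * BR => h (zy.1 - zy.2)).
Proof. by apply: (measurableT_comp mh); exact: measurable_funB. Qed.

(** The majorant [M C exp(- |z - y| / alpha)] has [z]-integral [2 alpha M C] for every [y], and [mu]
    is finite. All uses of Fubini in this section rest on this. *)
Let integrable2 (W : R -> R) (M : R) : measurable_fun setT W ->
  (forall z, `|W z| <= M) ->
  (leb \x mu)%E.-integrable setT
    (EFin \o (fun zy : BR * BR => W zy.1 * h (zy.1 - zy.2))).
Proof.
move=> mW WM.
have M0 : 0 <= M by exact: le_trans (normr_ge0 _) (WM 0).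
have mWh : measurable_fun setT (fun zy : BR * BR => W zy.1 * h (zy.1 - zy.2)).
  by apply: measurable_funM => //; exact: (measurableT_comp mW).
apply/integrable21ltyP; first exact/measurable_EFinP.
apply: (@le_lt_trans _ _ (\int[mu]_y (M * C * (2 * alpha))%:E)%E).
  apply: ge0_le_integral => //.
  - by move=> y _; apply: integral_ge0 => z _; rewrite lee_fin.
  - apply: (@measurable_fun_fubini_tonelli_G _ _ _ _ _ leb
      (fun zy : BR * BR => (`|W zy.1 * h (zy.1 - zy.2)|)%:E)).
    + by apply/measurable_EFinP; apply: measurableT_comp.
    + by move=> zy; rewrite lee_fin.
  - move=> y _ /=.
    rewrite EFinM -(integral_Eabs alpha_gt0 y) -ge0_integralZl//=; last 3 first.
    + apply/measurable_EFinP; apply: (measurableT_comp (measurable_Eabs _)) => //.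
      exact: measurable_funB.
    + by move=> z _; rewrite lee_fin Eabs_ge0.
    + by rewrite lee_fin mulr_ge0.
    apply: ge0_le_integral => //.
    + apply/measurable_EFinP; apply: measurableT_comp => //.
      by apply: measurable_funM; [exact: mW|exact: mh_sub].
    + apply/measurable_EFinP; apply: measurable_funM => //.
      apply: (measurableT_comp (measurable_Eabs _)) => //; exact: measurable_funB.
    + move=> z _; rewrite -EFinM lee_fin normrM -mulrA ler_pM//.
rewrite integral_cst//= -ge0_fin_numE ?mule_ge0 ?lee_fin ?mulr_ge0 ?(ltW alpha_gt0)//.
by rewrite fin_numM// fin_num_measure.
Qed.

(** The inner integral of a jointly integrable function is measurable; here the weight is
    [W = 1]. *)
Lemma measurable_convolution : measurable_fun setT (convolution h mu).
Proof.
have i1 : forall z : R, `|(cst 1 : R -> R) z| <= 1 by move=> z; rewrite normr1.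
have := measurable_fubini_F (integrable2 (measurable_cst _) i1).
rewrite /fubini_F /= => H.
apply: (measurableT_comp (fine_measurable measurableT)).
apply: eq_measurable_fun H => z _; apply: eq_integral => y _.
by rewrite /= mul1r.
Qed.

Lemma convolution_bounded z : `|convolution h mu z| <= C * mass mu.
Proof. exact: Rintegral_le_bound. Qed.

Lemma Rintegral_convolution (W : R -> R) (M : R) : measurable_fun setT W ->
  (forall z, `|W z| <= M) ->
  \int[leb]_z (W z * convolution h mu z) =
  \int[mu]_y \int[leb]_z (W z * h (z - y)).
Proof.
move=> mW WM.
have := Fubini (integrable2 mW WM).
rewrite /Rintegral /= => H.
transitivity (fine (\int[leb]_z \int[mu]_y (W z * h (z - y))%:E)%E).
  congr fine; apply: eq_integral => z _.
  have ih : mu.-integrable setT (EFin \o (fun y => h (z - y))).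
    exact: (@integrable_bounded _ _ _ C).
  rewrite EFinM fineK; last exact: integrable_fin_num.
  by rewrite -integralZl.
rewrite H; congr fine; apply: eq_integral => y _.
rewrite fineK//; apply: integrable_fin_num => //.
exact: (integrable_bounded_kernel alpha_gt0 y mW WM mh hC).
Qed.

Lemma integrable_mul_convolution (W : R -> R) (M : R) : measurable_fun setT W ->
  (forall z, `|W z| <= M) ->
  leb.-integrable setT (EFin \o (fun z => W z * convolution h mu z)).
Proof.
move=> mW WM.
apply: eq_integrable (integrable_fubini_F (integrable2 mW WM)) => // z _.
rewrite /fubini_F /=.
have ih : mu.-integrable setT (EFin \o (fun y => h (z - y))).
  exact: (@integrable_bounded _ _ _ C).
rewrite EFinM fineK; last exact: integrable_fin_num.
by rewrite -integralZl.
Qed.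

Lemma integrable_kernel_integral (W : R -> R) (M : R) : measurable_fun setT W ->
  (forall z, `|W z| <= M) ->
  mu.-integrable setT (EFin \o (fun y => \int[leb]_z (W z * h (z - y)))).
Proof.
move=> mW WM.
have iWh y : leb.-integrable setT (EFin \o (fun z => W z * h (z - y))).
  exact: (integrable_bounded_kernel alpha_gt0 y mW WM mh hC).
have M0 : 0 <= M by exact: le_trans (normr_ge0 _) (WM 0).
apply: (@integrable_bounded _ _ _ (M * C * (2 * alpha))).
  exact: (measurableT_comp (fine_measurable measurableT)
    (measurable_fubini_G (integrable2 mW WM))).
move=> y; rewrite (le_trans (le_normr_Rintegral _ (iWh y)))//.
have iE : leb.-integrable setT (EFin \o (fun z => Eabs alpha (z - y))).
  apply: (@integrable_le_Eabs _ _ alpha_gt0 _ 1 y).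
    by apply: (measurableT_comp (measurable_Eabs _)); exact: measurable_funB.
  by move=> z; rewrite mul1r ger0_norm ?Eabs_ge0.
rewrite (_ : 2 * alpha = \int[leb]_z Eabs alpha (z - y)); last first.
  by rewrite /Rintegral integral_Eabs.
rewrite -RintegralZl//; apply: le_Rintegral => //.
- exact: integrable_norm.
- exact: (integrableZl measurableT (M * C) iE).
- by move=> z _; rewrite normrM -mulrA ler_pM.
Qed.

End convolution_Fubini.

Section convolution_Green.
Variable R : realType.
Variable alpha : R.
Hypothesis alpha_gt0 : 0 < alpha.
Notation leb := (@lebesgue_measure R).
Notation BR := (measurableTypeR R).
Notation G := (Green alpha).
Notation DG := (dGreen alpha).
Notation fmeasure := {finite_measure set BR -> \bar R}.

(** [cG] and [cDG] bound [|G|] and [|G'|]. They reappear as bounds of the particle velocities and of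
    the relative momentum rates, hence as Lipschitz constants in time. *)
Definition cG : R := (2 * alpha)^-1.
Definition cDG : R := (2 * alpha ^+ 2)^-1.

Lemma cG_ge0 : 0 <= cG. Proof. by rewrite invr_ge0 mulr_ge0// ltW. Qed.
Lemma cDG_ge0 : 0 <= cDG.
Proof. by rewrite invr_ge0 mulr_ge0// sqr_ge0. Qed.

Lemma Green_le z : `|G z| <= cG.
Proof. by rewrite (le_trans (norm_Green _ _))// ler_piMr ?Eabs_le1 ?cG_ge0. Qed.

Lemma dGreen_le z : `|DG z| <= cDG.
Proof. by rewrite (le_trans (norm_dGreen _ _))// ler_piMr ?Eabs_le1 ?cDG_ge0. Qed.

Lemma GreenN z : G (- z) = G z.
Proof. by rewrite !GreenE EabsN. Qed.

Notation U mu := (convolution G mu).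
Notation DU mu := (convolution DG mu).

Lemma measurable_U (mu : fmeasure) : measurable_fun setT (U mu).
Proof. exact: (measurable_convolution alpha_gt0 (measurable_Green _) (norm_Green alpha_gt0)). Qed.

Lemma measurable_DU (mu : fmeasure) : measurable_fun setT (DU mu).
Proof. exact: (measurable_convolution alpha_gt0 (measurable_dGreen _) (norm_dGreen alpha_gt0)). Qed.

Lemma U_le (mu : fmeasure) z : `|U mu z| <= cG * mass mu.
Proof. exact: (convolution_bounded alpha_gt0 (measurable_Green _) (norm_Green alpha_gt0)). Qed.

Lemma DU_le (mu : fmeasure) z : `|DU mu z| <= cDG * mass mu.
Proof. exact: (convolution_bounded alpha_gt0 (measurable_dGreen _) (norm_dGreen alpha_gt0)). Qed.

Lemma Rintegral_mulU (mu : fmeasure) (W : R -> R) (M : R) : measurable_fun setT W ->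
  (forall z, `|W z| <= M) ->
  \int[leb]_z (W z * U mu z) = \int[mu]_y \int[leb]_z (W z * G (z - y)).
Proof. exact: (Rintegral_convolution alpha_gt0 (measurable_Green _) (norm_Green alpha_gt0)). Qed.

Lemma Rintegral_mulDU (mu : fmeasure) (W : R -> R) (M : R) : measurable_fun setT W ->
  (forall z, `|W z| <= M) ->
  \int[leb]_z (W z * DU mu z) = \int[mu]_y \int[leb]_z (W z * DG (z - y)).
Proof. exact: (Rintegral_convolution alpha_gt0 (measurable_dGreen _) (norm_dGreen alpha_gt0)). Qed.

Lemma integrable_mulU (mu : fmeasure) (W : R -> R) (M : R) : measurable_fun setT W ->
  (forall z, `|W z| <= M) -> leb.-integrable setT (EFin \o (fun z => W z * U mu z)).
Proof.
exact: (integrable_mul_convolution alpha_gt0 (measurable_Green _) (norm_Green alpha_gt0)).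
Qed.

Lemma integrable_mulDU (mu : fmeasure) (W : R -> R) (M : R) : measurable_fun setT W ->
  (forall z, `|W z| <= M) -> leb.-integrable setT (EFin \o (fun z => W z * DU mu z)).
Proof.
exact: (integrable_mul_convolution alpha_gt0 (measurable_dGreen _) (norm_dGreen alpha_gt0)).
Qed.

Lemma integrable_mulG (W : R -> R) (M c : R) : measurable_fun setT W ->
  (forall z, `|W z| <= M) -> leb.-integrable setT (EFin \o (fun z => W z * G (z - c))).
Proof.
move=> mW WM.
exact: (integrable_bounded_kernel alpha_gt0 c mW WM (measurable_Green _) (norm_Green alpha_gt0)).
Qed.

Lemma integrable_mulDG (W : R -> R) (M c : R) : measurable_fun setT W ->
  (forall z, `|W z| <= M) -> leb.-integrable setT (EFin \o (fun z => W z * DG (z - c))).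
Proof.
move=> mW WM.
exact: (integrable_bounded_kernel alpha_gt0 c mW WM (measurable_dGreen _) (norm_dGreen alpha_gt0)).
Qed.

Lemma convolution_helmholtz (mu : fmeasure) (f f1 f2 : R -> R) (A : R) :
  (forall z, has_derivative f z (f1 z)) ->
  (forall z, has_derivative f1 z (f2 z)) -> continuous f2 ->
  (forall z, A < `|z| -> f z = 0) ->
  \int[leb]_z ((f z - alpha ^+ 2 * f2 z) * U mu z) = \int[mu]_y f y.
Proof.
move=> df df1 cf2 f0; have cf := has_derivative_continuous df.
have f10 := has_derivative_supp df f0.
have f20 := has_derivative_supp df1 f10.
have cW : continuous (fun z => f z - alpha ^+ 2 * f2 z) by do !cont_step.
have [M _ WM] : exists2 M : R, 0 <= M & forall z, `|f z - alpha ^+ 2 * f2 z| <= M.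
  apply: (@compact_support_bounded _ _ A) => // z Az.
  by rewrite f0// f20// mulr0 subr0.
rewrite (Rintegral_mulU _ _ WM); last exact: continuous_measurable_fun.
apply: eq_Rintegral => y _; exact: (integral_helmholtz_Green _ _ df df1 cf2 f0).
Qed.

Lemma convolution_weak_derivative (mu : fmeasure) (f f1 : R -> R) (A : R) :
  (forall z, has_derivative f z (f1 z)) -> continuous f1 ->
  (forall z, A < `|z| -> f z = 0) ->
  \int[leb]_z (f1 z * U mu z) = - \int[leb]_z (f z * DU mu z).
Proof.
move=> df cf1 f0; have cf := has_derivative_continuous df.
have f10 := has_derivative_supp df f0.
have [M _ fM] := compact_support_bounded cf f0.
have [M1 _ f1M] := compact_support_bounded cf1 f10.
have mf := continuous_measurable_fun cf.
have mf1 := continuous_measurable_fun cf1.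
rewrite (Rintegral_mulU _ mf1 f1M) (Rintegral_mulDU _ mf fM) -mulN1r.
rewrite -RintegralZl//; last first.
  exact: (integrable_kernel_integral alpha_gt0 (measurable_dGreen _)
    (norm_dGreen alpha_gt0) mu mf fM).
apply: eq_Rintegral => y _; rewrite mulN1r.
exact: (integral_dGreen _ _ df cf1 f0).
Qed.

(** Each square of a convolution is unfolded by two applications of Fubini: first with the weight
    [W U] (or [V DU]), bounded because the convolution is, then with the weight [W G(. - b)] (or
    [V DG(. - b)]). What remains is the pointwise kernel identity. *)
Lemma convolution_CH (mu : fmeasure) (f f1 f2 f3 : R -> R) (A : R) :
  (forall z, has_derivative f z (f1 z)) ->
  (forall z, has_derivative f1 z (f2 z)) ->
  (forall z, has_derivative f2 z (f3 z)) -> continuous f3 ->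
  (forall z, A < `|z| -> f z = 0) ->
  \int[leb]_z ((3 / 2 * f1 z - 1 / 2 * alpha ^+ 2 * f3 z) * U mu z ^+ 2)
  + \int[leb]_z (1 / 2 * alpha ^+ 2 * f1 z * DU mu z ^+ 2)
  = \int[mu]_b \int[mu]_a CH_kernel alpha f f1 a b.
Proof.
move=> df df1 df2 cf3 f0.
have cf1 := has_derivative_continuous df1.
have f10 := has_derivative_supp df f0.
have f20 := has_derivative_supp df1 f10.
have f30 := has_derivative_supp df2 f20.
pose W z := 3 / 2 * f1 z - 1 / 2 * alpha ^+ 2 * f3 z.
pose V z := 1 / 2 * alpha ^+ 2 * f1 z.
have cW : continuous W by rewrite /W; do !cont_step.
have cV : continuous V by rewrite /V; do !cont_step.
have mW := continuous_measurable_fun cW.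
have mV := continuous_measurable_fun cV.
have [M M0 WM] : exists2 M : R, 0 <= M & forall z, `|W z| <= M.
  apply: (@compact_support_bounded _ _ A) => // z Az.
  by rewrite /W f10// f30// !mulr0 subr0.
have [N N0 VN] : exists2 M : R, 0 <= M & forall z, `|V z| <= M.
  by apply: (@compact_support_bounded _ _ A) => // z Az; rewrite /V f10// mulr0.
have mWU : measurable_fun setT (fun z => W z * U mu z).
  by apply: measurable_funM => //; exact: measurable_U.
have mVU : measurable_fun setT (fun z => V z * DU mu z).
  by apply: measurable_funM => //; exact: measurable_DU.
have WUM z : `|W z * U mu z| <= M * (cG * mass mu).
  by rewrite normrM ler_pM// U_le.
have VUN z : `|V z * DU mu z| <= N * (cDG * mass mu).
  by rewrite normrM ler_pM// DU_le.
have mGs c : measurable_fun setT (fun z : R => G (z - c)).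
  by apply: (measurableT_comp (measurable_Green _)); exact: measurable_funB.
have mDGs c : measurable_fun setT (fun z : R => DG (z - c)).
  by apply: (measurableT_comp (measurable_dGreen _)); exact: measurable_funB.
have mWG c : measurable_fun setT (fun z => W z * G (z - c)) by exact: measurable_funM.
have mVG c : measurable_fun setT (fun z => V z * DG (z - c)) by exact: measurable_funM.
have WGM c z : `|W z * G (z - c)| <= M * cG by rewrite normrM ler_pM// Green_le.
have VGN c z : `|V z * DG (z - c)| <= N * cDG by rewrite normrM ler_pM// dGreen_le.
transitivity (\int[leb]_z (W z * U mu z * U mu z) +
   \int[leb]_z (V z * DU mu z * DU mu z)).
  by congr (_ + _); apply: eq_Rintegral => z _; rewrite expr2 mulrA.
rewrite (Rintegral_mulU _ mWU WUM) (Rintegral_mulDU _ mVU VUN).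
rewrite -RintegralD//; last 2 first.
- exact: (integrable_kernel_integral alpha_gt0 (measurable_Green _)
    (norm_Green alpha_gt0) mu mWU WUM).
- exact: (integrable_kernel_integral alpha_gt0 (measurable_dGreen _)
    (norm_dGreen alpha_gt0) mu mVU VUN).
apply: eq_Rintegral => b _.
transitivity (\int[leb]_z (W z * G (z - b) * U mu z) +
   \int[leb]_z (V z * DG (z - b) * DU mu z)).
  by congr (_ + _); apply: eq_Rintegral => z _; rewrite mulrAC.
rewrite (Rintegral_mulU _ (mWG b) (WGM b)) (Rintegral_mulDU _ (mVG b) (VGN b)).
rewrite -RintegralD//; last 2 first.
- exact: (integrable_kernel_integral alpha_gt0 (measurable_Green _)
    (norm_Green alpha_gt0) mu (mWG b) (WGM b)).
- exact: (integrable_kernel_integral alpha_gt0 (measurable_dGreen _)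
    (norm_dGreen alpha_gt0) mu (mVG b) (VGN b)).
apply: eq_Rintegral => a _.
rewrite -RintegralD//; last 2 first.
- exact: (integrable_mulG _ (mWG b) (WGM b)).
- exact: (integrable_mulDG _ (mVG b) (VGN b)).
rewrite CH_kernelC -(integral_CH_kernel alpha_gt0 b a df df1 df2 cf3 f0).
by [].
Qed.

(** Fubini in both variables reduces the energy to [integral_Green_energy] under the double
    integral. *)
Lemma convolution_energy (mu nu : fmeasure) :
  \int[leb]_z (U nu z * U mu z) + alpha ^+ 2 * \int[leb]_z (DU nu z * DU mu z)
  = \int[mu]_y U nu y.
Proof.
have mGs c : measurable_fun setT (fun z : R => G (z - c)).
  by apply: (measurableT_comp (measurable_Green _)); exact: measurable_funB.
have mDGs c : measurable_fun setT (fun z : R => DG (z - c)).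
  by apply: (measurableT_comp (measurable_dGreen _)); exact: measurable_funB.
have mU := measurable_U nu; have mDU := measurable_DU nu.
have UM := U_le nu; have DUM := DU_le nu.
have GM c z : `|G (z - c)| <= cG by exact: Green_le.
have DGM c z : `|DG (z - c)| <= cDG by exact: dGreen_le.
rewrite (Rintegral_mulU _ mU UM) (Rintegral_mulDU _ mDU DUM).
have iU : mu.-integrable setT (EFin \o (fun y => \int[leb]_z (U nu z * G (z - y)))).
  exact: (integrable_kernel_integral alpha_gt0 (measurable_Green _)
    (norm_Green alpha_gt0) mu mU UM).
have iDU : mu.-integrable setT (EFin \o (fun y => \int[leb]_z (DU nu z * DG (z - y)))).
  exact: (integrable_kernel_integral alpha_gt0 (measurable_dGreen _)
    (norm_dGreen alpha_gt0) mu mDU DUM).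
rewrite -RintegralZl// -RintegralD//; last first.
  exact: (integrableZl measurableT (alpha ^+ 2) iDU).
apply: eq_Rintegral => b _.
transitivity (\int[leb]_z (G (z - b) * U nu z) +
   alpha ^+ 2 * \int[leb]_z (DG (z - b) * DU nu z)).
  by congr (_ + _ * _); apply: eq_Rintegral => z _; rewrite mulrC.
rewrite (Rintegral_mulU _ (mGs b) (GM b)) (Rintegral_mulDU _ (mDGs b) (DGM b)).
have iG : nu.-integrable setT (EFin \o (fun y => \int[leb]_z (G (z - b) * G (z - y)))).
  exact: (integrable_kernel_integral alpha_gt0 (measurable_Green _)
    (norm_Green alpha_gt0) nu (mGs b) (GM b)).
have iDG : nu.-integrable setT (EFin \o (fun y => \int[leb]_z (DG (z - b) * DG (z - y)))).
  exact: (integrable_kernel_integral alpha_gt0 (measurable_dGreen _)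
    (norm_dGreen alpha_gt0) nu (mDGs b) (DGM b)).
rewrite -RintegralZl// -RintegralD//; last first.
  exact: (integrableZl measurableT (alpha ^+ 2) iDG).
apply: eq_Rintegral => a _.
have jG := integrable_mulG a (mGs b) (GM b).
have jDG := integrable_mulDG a (mDGs b) (DGM b).
rewrite -RintegralZl// -RintegralD//; last first.
  exact: (integrableZl measurableT (alpha ^+ 2) jDG).
rewrite -(integral_Green_energy alpha_gt0 b a); apply: eq_Rintegral => z _.
by rewrite mulrA.
Qed.

(** [m1 - m2] is signed, so the identity is assembled by bilinearity from [convolution_energy] for
    the four pairs of positive measures. *)
Lemma convolution_energy_sub (m1 m2 : fmeasure) :
  let w z := U m1 z - U m2 z in
  let wx z := DU m1 z - DU m2 z in
  [/\ leb.-integrable setT (EFin \o (fun z => w z ^+ 2)),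
      leb.-integrable setT (EFin \o (fun z => wx z ^+ 2)) &
  \int[leb]_z (w z ^+ 2) + alpha ^+ 2 * \int[leb]_z (wx z ^+ 2) =
  \int[m1]_y w y - \int[m2]_y w y].
Proof.
move=> w wx.
have mw : measurable_fun setT w by apply: measurable_funB; exact: measurable_U.
have mwx : measurable_fun setT wx by apply: measurable_funB; exact: measurable_DU.
have wM z : `|w z| <= cG * mass m1 + cG * mass m2.
  by rewrite (le_trans (ler_normB _ _))// lerD// U_le.
have wxM z : `|wx z| <= cDG * mass m1 + cDG * mass m2.
  by rewrite (le_trans (ler_normB _ _))// lerD// DU_le.
have iw (mu : fmeasure) := integrable_mulU mu mw wM.
have iwx (mu : fmeasure) := integrable_mulDU mu mwx wxM.
have ew : (fun z => w z ^+ 2) = (fun z => w z * U m1 z - w z * U m2 z).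
  by apply/funext => z; rewrite expr2 -mulrBr.
have ewx : (fun z => wx z ^+ 2) = (fun z => wx z * DU m1 z - wx z * DU m2 z).
  by apply/funext => z; rewrite expr2 -mulrBr.
have iU (mu nu : fmeasure) : leb.-integrable setT (EFin \o (fun z => U nu z * U mu z)).
  exact: (integrable_mulU mu (measurable_U nu) (U_le nu)).
have iDU (mu nu : fmeasure) : leb.-integrable setT (EFin \o (fun z => DU nu z * DU mu z)).
  exact: (integrable_mulDU mu (measurable_DU nu) (DU_le nu)).
have iUm (mu nu : fmeasure) : mu.-integrable setT (EFin \o U nu).
  exact: (integrable_bounded _ (measurable_U nu) (U_le nu)).
split.
- by rewrite ew; exact: (integrableB measurableT (iw m1) (iw m2)).
- by rewrite ewx; exact: (integrableB measurableT (iwx m1) (iwx m2)).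
have EU (mu : fmeasure) : \int[mu]_y w y = \int[mu]_y U m1 y - \int[mu]_y U m2 y.
  by apply: RintegralB => //; exact: iUm.
rewrite !EU ew ewx (RintegralB measurableT (iw m1) (iw m2)).
rewrite (RintegralB measurableT (iwx m1) (iwx m2)).
rewrite -(convolution_energy m1 m1) -(convolution_energy m1 m2).
rewrite -(convolution_energy m2 m1) -(convolution_energy m2 m2).
have Ew (mu : fmeasure) : \int[leb]_z (w z * U mu z) =
    \int[leb]_z (U m1 z * U mu z) - \int[leb]_z (U m2 z * U mu z).
  rewrite -(RintegralB measurableT (iU mu m1) (iU mu m2)).
  by apply: eq_Rintegral => z _; rewrite mulrBl.
have Ewx (mu : fmeasure) : \int[leb]_z (wx z * DU mu z) =
    \int[leb]_z (DU m1 z * DU mu z) - \int[leb]_z (DU m2 z * DU mu z).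
  rewrite -(RintegralB measurableT (iDU mu m1) (iDU mu m2)).
  by apply: eq_Rintegral => z _; rewrite mulrBl.
have key (k a b c d a' b' c' d' : R) :
    (a - c) - (b - d) + k * ((a' - c') - (b' - d')) =
    a + k * a' - (c + k * c') - (b + k * b' - (d + k * d')) by ring.
by rewrite !Ew !Ewx; exact: key.
Qed.

End convolution_Green.

(** * Weak derivatives and Sobolev norms *)

Section Sobolev.
Variable R : realType.
Notation leb := (@lebesgue_measure R).

Lemma derivable_has_derivative (f : R -> R) (z : R) : derivable f z 1 ->
  has_derivative f z (derive1 f z).
Proof. by move=> df; rewrite /has_derivative derive1E; exact/derivableP. Qed.

Lemma compact_closure_support (T : normedModType R) (S : set T) :
  compact (closure S) -> exists A : R, forall z, A < `|z| -> ~ S z.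
Proof.
move=> /compact_bounded[M [_ MS]]; exists (`|M| + 1) => z Mz Sz.
have := MS (`|M| + 1) _ z (subset_closure Sz).
have -> : M < `|M| + 1 by rewrite (le_lt_trans (ler_norm _))// ltrDl.
by move=> /(_ isT) /(lt_le_trans Mz); rewrite ltxx.
Qed.

Lemma Cc_smooth_derivatives (psi : R -> R) : Cc_smooth psi ->
  [/\ forall n z, has_derivative (derive1n n psi) z (derive1n n.+1 psi z),
      forall n, continuous (derive1n n psi) &
      exists A : R, forall z, A < `|z| -> psi z = 0].
Proof.
move=> [dpsi cpsi].
have d n z : has_derivative (derive1n n psi) z (derive1n n.+1 psi z).
  exact: derivable_has_derivative.
split => //; first by move=> n; exact: has_derivative_continuous (d n).
have [A SA] := compact_closure_support cpsi.
by exists A => z /SA /= /negP; rewrite negbK => /eqP.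
Qed.

Lemma bounded_locally_integrable (f : R -> R) (M : R) : measurable_fun setT f ->
  (forall z, `|f z| <= M) -> locally_integrable setT f.
Proof.
move=> mf fM; split => //; first exact: openT.
move=> K _ cK; have mK := compact_measurable cK.
have /integrableP[_] := @measurable_bounded_integrable _ _ _ leb f K mK
  (compact_finite_measure cK) (measurable_funS measurableT (@subsetT _ _) mf)
  (ex_intro _ M (conj (num_real _) (fun x Mx z _ => le_trans (fM z) (ltW Mx)))).
by [].
Qed.

Lemma L2_norm_sqr (f : R -> R) : leb.-integrable setT (EFin \o (fun z => f z ^+ 2)) ->
  (L2_norm f ^+ 2 = (\int[leb]_z (f z ^+ 2))%:E)%E.
Proof.
move=> if2; rewrite fineK; last exact: integrable_fin_num.
have -> : (\int[leb]_z (f z ^+ 2)%:E = L2_norm f `^ 2)%E.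
  rewrite /L2_norm poweR_Lnorm//; apply: eq_integral => z _ /=.
  by rewrite -[X in _ `^ X]/(2%:R) powR_mulrn// real_normK// num_real.
have := Lnorm_ge0 leb 2%:E (EFin \o f); rewrite -/(L2_norm f).
case: (L2_norm f) => [r| |]//; last by rewrite poweRyr// => _; rewrite expe2 mulyy.
by rewrite lee_fin => r0; rewrite poweR_EFin -[X in _ `^ X]/(2%:R) powR_mulrn.
Qed.

Lemma L2_norm_lty (f : R -> R) :
  leb.-integrable setT (EFin \o (fun z => f z ^+ 2)) -> (L2_norm f < +oo)%E.
Proof.
move=> /L2_norm_sqr; have := Lnorm_ge0 leb 2%:E (EFin \o f); rewrite -/(L2_norm f).
by case: (L2_norm f) => [r| |]//= _; rewrite ?ltry// expe2 mulyy.
Qed.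

Lemma H1_norm_le (f g : R -> R) : is_weak_deriv f g ->
  leb.-integrable setT (EFin \o (fun z => f z ^+ 2)) ->
  leb.-integrable setT (EFin \o (fun z => g z ^+ 2)) ->
  (H1_norm f <= (Num.sqrt (\int[leb]_z (f z ^+ 2) + \int[leb]_z (g z ^+ 2)))%:E)%E.
Proof.
move=> fg if2 ig2; apply: ereal_inf_lbound; exists g => //.
rewrite !L2_norm_sqr// -EFinD poweR_EFin powR12_sqrt// addr_ge0//.
  by apply: Rintegral_ge0 => z _; rewrite sqr_ge0.
by apply: Rintegral_ge0 => z _; rewrite sqr_ge0.
Qed.

Variable alpha : R.
Hypothesis alpha_gt0 : 0 < alpha.
Notation BR := (measurableTypeR R).
Notation fmeasure := {finite_measure set BR -> \bar R}.
Notation G := (Green alpha).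
Notation DG := (dGreen alpha).
Notation U mu := (convolution G mu).
Notation DU mu := (convolution DG mu).

Lemma is_weak_deriv_U (mu : fmeasure) : is_weak_deriv (U mu) (DU mu).
Proof.
split.
- exact: bounded_locally_integrable (measurable_U alpha_gt0 mu) (U_le alpha_gt0 mu).
- exact: bounded_locally_integrable (measurable_DU alpha_gt0 mu) (DU_le alpha_gt0 mu).
move=> psi /Cc_smooth_derivatives[d c [A psi0]].
have := convolution_weak_derivative alpha_gt0 mu (d 0%N) (c 1%N) psi0.
under eq_Rintegral do rewrite mulrC; move=> ->.
by congr (- _); apply: eq_Rintegral => z _; rewrite mulrC.
Qed.

Lemma is_helmholtz_U (mu : fmeasure) : is_helmholtz alpha (U mu) mu.
Proof.
split.
  exact: bounded_locally_integrable (measurable_U alpha_gt0 mu) (U_le alpha_gt0 mu).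
move=> psi /Cc_smooth_derivatives[d c [A psi0]].
rewrite -(convolution_helmholtz alpha_gt0 mu (d 0%N) (d 1%N) (c 2%N) psi0).
by apply: eq_Rintegral => z _; rewrite mulrC.
Qed.

Lemma is_weak_deriv_U_sub (m1 m2 : fmeasure) :
  is_weak_deriv (fun z => U m1 z - U m2 z) (fun z => DU m1 z - DU m2 z).
Proof.
have [_ _ w1] := is_weak_deriv_U m1; have [_ _ w2] := is_weak_deriv_U m2.
split.
- apply: (@bounded_locally_integrable _ (cG alpha * mass m1 + cG alpha * mass m2)).
    by apply: measurable_funB; exact: measurable_U.
  by move=> z; rewrite (le_trans (ler_normB _ _))// lerD// U_le.
- apply: (@bounded_locally_integrable _ (cDG alpha * mass m1 + cDG alpha * mass m2)).
    by apply: measurable_funB; exact: measurable_DU.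
  by move=> z; rewrite (le_trans (ler_normB _ _))// lerD// DU_le.
move=> psi cpsi; have [d c [A psi0]] := Cc_smooth_derivatives cpsi.
have [M _ pM] := compact_support_bounded (c 0%N) psi0.
have [N _ qN] := compact_support_bounded (c 1%N) (has_derivative_supp (d 0%N) psi0).
have mp := continuous_measurable_fun (c 0%N).
have mq := continuous_measurable_fun (c 1%N).
have iU (mu : fmeasure) : leb.-integrable setT (EFin \o (fun z => U mu z * derive1 psi z)).
  apply: eq_integrable (integrable_mulU alpha_gt0 mu mq qN) => // z _ /=.
  by rewrite mulrC.
have iDU (mu : fmeasure) : leb.-integrable setT (EFin \o (fun z => DU mu z * psi z)).
  apply: eq_integrable (integrable_mulDU alpha_gt0 mu mp pM) => // z _ /=.
  by rewrite mulrC.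
under eq_Rintegral do rewrite mulrBl.
rewrite RintegralB// w1// w2//.
under [in RHS]eq_Rintegral do rewrite mulrBl.
by rewrite RintegralB//; ring.
Qed.

(** Passes from the energy with weight [alpha ^+ 2] to the unweighted [H1] norm; the factor
    [1 + (alpha ^+ 2)^-1] of the bounds below originates here. *)
Let weighted_sum_le (a I J : R) : 0 < a -> 0 <= I -> 0 <= J ->
  I + J <= (1 + a^-1) * (I + a * J).
Proof.
move=> a0 I0 J0.
have -> : (1 + a^-1) * (I + a * J) = I + J + (I / a + a * J).
  by field; rewrite gt_eqF.
by rewrite lerDl addr_ge0// ?divr_ge0 ?mulr_ge0// ltW.
Qed.

Lemma H1_norm_U_sub_le (m1 m2 : fmeasure) :
  (H1_norm (fun z => (U m1 z - U m2 z)%R) <=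
   (Num.sqrt ((1 + (alpha ^+ 2)^-1) *
     (\int[m1]_y (U m1 y - U m2 y) - \int[m2]_y (U m1 y - U m2 y))))%:E)%E.
Proof.
have [i1 i2 <-] := convolution_energy_sub alpha_gt0 m1 m2.
apply: le_trans (H1_norm_le (is_weak_deriv_U_sub m1 m2) i1 i2) _.
rewrite lee_fin ler_wsqrtr//.
apply: weighted_sum_le; first by rewrite exprn_gt0.
  by apply: Rintegral_ge0 => z _; rewrite sqr_ge0.
by apply: Rintegral_ge0 => z _; rewrite sqr_ge0.
Qed.

Lemma H1_norm_U_le (mu : fmeasure) :
  (H1_norm (U mu) <= (Num.sqrt ((1 + (alpha ^+ 2)^-1) * \int[mu]_y U mu y))%:E)%E.
Proof.
rewrite -(convolution_energy alpha_gt0 mu mu).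
have i1 := integrable_mulU alpha_gt0 mu (measurable_U alpha_gt0 mu) (U_le alpha_gt0 mu).
have i2 := integrable_mulDU alpha_gt0 mu (measurable_DU alpha_gt0 mu) (DU_le alpha_gt0 mu).
apply: le_trans (H1_norm_le (is_weak_deriv_U mu) _ _) _ => //.
rewrite lee_fin ler_wsqrtr//.
have E (f : R -> R) : \int[leb]_z (f z ^+ 2) = \int[leb]_z (f z * f z).
  by apply: eq_Rintegral => z _; rewrite expr2.
rewrite !E; apply: weighted_sum_le; first by rewrite exprn_gt0.
  by apply: Rintegral_ge0 => z _; rewrite -expr2 sqr_ge0.
by apply: Rintegral_ge0 => z _; rewrite -expr2 sqr_ge0.
Qed.

Lemma in_H1_U (mu : fmeasure) : in_H1 (U mu).
Proof.
have i1 := integrable_mulU alpha_gt0 mu (measurable_U alpha_gt0 mu) (U_le alpha_gt0 mu).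
have i2 := integrable_mulDU alpha_gt0 mu (measurable_DU alpha_gt0 mu) (DU_le alpha_gt0 mu).
split; first exact: L2_norm_lty.
by exists (DU mu); [exact: is_weak_deriv_U|exact: L2_norm_lty].
Qed.

End Sobolev.

(** * Differentiation on the half-line *)

Section derivatives_on_Rplus.
Variable R : realType.
Implicit Types f : R -> R.

Lemma is_deriv_RplusP f (t l : R) : is_deriv_Rplus f t l <->
  forall e : R, 0 < e -> \forall s \near t, s != t -> 0 <= s ->
    `|l - quot_Rplus f t s| < e.
Proof.
rewrite /is_deriv_Rplus; split.
  move=> /cvgrPdist_lt H e e0; have := H e e0.
  rewrite !near_withinE; apply: filterS => s Hs st s0.
  by apply: Hs => //=; rewrite in_itv/= s0.
move=> H; apply/cvgrPdist_lt => e e0; rewrite !near_withinE.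
apply: filterS (H e e0) => s Hs st; rewrite /= in_itv/= andbT => s0.
exact: Hs.
Qed.

(** A whole neighbourhood of a positive time lies in the half-line, so the relative difference
    quotient serves as Caratheodory slope of the ordinary derivative. *)
Lemma is_deriv_Rplus_interior f (t l : R) : 0 < t -> is_deriv_Rplus f t l ->
  has_derivative f t l.
Proof.
move=> t0 /is_deriv_RplusP H; apply/is_derive1_caratheodory.
exists (fun z => if z == t then l else quot_Rplus f t z); split.
- move=> z; case: eqP => [->|/eqP zt]; first by rewrite !subrr mulr0.
  by rewrite /quot_Rplus divfK// subr_eq0.
- apply/cvgrPdist_lt => e e0; rewrite eqxx; near=> z.
  case: eqP => [_|/eqP zt]; first by rewrite subrr normr0.
  have : z != t -> 0 <= z -> `|l - quot_Rplus f t z| < e.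
    by near: z; exact: H.
  by apply => //; apply/ltW; near: z; exact: lt_nbhsr.
- by rewrite eqxx.
Unshelve. all: by end_near. Qed.

Definition continuous_Rplus f := forall t : R, 0 <= t ->
  forall e : R, 0 < e -> \forall s \near t, 0 <= s -> `|f t - f s| < e.

Lemma is_deriv_Rplus_continuous f (f' : R -> R) :
  (forall t : R, 0 <= t -> is_deriv_Rplus f t (f' t)) -> continuous_Rplus f.
Proof.
move=> H t t0 e e0.
have /is_deriv_RplusP/(_ 1 ltr01) Ht := H t t0.
have c0 : 0 < e / (`|f' t| + 1) by rewrite divr_gt0// ltr_wpDl.
near=> s => s0; have [->|st] := eqVneq s t; first by rewrite subrr normr0.
have h1 : `|f' t - quot_Rplus f t s| < 1.
  have : s != t -> 0 <= s -> `|f' t - quot_Rplus f t s| < 1.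
    by near: s; exact: Ht.
  exact.
have h2 : `|t - s| < e / (`|f' t| + 1).
  by near: s; apply: nbhsx_ballx.
have -> : f t - f s = quot_Rplus f t s * (t - s).
  have /divfK E : s - t != 0 by rewrite subr_eq0.
  by rewrite /quot_Rplus -(opprB s t) mulrN E opprB.
rewrite normrM.
have h3 : `|quot_Rplus f t s| <= `|f' t| + 1.
  rewrite -[X in `|X|](subrK (f' t)) addrC (le_trans (ler_normD _ _))// lerD2l.
  by rewrite distrC ltW.
rewrite (le_lt_trans (ler_wpM2r _ h3))//.
by rewrite mulrC -ltr_pdivlMr// ltr_wpDl.
Unshelve. all: by end_near. Qed.

(** Freezing [f] at its value in 0 for negative times reduces the half-line notion to continuity on
    the whole line, where the usual rules apply. *)
Lemma continuous_RplusP f : continuous_Rplus f <->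
  continuous (fun t : R => f (Num.max 0 t)).
Proof.
split.
  move=> H t; apply/cvgrPdist_lt => e e0.
  have m0 s : 0 <= Num.max 0 s :> R by rewrite le_max lexx.
  have := H (Num.max 0 t) (m0 t) e e0.
  move=> /nbhs_ballP[d /= d0 Hd].
  apply/nbhs_ballP; exists d => //= s; rewrite /ball/= => ts.
  apply: Hd => //; rewrite /ball/=; apply: le_lt_trans ts.
  have [t0|t0] := leP 0 t; have [s0|s0] := leP 0 s; rewrite ?subrr ?normr0//.
    by rewrite subr0 (ger0_norm t0) ger0_norm; lra.
  by rewrite sub0r normrN (ger0_norm s0) distrC ger0_norm; lra.
move=> H t t0 e e0; have /cvgrPdist_lt/(_ e e0) := H t.
apply: filterS => s; rewrite (max_idPr t0) => + s0.
by rewrite (max_idPr s0).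
Qed.

Lemma continuous_Rplus_within f (a b : R) : 0 <= a -> continuous_Rplus f ->
  {within `[a, b], continuous f}.
Proof.
move=> a0 /continuous_RplusP cf.
have := continuous_subspaceT (A := `[a, b]) cf.
apply: subspace_eq_continuous => s; rewrite inE/= in_itv/= => /andP[as_ _].
by rewrite /from_subspace /= (max_idPr (le_trans a0 as_)).
Qed.

Lemma MVT_Rplus f (f' : R -> R) (a b : R) : 0 <= a -> a < b ->
  (forall t : R, 0 < t -> has_derivative f t (f' t)) -> continuous_Rplus f ->
  exists2 c, a < c < b & f b - f a = f' c * (b - a).
Proof.
move=> a0 ab df cf.
have dab t : t \in `]a, b[ -> is_derive t 1 f (f' t).
  by rewrite in_itv/= => /andP[at_ _]; apply: df; exact: le_lt_trans at_.
have [c + E] := MVT ab dab (continuous_Rplus_within (b := b) a0 cf).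
by rewrite in_itv/=; exists c.
Qed.

(** The sign of the derivative is asked only up to [T], because the bound on [slope] that is
    available first is local in time. *)
Lemma le_Rplus f (f' : R -> R) (a b T : R) : 0 <= a -> a <= b -> b <= T ->
  (forall t : R, 0 < t -> has_derivative f t (f' t)) -> continuous_Rplus f ->
  (forall t : R, 0 < t -> t < T -> f' t <= 0) -> f b <= f a.
Proof.
move=> a0; rewrite le_eqVlt => /predU1P[->//|ab] bT df cf f'0.
have [c /andP[ac cb] E] := MVT_Rplus a0 ab df cf.
rewrite -subr_le0 E mulr_le0_ge0 ?subr_ge0 ?(ltW ab)//; apply: f'0.
  exact: le_lt_trans ac.
exact: lt_le_trans bT.
Qed.

Lemma lipschitz_Rplus f (f' : R -> R) (C s t : R) : 0 <= s -> 0 <= t ->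
  (forall t : R, 0 < t -> has_derivative f t (f' t)) -> continuous_Rplus f ->
  (forall t : R, 0 < t -> `|f' t| <= C) -> `|f t - f s| <= C * `|t - s|.
Proof.
move=> + + df cf f'C; wlog st : s t / s <= t.
  by move=> H s0 t0; have [/H|/ltW/H] := leP s t; [exact|rewrite distrC (distrC t); exact].
move=> s0 t0; move: st; rewrite le_eqVlt => /predU1P[->|st].
  by rewrite !subrr normr0 mulr0.
have [c /andP[sc cb] ->] := MVT_Rplus s0 st df cf.
by rewrite normrM ler_wpM2r// f'C// (le_lt_trans s0).
Qed.

Lemma continuous_RplusD f g : continuous_Rplus f -> continuous_Rplus g ->
  continuous_Rplus (fun t => f t + g t).
Proof.
move=> /continuous_RplusP cf /continuous_RplusP cg; apply/continuous_RplusP.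
exact: continuous_addr.
Qed.

Lemma continuous_RplusM f g : continuous_Rplus f -> continuous_Rplus g ->
  continuous_Rplus (fun t => f t * g t).
Proof.
move=> /continuous_RplusP cf /continuous_RplusP cg; apply/continuous_RplusP.
exact: continuous_mulr.
Qed.

Lemma continuous_RplusT f : continuous f -> continuous_Rplus f.
Proof.
move=> cf t t0 e e0; have /cvgrPdist_lt/(_ e e0) := cf t.
by apply: filterS.
Qed.

Lemma continuous_Rplus_comp f g : continuous_Rplus f -> continuous g ->
  continuous_Rplus (fun t => g (f t)).
Proof.
move=> /continuous_RplusP cf cg; apply/continuous_RplusP => t.
by apply: (continuous_comp (cf t)); exact: cg.
Qed.

Lemma continuous_Rplus_sum n (F : 'I_n -> R -> R) :
  (forall i, continuous_Rplus (F i)) ->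
  continuous_Rplus (fun t => \sum_(i < n) F i t).
Proof.
move=> cF.
rewrite (_ : (fun _ => _) = \sum_(i < n) F i); last first.
  by apply/funext => t; rewrite fct_sumE.
elim/big_ind : _ => [|f g cf cg|i _]; last exact: cF.
  by apply: continuous_RplusT; exact: continuous_const.
exact: continuous_RplusD.
Qed.

Lemma has_derivative_sum n (F : 'I_n -> R -> R) (dF : 'I_n -> R) (t : R) :
  (forall i, has_derivative (F i) t (dF i)) ->
  has_derivative (fun s => \sum_(i < n) F i s) t (\sum_(i < n) dF i).
Proof.
move=> d; rewrite (_ : (fun _ => _) = \sum_(i < n) F i); last first.
  by apply/funext => s; rewrite fct_sumE.
elim/big_ind2 : _ => [|f df g dg cf cg|i _]; last exact: d.
  exact: has_derivative_const.
exact: has_derivative_addr.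
Qed.

End derivatives_on_Rplus.

(** * Particle solutions *)

Section particles.
Variable R : realType.
Variable alpha : R.
Hypothesis alpha_gt0 : 0 < alpha.
Notation G := (Green alpha).
Notation DG := (dGreen alpha).
Variables (N : nat) (x p : 'I_N -> R -> R).
Hypothesis sol : particle_solution alpha x p.

(** [velocity] is [u = G * m] and [slope] is [u_x = G' * m] for the particle measure [m]: the system
    reads [x' = u(x)], [p' = - p u_x(x)]. At a particle the self-term of [slope] is 0 because
    [DG 0 = 0]. *)
Definition velocity (t y : R) : R := \sum_(i < N) p i t * G (y - x i t).
Definition slope (t y : R) : R := \sum_(i < N) p i t * DG (y - x i t).

Lemma dGreenN d : DG (- d) = - DG d.
Proof. by rewrite /dGreen EabsN sgrN mulrN mulNr opprK. Qed.

Lemma dGreen0 : DG 0 = 0.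
Proof. by rewrite /dGreen sgr0 mulr0 mul0r oppr0. Qed.

Lemma position_deriv j t : 0 <= t -> is_deriv_Rplus (x j) t (velocity t (x j t)).
Proof.
move=> t0; have := @ps_eq_x _ _ _ _ _ sol j t t0; rewrite /velocity mulr_sumr.
by under eq_bigr => i _ do rewrite mulrCA -GreenE.
Qed.

Lemma momentum_deriv j t : 0 <= t ->
  is_deriv_Rplus (p j) t (- p j t * slope t (x j t)).
Proof.
move=> t0; have := @ps_eq_p _ _ _ _ _ sol j t t0; rewrite /slope.
rewrite [X in is_deriv_Rplus _ _ X -> _](_ : _ =
  - p j t * \sum_(i < N) p i t * DG (x j t - x i t)) //.
rewrite [in RHS](bigD1 j)//= subrr dGreen0 mulr0 add0r !mulr_sumr.
by apply: eq_bigr => i _; rewrite /dGreen /Eabs; ring.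
Qed.

Lemma continuous_position j : continuous_Rplus (x j).
Proof. exact: is_deriv_Rplus_continuous (@position_deriv j). Qed.

Lemma continuous_momentum j : continuous_Rplus (p j).
Proof. exact: is_deriv_Rplus_continuous (@momentum_deriv j). Qed.

Lemma position_has_derivative j t : 0 < t ->
  has_derivative (x j) t (velocity t (x j t)).
Proof. by move=> t0; apply: is_deriv_Rplus_interior => //; exact/position_deriv/ltW. Qed.

Lemma momentum_has_derivative j t : 0 < t ->
  has_derivative (p j) t (- p j t * slope t (x j t)).
Proof. by move=> t0; apply: is_deriv_Rplus_interior => //; exact/momentum_deriv/ltW. Qed.

Lemma sum_antisym (A : 'I_N -> 'I_N -> R) : (forall i j, A i j = - A j i) ->
  \sum_(i < N) \sum_(j < N) A i j = 0.
Proof.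
move=> AA; set S := (X in X = 0).
suff : S = - S by lra.
rewrite [in RHS]/S exchange_big/= -sumrN; apply: eq_bigr => i _.
by rewrite -sumrN; apply: eq_bigr => j _.
Qed.

(** [DG] is odd, so the terms [p_i p_j DG(x_i - x_j)] of the derivative cancel in pairs. *)
Lemma sum_momentum t : 0 <= t -> \sum_(i < N) p i t = 1.
Proof.
move=> t0; rewrite -(ps_p0_sum sol).
apply/eqP; rewrite -subr_eq0 -normr_le0.
(* Constancy is obtained as a Lipschitz bound with constant 0. *)
apply: le_trans (_ : _ <= 0 * `|t - 0|) _; last by rewrite mul0r.
apply: (@lipschitz_Rplus _ (fun t => \sum_(i < N) p i t)
  (fun t => \sum_(i < N) - p i t * slope t (x i t))) => //.
- by move=> s s0; apply: has_derivative_sum => i; exact: momentum_has_derivative.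
- by apply: continuous_Rplus_sum => i; exact: continuous_momentum.
move=> s s0; rewrite normr_le0 /slope; apply/eqP.
under eq_bigr do rewrite mulr_sumr.
apply: sum_antisym => i j.
by rewrite -(opprB (x j s) (x i s)) dGreenN; ring.
Qed.

Lemma continuous_Rplus_bounded (f : R -> R) (T : R) : 0 <= T ->
  continuous_Rplus f -> exists2 M : R, 0 <= M &
  forall t, 0 <= t -> t <= T -> `|f t| <= M.
Proof.
move=> T0 /continuous_RplusP cf.
have cnf : continuous (fun t : R => `|f (Num.max 0 t)|).
  by move=> z; apply: cvg_norm; exact: cf.
have [c _ cmax] := EVT_max T0 (continuous_subspaceT cnf).
exists `|f (Num.max 0 c)| => // t t0 tT.
have := cmax t; rewrite in_itv/= t0 tT (max_idPr t0); exact.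
Qed.

(** An a priori bound that depends on [N] and [T]. It serves to establish the sign of the momenta,
    after which [slope_le] gives the uniform constant [cDG]. *)
Lemma slope_bounded (T : R) : 0 <= T -> exists2 K : R, 0 <= K &
  forall t y, 0 <= t -> t <= T -> `|slope t y| <= K.
Proof.
move=> T0.
have /choice[M HM] i : exists M : R, 0 <= M /\ forall t, 0 <= t -> t <= T -> `|p i t| <= M.
  by have [M] := continuous_Rplus_bounded T0 (continuous_momentum i); exists M.
exists (\sum_(i < N) M i * cDG alpha).
  by apply: sumr_ge0 => i _; rewrite mulr_ge0 ?cDG_ge0//; case: (HM i).
move=> t y t0 tT; rewrite (le_trans (ler_norm_sum _ _ _))//.
apply: ler_sum => i _; have [M0 HMi] := HM i.
by rewrite normrM ler_pM// ?HMi// dGreen_le.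
Qed.

Let expRk (k t : R) : has_derivative (fun s => expR (k * s)) t (k * expR (k * t)).
Proof.
have h : has_derivative (fun s => k * s) t k.
  apply: has_derivative_conv; first by do !derive_step.
  by rewrite /=; ring.
apply: has_derivative_conv; first exact: (@is_derive1_comp _ expR _ _ _ _ _ h).
by rewrite mulrC.
Qed.

Let expRkc k : continuous (fun t : R => expR (k * t)).
Proof. exact: has_derivative_continuous (expRk k). Qed.

(** A Gronwall argument on squares: [p^2 exp(2 K t)] is nondecreasing and [p^2 exp(- 2 K t)]
    nonincreasing when [|slope| <= K]. Hence a momentum that starts at 0 stays 0, and one that
    starts positive never reaches 0. *)
Lemma momentum_ge0 j t : 0 <= t -> 0 <= p j t.
Proof.
move=> t0; have [K K0 HK] := slope_bounded t0.
pose f (k s : R) := p j s * p j s * expR (k * s).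
pose f' (k s : R) := p j s * p j s * (k * expR (k * s)) +
  expR (k * s) * (p j s * (- p j s * slope s (x j s)) +
                  p j s * (- p j s * slope s (x j s))).
have df k s : 0 < s -> has_derivative (f k) s (f' k s).
  move=> s0; have dp := momentum_has_derivative j s0.
  apply: has_derivative_mulr; last exact: expRk.
  exact: has_derivative_mulr.
have cf k : continuous_Rplus (f k).
  apply: continuous_RplusM; last exact: continuous_RplusT (@expRkc k).
  by apply: continuous_RplusM; exact: continuous_momentum.
have f'E k s : f' k s = p j s * p j s * expR (k * s) * (k - 2 * slope s (x j s)).
  by rewrite /f'; ring.
have pe s k : 0 <= p j s * p j s * expR (k * s).
  by rewrite mulr_ge0 ?expR_ge0// -expr2 sqr_ge0.
have dec : f (- (2 * K)) t <= f (- (2 * K)) 0.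
  apply: (le_Rplus (T := t) (lexx 0) t0 (lexx t) (df _) (cf _)) => s s0 st.
  rewrite f'E mulr_ge0_le0//.
  have := HK s (x j s) (ltW s0) (ltW st); rewrite ler_norml => /andP[+ _]; lra.
have inc : - f (2 * K) t <= - f (2 * K) 0.
  apply: (le_Rplus (T := t) (f := fun s => - f (2 * K) s) (f' := fun s => - f' (2 * K) s)
    (lexx 0) t0 (lexx t)).
  - by move=> s s0; apply: has_derivative_oppr; exact: df.
  - apply: (continuous_Rplus_comp (cf _) (g := fun y => - y)).
    by move=> y; apply: cvgN; exact: cvg_id.
  - move=> s s0 st; rewrite f'E oppr_le0 mulr_ge0//.
    have := HK s (x j s) (ltW s0) (ltW st); rewrite ler_norml => /andP[_]; lra.
have p0 := ps_p0_ge0 sol j.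
have [p00|pn0] := eqVneq (p j 0) 0.
  have : f (- (2 * K)) t <= 0 by rewrite (le_trans dec)// /f p00 !mul0r.
  rewrite /f pmulr_lle0 ?expR_gt0// => pp.
  have : p j t ^+ 2 == 0 by rewrite eq_le expr2 pp -expr2 sqr_ge0.
  by rewrite sqrf_eq0 => /eqP ->.
have p0_gt0 : 0 < p j 0 by rewrite lt_def pn0.
rewrite leNgt; apply/negP => ptlt0.
(* A negative value at [t] would force a zero at some [c], against [p(0)^2 <= p(c)^2 exp(2 K c)]. *)
have [c ct pc0] : exists2 c, c \in `[0, t] & p j c = 0.
  apply: IVT => //; first exact: (continuous_Rplus_within (lexx 0) (continuous_momentum j)).
  by rewrite ge_min (ltW ptlt0) orbT le_max p0.
move: ct; rewrite in_itv/= => /andP[c0 ct].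
have : - f (2 * K) c <= - f (2 * K) 0.
  apply: (le_Rplus (T := t) (f := fun s => - f (2 * K) s) (f' := fun s => - f' (2 * K) s)
    (lexx 0) c0 ct).
  - by move=> s s0; apply: has_derivative_oppr; exact: df.
  - apply: (continuous_Rplus_comp (cf _) (g := fun y => - y)).
    by move=> y; apply: cvgN; exact: cvg_id.
  - move=> s s0 st; rewrite f'E oppr_le0 mulr_ge0//.
    have := HK s (x j s) (ltW s0) (ltW st); rewrite ler_norml => /andP[_]; lra.
rewrite /f pc0 !mul0r mulr0 expR0 mulr1 oppr0 oppr_ge0 leNgt.
by rewrite mulr_gt0.
Qed.

(** A convex combination of values of [G], hence a bound free of [N]. *)
Lemma velocity_le t y : 0 <= t -> `|velocity t y| <= cG alpha.
Proof.
move=> t0; rewrite (le_trans (ler_norm_sum _ _ _))//.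
rewrite -[leRHS]mul1r -(sum_momentum t0) mulr_suml; apply: ler_sum => i _.
by rewrite normrM (ger0_norm (momentum_ge0 _ t0)) ler_wpM2l ?momentum_ge0// Green_le.
Qed.

Lemma slope_le t y : 0 <= t -> `|slope t y| <= cDG alpha.
Proof.
move=> t0; rewrite (le_trans (ler_norm_sum _ _ _))//.
rewrite -[leRHS]mul1r -(sum_momentum t0) mulr_suml; apply: ler_sum => i _.
by rewrite normrM (ger0_norm (momentum_ge0 _ t0)) ler_wpM2l ?momentum_ge0// dGreen_le.
Qed.

Lemma position_lipschitz j s t : 0 <= s -> 0 <= t ->
  `|x j t - x j s| <= cG alpha * `|t - s|.
Proof.
move=> s0 t0; apply: lipschitz_Rplus (@position_has_derivative j) _ _ => //.
  exact: continuous_position.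
by move=> r r0; exact/velocity_le/ltW.
Qed.

(* Freezing the signs of p_i t - p_i s turns the l^1 distance into the increment
   of a single function of time. *)
Lemma momentum_lipschitz s t : 0 <= s -> 0 <= t ->
  \sum_(i < N) `|p i t - p i s| <= cDG alpha * `|t - s|.
Proof.
move=> s0 t0; pose e i := Num.sg (p i t - p i s).
have -> : \sum_(i < N) `|p i t - p i s| =
    \sum_(i < N) e i * p i t - \sum_(i < N) e i * p i s.
  by rewrite -sumrB; apply: eq_bigr => i _; rewrite -mulrBr normrEsg.
rewrite (le_trans (ler_norm _))//.
apply: (@lipschitz_Rplus _ (fun t => \sum_(i < N) e i * p i t)
  (fun t => \sum_(i < N) e i * (- p i t * slope t (x i t)))) => //.
- move=> r r0; apply: has_derivative_sum => i; apply: has_derivative_mull.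
  exact: momentum_has_derivative.
- apply: continuous_Rplus_sum => i; apply: continuous_RplusM.
    by apply: continuous_RplusT; exact: continuous_const.
  exact: continuous_momentum.
move=> r r0; have r0' := ltW r0; rewrite (le_trans (ler_norm_sum _ _ _))//.
rewrite -[leRHS]mul1r -(sum_momentum r0') mulr_suml; apply: ler_sum => i _.
rewrite !normrM normrN (ger0_norm (momentum_ge0 _ r0')).
rewrite -[leRHS]mul1r ler_pM ?mulr_ge0 ?momentum_ge0//.
  by rewrite /e normr_sg; case: (_ == _).
by rewrite ler_wpM2l ?momentum_ge0// slope_le.
Qed.

(** The integral of [f] against the particle measure; [integral_particle_measure] makes the
    identification. *)
Definition particle_sum (f : R -> R) (t : R) : R := \sum_(i < N) p i t * f (x i t).

(** The first part is the change of momenta, the second the motion of the positions at fixed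
    momenta. [e] is the oscillation of [f] over the distance a particle can travel, so Lipschitz and
    merely uniformly continuous [f] are covered alike. *)
Lemma particle_sum_lipschitz (f : R -> R) (M e s t : R) : 0 <= s -> 0 <= t ->
  (forall y, `|f y| <= M) ->
  (forall y z, `|y - z| <= cG alpha * `|t - s| -> `|f y - f z| <= e) ->
  `|particle_sum f t - particle_sum f s| <= M * cDG alpha * `|t - s| + e.
Proof.
move=> s0 t0 fM fe.
have -> : particle_sum f t - particle_sum f s =
    \sum_(i < N) (p i t - p i s) * f (x i t) +
    \sum_(i < N) p i s * (f (x i t) - f (x i s)).
  by rewrite -sumrB -big_split/=; apply: eq_bigr => i _; ring.
have M0 : 0 <= M by exact: le_trans (normr_ge0 _) (fM 0).
rewrite (le_trans (ler_normD _ _))// lerD//.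
  rewrite (le_trans (ler_norm_sum _ _ _))// -mulrA.
  apply: le_trans (ler_wpM2l M0 (momentum_lipschitz s0 t0)).
  by rewrite mulr_sumr; apply: ler_sum => i _; rewrite normrM mulrC ler_wpM2r.
rewrite (le_trans (ler_norm_sum _ _ _))// -[leRHS]mul1r -(sum_momentum s0) mulr_suml.
apply: ler_sum => i _; rewrite normrM (ger0_norm (momentum_ge0 _ s0)).
by rewrite ler_wpM2l ?momentum_ge0// fe// position_lipschitz.
Qed.

Lemma particle_sum_le (f : R -> R) (M t : R) : 0 <= t ->
  (forall y, `|f y| <= M) -> `|particle_sum f t| <= M.
Proof.
move=> t0 fM; rewrite (le_trans (ler_norm_sum _ _ _))//.
rewrite -[leRHS]mul1r -(sum_momentum t0) mulr_suml; apply: ler_sum => i _.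
by rewrite normrM (ger0_norm (momentum_ge0 _ t0)) ler_wpM2l ?momentum_ge0.
Qed.

End particles.

(** * The weak form for particles *)

Section half_plane.
Variable R : realType.
Notation leb := (@lebesgue_measure R).

Definition continuous_Omega (g : R -> R -> R) := forall t y : R, 0 <= t ->
  forall e : R, 0 < e -> exists2 d : R, 0 < d & forall s z : R, 0 <= s ->
    `|t - s| < d -> `|y - z| < d -> `|g t y - g s z| < e.

Lemma continuous_OmegaP (g : R -> R -> R) :
  {within @Omega R, continuous (fun z : R * R => g z.1 z.2)} -> continuous_Omega g.
Proof.
move=> /subspace_continuousP cg t y t0 e e0.
have /cvgrPdist_lt/(_ e e0) := cg (t, y) t0.
rewrite near_withinE => /nbhs_ballP[d /= d0 Hd]; exists d => // s z s0 ts yz.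
by apply: (Hd (s, z)) => //; split.
Qed.

Lemma continuous_Omega_curve (g : R -> R -> R) (y : R -> R) :
  continuous_Omega g -> continuous_Rplus y -> continuous_Rplus (fun t => g t (y t)).
Proof.
move=> cg cy t t0 e e0; have [d d0 Hd] := cg t (y t) t0 e e0.
have cyd := cy t t0 d d0; near=> s => s0.
have ts : `|t - s| < d by near: s; apply: nbhsx_ballx.
have ys : 0 <= s -> `|y t - y s| < d by near: s; exact: cyd.
exact: Hd (ys s0).
Unshelve. all: by end_near. Qed.

Lemma eq_continuous_Rplus (f g : R -> R) : (forall t, 0 <= t -> f t = g t) ->
  continuous_Rplus f -> continuous_Rplus g.
Proof.
move=> fg cf t t0 e e0; apply: filterS (cf t t0 e e0) => s H s0.
by rewrite -!fg//; exact: H.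
Qed.

Lemma Rintegral_FTC_Rplus (f f' : R -> R) (T : R) : 0 < T ->
  (forall t, 0 < t -> has_derivative f t (f' t)) -> continuous_Rplus f ->
  continuous_Rplus f' -> \int[leb]_(t in `[0, T]) f' t = f T - f 0.
Proof.
move=> T0 df /continuous_RplusP cf cf'.
rewrite /Rintegral (@continuous_FTC2 _ f' f)//.
- exact: continuous_Rplus_within.
- split.
  + by move=> t; rewrite in_itv/= => /andP[t0 _]; case: (df t t0).
  + have := cvg_at_right_filter (cf 0); rewrite maxxx; apply: cvg_trans.
    apply: near_eq_cvg; near=> s.
    have s0 : 0 <= s by apply/ltW; near: s; exact: nbhs_right_gt.
    by rewrite (max_idPr s0).
  + have := cvg_at_left_filter (cf T); rewrite (max_idPr (ltW T0)); apply: cvg_trans.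
    apply: near_eq_cvg; near=> s.
    have s0 : 0 <= s by apply/ltW; near: s; exact: nbhs_left_gt.
    by rewrite (max_idPr s0).
- move=> t; rewrite in_itv/= => /andP[t0 _].
  by rewrite derive1E; exact: (@derive_val _ _ _ _ _ _ _ (df t t0)).
Unshelve. all: by end_near. Qed.

(** The increment is split into one along the curve at the fixed time [t] and one in time at the
    fixed point [y s]. The mean value theorem turns the latter into [phit th (y s)] with [th]
    between [t] and [s], and joint continuity of [phit] gives its limit. *)
Lemma has_derivative_curve (phi phit phix : R -> R -> R) (y : R -> R) (t y' : R) :
  0 < t ->
  (forall s z, 0 < s -> has_derivative (phi^~ z) s (phit s z)) ->
  (forall s z, 0 < s -> has_derivative (phi s) z (phix s z)) ->
  continuous_Omega phi -> continuous_Omega phit ->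
  has_derivative y t y' ->
  has_derivative (fun s => phi s (y s)) t (phit t (y t) + phix t (y t) * y').
Proof.
move=> t0 dt dx cphi cphit dy.
have h2 : has_derivative (fun s => phi t (y s)) t (phix t (y t) * y').
  exact: (@is_derive1_comp _ (phi t) _ _ _ _ (dx t (y t) t0) dy).
have h1 : has_derivative (fun s => phi s (y s) - phi t (y s)) t (phit t (y t)).
  apply/is_derive1_caratheodory.
  exists (fun s => if s == t then phit t (y t) else (phi s (y s) - phi t (y s)) / (s - t)).
  split.
  - move=> s; case: eqP => [->|/eqP st]; first by rewrite !subrr mulr0.
    by rewrite subrr subr0 divfK// subr_eq0.
  - apply/cvgrPdist_lt => e e0; rewrite eqxx.
    have [d d0 Hd] := cphit t (y t) (ltW t0) e e0.
    have /differentiable_continuous cy : differentiable y t.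
      by apply/derivable1_diffP; case: dy.
    have bt : \forall s \near t, `|t - s| < d by apply: nbhsx_ballx.
    have cyd : \forall s \near t, `|y t - y s| < d 
      by have /cvgrPdist_lt/(_ d d0) := cy.
    near=> s; case: eqP => [_|/eqP st]; first by rewrite subrr normr0.
    have s0 : 0 < s by near: s; exact: lt_nbhsr.
    have ts : `|t - s| < d by near: s; exact: bt.
    have ys : `|y t - y s| < d by near: s; exact: cyd.
    have cz : continuous_Rplus (phi^~ (y s)).
      exact: continuous_Omega_curve cphi (continuous_RplusT (@continuous_const _ (y s))).
    have [th [th0 tht ->]] : exists th, [/\ 0 <= th, `|t - th| < d &
        (phi s (y s) - phi t (y s)) / (s - t) = phit th (y s)].
      have [st'|ts'] := ltP s t.
        have [c /andP[sc ct] E] := MVT_Rplus (ltW s0) st' (fun r => @dt r (y s)) cz.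
        exists c; split; first by rewrite ltW// (lt_trans s0).
          by move: ts; rewrite !gtr0_norm ?subr_gt0//; lra.
        rewrite -[X in X / _]opprB E -mulrN opprB mulfK// subr_eq0.
        done.
      have {}ts' : t < s by rewrite lt_neqAle eq_sym st.
      have [c /andP[tc cs] E] := MVT_Rplus (ltW t0) ts' (fun r => @dt r (y s)) cz.
      exists c; split; first by rewrite ltW// (lt_trans t0).
        by move: ts; rewrite !ltr0_norm ?subr_lt0//; lra.
      by rewrite E mulfK// subr_eq0.
    exact: Hd.
  - by rewrite eqxx.
apply: has_derivative_conv; last reflexivity.
have := has_derivative_addr h1 h2.
by under eq_fun do rewrite subrK.
Unshelve. all: by end_near. Qed.

End half_plane.

Section particle_weak_form.
Variable R : realType.
Variable alpha : R.
Hypothesis alpha_gt0 : 0 < alpha.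
Notation leb := (@lebesgue_measure R).
Notation G := (Green alpha).
Notation DG := (dGreen alpha).
Variables (N : nat) (x p : 'I_N -> R -> R).
Hypothesis sol : particle_solution alpha x p.
Variables phi phit phix : R -> R -> R.
Hypothesis dt : forall s z, 0 < s -> has_derivative (phi^~ z) s (phit s z).
Hypothesis dx : forall s z, 0 < s -> has_derivative (phi s) z (phix s z).
Hypothesis cphi : continuous_Omega phi.
Hypothesis cphit : continuous_Omega phit.
Hypothesis cphix : continuous_Omega phix.

Definition pair_sum (K : R -> R -> R) (t : R) : R :=
  \sum_(j < N) p j t * \sum_(i < N) p i t * K (x i t) (x j t).

Let cx := continuous_position sol.
Let cp := continuous_momentum sol.

(** The order of the particles is preserved, so the sign of [x j t - x i t] depends on the indices
    alone and the jump of [DG] is never crossed. *)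
Let continuous_dGreen_trajectory i j :
  continuous_Rplus (fun t => DG (x j t - x i t)).
Proof.
have cE : continuous (Eabs alpha).
  move=> z; rewrite /Eabs; apply: continuous_comp; last exact: continuous_expR.
  apply: cvgM; last exact: cvg_cst; apply: cvgN; apply: cvg_norm.
  exact: cvg_id.
pose s : R := if (i < j)%N then 1 else if (j < i)%N then -1 else 0.
have cxji : continuous_Rplus (fun t => x j t - x i t).
  apply: continuous_RplusD; first exact: cx.
  apply: (continuous_Rplus_comp (@cx i) (g := fun y => - y)).
  by move=> y; apply: cvgN; exact: cvg_id.
apply: (@eq_continuous_Rplus _
  (fun t => - (cDG alpha * s) * Eabs alpha (x j t - x i t))).
  move=> t t0; rewrite /dGreen /cDG /s.
  have [ij|ji|/val_inj ->] := ltngtP i j.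
  - by rewrite gtr0_sg ?subr_gt0 ?(ps_order sol)// mulNr.
  - by rewrite ltr0_sg ?subr_lt0 ?(ps_order sol)// mulNr.
  - by rewrite subrr sgr0 mulNr.
apply: continuous_RplusM; last exact: continuous_Rplus_comp.
by apply: continuous_RplusT; exact: continuous_const.
Qed.

Let continuous_Green_trajectory i j :
  continuous_Rplus (fun t => G (x j t - x i t)).
Proof.
have cE : continuous G.
  move=> z; rewrite /Green; apply: cvgM; first exact: cvg_cst.
  apply: continuous_comp; last exact: continuous_expR.
  apply: cvgM; last exact: cvg_cst; apply: cvgN; apply: cvg_norm.
  exact: cvg_id.
apply: (continuous_Rplus_comp (f := fun t => x j t - x i t)) => //.
apply: continuous_RplusD; first exact: cx.
apply: (continuous_Rplus_comp (@cx i) (g := fun y => - y)).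
by move=> y; apply: cvgN; exact: cvg_id.
Qed.

Let particle_sum_deriv (t : R) : R :=
  \sum_(j < N) (p j t * (phit t (x j t) + phix t (x j t) * velocity alpha x p t (x j t))
    + phi t (x j t) * (- p j t * slope alpha x p t (x j t))).

(** [M] is averaged with its transpose; as [G] is even and [DG] odd, the half sum is [CH_kernel]. *)
Let particle_sum_derivE t :
  particle_sum_deriv t = particle_sum x p (phit t) t +
    pair_sum (CH_kernel alpha (phi t) (phix t)) t.
Proof.
pose M j i := p j t * (p i t * (phix t (x j t) * G (x j t - x i t)
   - phi t (x j t) * DG (x j t - x i t))).
transitivity (particle_sum x p (phit t) t + \sum_(j < N) \sum_(i < N) M j i).
  rewrite /particle_sum_deriv /particle_sum -big_split/=; apply: eq_bigr => j _.
  rewrite mulrDr -addrA; congr (_ + _); rewrite /velocity /slope /M.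
  rewrite !mulr_sumr -big_split/=; apply: eq_bigr => i _; ring.
congr (_ + _); rewrite /pair_sum.
transitivity (\sum_(j < N) \sum_(i < N) 2^-1 * (M j i + M i j)).
  under [in RHS]eq_bigr do rewrite -mulr_sumr big_split/=.
  rewrite -mulr_sumr big_split/= [X in _ = 2^-1 * (_ + X)]exchange_big/=.
  by field.
apply: eq_bigr => j _; rewrite mulr_sumr; apply: eq_bigr => i _.
rewrite /CH_kernel /M -(opprB (x i t) (x j t)) GreenN dGreenN.
by field.
Qed.

Lemma continuous_particle_sum (f : R -> R -> R) : continuous_Omega f ->
  continuous_Rplus (fun t => particle_sum x p (f t) t).
Proof.
move=> cf; apply: continuous_Rplus_sum => j; apply: continuous_RplusM.
  exact: cp.
exact: continuous_Omega_curve.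
Qed.

(** Continuity is read off from the form before symmetrization, in which every factor is continuous
    along the trajectories. *)
Lemma continuous_pair_sum_kernel :
  continuous_Rplus (fun t => particle_sum x p (phit t) t +
    pair_sum (CH_kernel alpha (phi t) (phix t)) t).
Proof.
apply: (@eq_continuous_Rplus _ particle_sum_deriv).
  by move=> t _; exact: particle_sum_derivE.
apply: continuous_Rplus_sum => j; apply: continuous_RplusD.
  apply: continuous_RplusM; first exact: cp.
  apply: continuous_RplusD; first exact: continuous_Omega_curve.
  apply: continuous_RplusM; first exact: continuous_Omega_curve.
  apply: continuous_Rplus_sum => i; apply: continuous_RplusM; first exact: cp.
  exact: continuous_Green_trajectory.
apply: continuous_RplusM; first exact: continuous_Omega_curve.
apply: continuous_RplusM.
  apply: (continuous_Rplus_comp (@cp j) (g := fun y => - y)).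
  by move=> y; apply: cvgN; exact: cvg_id.
apply: continuous_Rplus_sum => i; apply: continuous_RplusM; first exact: cp.
exact: continuous_dGreen_trajectory.
Qed.

Lemma particle_weak_form (T : R) : 0 < T ->
  \int[leb]_(t in `[0, T]) (particle_sum x p (phit t) t +
    pair_sum (CH_kernel alpha (phi t) (phix t)) t)
  = particle_sum x p (phi T) T - particle_sum x p (phi 0) 0.
Proof.
move=> T0.
under eq_Rintegral do rewrite -particle_sum_derivE.
apply: (@Rintegral_FTC_Rplus _ (fun t => particle_sum x p (phi t) t)) => //.
- move=> t t0; apply: has_derivative_sum => j.
  have dp := momentum_has_derivative sol j t0.
  have dX := position_has_derivative sol j t0.
  have := has_derivative_curve t0 dt dx cphi cphit dX.
  exact: has_derivative_mulr dp.
- exact: continuous_particle_sum.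
apply: eq_continuous_Rplus continuous_pair_sum_kernel => t _.
by rewrite particle_sum_derivE.
Qed.

End particle_weak_form.

(** * Functions vanishing at infinity *)

Lemma bounded_onT (R : realType) (T : Type) (f : T -> R) (M : R) (A : set T) :
  (forall z, `|f z| <= M) -> [bounded f z | z in A].
Proof.
move=> fM; exists M; split; first exact: num_real.
by move=> x Mx z _; exact: le_trans (fM z) (ltW Mx).
Qed.

Section C0_functions.
Variable R : realType.
Variable f : R -> R.
Hypothesis f0 : C0 f.

Lemma C0_tail (e : R) : 0 < e -> exists2 B : R, 0 < B &
  forall y, B < `|y| -> `|f y| < e.
Proof.
move=> e0; have [_ fy fNy] := f0.
have /cvgrPdist_lt/(_ e e0)[A [_ HA]] := fy.
have /cvgrPdist_lt/(_ e e0)[A' [_ HA']] := fNy.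
exists (1 + `|A| + `|A'|); first by rewrite -addrA ltr_pwDl.
move=> y; have [y0|y0] := leP 0 y => By.
  rewrite -normrN -sub0r; apply: HA; have := ler_norm A; have := normr_ge0 A'.
  by rewrite (ger0_norm y0) in By; lra.
rewrite -normrN -sub0r; apply: HA'; have := ler_norm (- A'); have := normr_ge0 A.
by rewrite (ltr0_norm y0) in By; rewrite normrN; lra.
Qed.

Lemma C0_continuous : continuous f. Proof. by have [] := f0. Qed.

Lemma measurable_C0 : measurable_fun setT f.
Proof. exact: continuous_measurable_fun C0_continuous. Qed.

Lemma C0_bounded : exists M : R, forall y, `|f y| <= M.
Proof.
have [B B0 HB] := C0_tail ltr01.
have cnf : continuous (fun z => `|f z|).
  by move=> z; apply: cvg_norm; exact: C0_continuous.
have BB : - B <= B by rewrite ge0_cp// ltW.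
have [c _ cmax] := EVT_max BB (continuous_subspaceT cnf).
exists (`|f c| + 1) => y; have [yB|/HB/ltW By] := leP `|y| B.
  by rewrite (le_trans (cmax y _)) ?lerDl// in_itv/= -ler_norml.
by rewrite (le_trans By)// lerDr.
Qed.

(** Compactness handles a segment; beyond it both values of [f] are small. *)
Lemma C0_uniformly_continuous (e : R) : 0 < e -> exists2 d : R, 0 < d &
  forall y z, `|y - z| <= d -> `|f y - f z| <= e.
Proof.
move=> e0; have e20 : 0 < e / 2 by rewrite divr_gt0.
have [B B0 HB] := C0_tail e20.
pose P (d y : R) := forall z, `|y - z| <= d -> `|f y - f z| <= e.
(* The segment exceeds [[- B, B]] by 1 and [d < 1] is imposed below: if [y] lies outside the
   segment, [z] still lies beyond [B]. *)
have cK : compact (`[- (B + 1), B + 1]%classic : set R) by exact: segment_compact.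
have /compact_near_coveringP/(_ R (0 : R)^'+ P) := cK.
move=> /(_ (at_right_proper_filter 0)) H.
have H1 : \forall d \near (0 : R)^'+, `[- (B + 1), B + 1]%classic `<=` P d.
  apply: H => y _.
  have /cvgrPdist_lt/(_ _ e20)/nbhs_ballP[d /= d0 Hd] := @C0_continuous y.
  have d20 : 0 < d / 2 by rewrite divr_gt0.
  exists (ball y (d / 2), [set s | s < d / 2]).
    by split; [exact: nbhsx_ballx|exact: nbhs_right_lt].
  move=> [z s] /= [yz sd] w zw.
  have h1 : `|f y - f z| < e / 2.
    by apply: Hd; rewrite /ball/= in yz *; lra.
  have h2 : `|f y - f w| < e / 2.
    apply: Hd; rewrite /ball/= in yz *.
    by rewrite -(subrKA z) (le_lt_trans (ler_normD _ _))//; lra.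
  rewrite -(subrKA (f y)) (le_trans (ler_normD _ _))// (distrC (f z)).
  lra.
have H2 : \forall d \near (0 : R)^'+,
    [/\ `[- (B + 1), B + 1]%classic `<=` P d, 0 < d & d < 1].
  by near=> d; split; near: d; [exact: H1|exact: nbhs_right_gt|exact: nbhs_right_lt].
have [d [HP d0 d1]] := @filter_ex _ _ (at_right_proper_filter (0 : R)) _ H2.
 exists d => // y z yz.
have [yB|yB] := leP `|y| (B + 1).
  by apply: HP => //; rewrite /= in_itv/= -ler_norml.
have zB : B < `|z|.
  have : `|y| <= `|y - z| + `|z| by rewrite -{1}(subrK z y) ler_normD.
  lra.
have := HB y; have := HB z zB; rewrite (lt_trans _ yB) ?ltrDl// => h /(_ isT) h'.
rewrite (le_trans (ler_normB _ _))//; lra.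
Unshelve. all: by end_near. Qed.

End C0_functions.

(** * Squashing the line into []-1, 1[] *)

Section compactification.
Variable R : realType.

(** An increasing homeomorphism of the line onto []-1, 1[], with inverse [unsquash]. *)
Definition squash (y : R) : R := y / (1 + `|y|).
Definition unsquash (r : R) : R := r / (1 - `|r|).
(* The value at the two added points +-1 is 0, as befits C_0. *)
Definition squashed (f : R -> R) (r : R) : R :=
  if `|r| < 1 then f (unsquash r) else 0.

Lemma norm_squash y : `|squash y| = `|y| / (1 + `|y|).
Proof. by rewrite /squash normrM normfV [X in _ / X]ger0_norm ?addr_ge0. Qed.

Lemma norm_squash_lt1 y : `|squash y| < 1.
Proof. by rewrite norm_squash ltr_pdivrMr ?mul1r ?ltrDr// ltr_pwDl. Qed.

Lemma squashK y : unsquash (squash y) = y.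
Proof.
rewrite /unsquash norm_squash /squash.
have y0 := normr_ge0 y.
by field; apply/andP; split; lra.
Qed.

Lemma squashedE f y : squashed f (squash y) = f y.
Proof. by rewrite /squashed norm_squash_lt1 squashK. Qed.

Lemma le_squash y z : y <= z -> squash y <= squash z.
Proof.
move=> yz; rewrite /squash.
have y1 : 0 < 1 + `|y| by rewrite ltr_pwDl.
have z1 : 0 < 1 + `|z| by rewrite ltr_pwDl.
rewrite ler_pdivrMr// mulrAC ler_pdivlMr//.
have [y0|y0] := ger0P y; have [z0|z0] := ger0P z; nra.
Qed.

Lemma unsquash_cvg (u : nat -> R) (r : R) : `|r| < 1 -> u n @[n --> \oo] --> r ->
  unsquash (u n) @[n --> \oo] --> unsquash r.
Proof.
move=> r1 ur; apply: cvgM => //; apply: cvgV; first by rewrite subr_eq0 gt_eqF.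
by apply: cvgB; [exact: cvg_cst|exact: cvg_norm].
Qed.

(** If [|r| < 1] this is continuity of [f]. Otherwise [unsquash (u n)] leaves every bounded set
    along the indices with [|u n| < 1], and [f] vanishes at infinity. *)
Lemma squashed_cvg (f : R -> R) (u : nat -> R) (r : R) : C0 f ->
  u n @[n --> \oo] --> r -> squashed f (u n) @[n --> \oo] --> squashed f r.
Proof.
move=> f0 ur; have nur : `|u n| @[n --> \oo] --> `|r| by exact: cvg_norm.
rewrite /squashed; case: ifPn => r1.
  have : f (unsquash (u n)) @[n --> \oo] --> f (unsquash r).
    by apply: continuous_cvg; [exact: C0_continuous|exact: unsquash_cvg].
  apply: cvg_trans; apply: near_eq_cvg; near=> n.
  suff -> : `|u n| < 1 by [].
  by near: n; have /cvgr_lt := nur; exact.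
apply/cvgrPdist_lt => e e0; have [B B0 HB] := C0_tail f0 e0.
(* [B / (1 + B)] is [squash B]: past it, [unsquash] exceeds [B] in absolute value. *)
have Bn : \forall n \near \oo, B / (1 + B) < `|u n|.
  have /cvgr_gt := nur; apply; rewrite -leNgt in r1; apply: lt_le_trans r1.
  by rewrite ltr_pdivrMr ?mul1r ?ltrDr// addr_gt0.
near=> n; rewrite sub0r normrN.
case: ifPn => un; last by rewrite normr0.
apply: HB; rewrite /unsquash normrM normfV [X in _ / X]ger0_norm ?subr_ge0 ?ltW//.
rewrite ltr_pdivlMr ?subr_gt0//.
have : B / (1 + B) < `|u n| by near: n; exact: Bn.
rewrite ltr_pdivrMr ?addr_gt0//; nra.
Unshelve. all: by end_near. Qed.

Lemma squashed_continuous (f : R -> R) : C0 f -> continuous (squashed f).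
Proof.
move=> f0 r; apply/(@cvg_nbhsP _ R^o) => u ur; exact: squashed_cvg.
Qed.

Lemma squashed_bounded (f : R -> R) (M : R) : (forall y, `|f y| <= M) ->
  forall r, `|squashed f r| <= M.
Proof.
move=> fM r; rewrite /squashed; case: ifP => // _.
by rewrite normr0 (le_trans _ (fM 0)).
Qed.

Let measurable_inv : measurable_fun setT (@GRing.inv R).
Proof.
have -> : [set: R] = [set~ 0] `|` [set 0] by rewrite setUC setUv.
apply/measurable_funU => //; first exact: measurableC.
split; last exact: measurable_fun_set1.
apply: open_continuous_measurable_fun.
  by apply/closed_openC/accessible_closed_set1/hausdorff_accessible/Rhausdorff.
by move=> r; rewrite inE/= => /eqP r0; exact: inv_continuous.
Qed.

Lemma measurable_unsquash : measurable_fun setT unsquash.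
Proof.
apply: measurable_funM => //.
rewrite (_ : (fun r => (1 - `|r|)^-1) = (@GRing.inv R \o (fun r : R => 1 - `|r|)))//.
apply: measurableT_comp; first exact: measurable_inv.
by apply: measurable_funB => //; exact: normr_measurable.
Qed.

End compactification.

(** * Compactness of the particle measures *)

Section restricted_law.
Variable R : realType.
Notation leb := (@lebesgue_measure R).
Notation BR := (measurableTypeR R).

Section integral_mrestr.
Variables (D : set BR) (mD : measurable D).

(** Lebesgue measure is the sum of its restrictions to [D] and to the complement. The cut-off of [f]
    to [D] vanishes almost everywhere for the second and equals [f] almost everywhere for the
    first. *)
Lemma Rintegral_mrestr (f : R -> R) (M : R) : (leb D < +oo)%E ->
  measurable_fun setT f -> (forall y, `|f y| <= M) ->
  \int[mrestr leb mD]_y f y = \int[leb]_(y in D) f y.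
Proof.
move=> Dfin mf fM.
have mDC := measurableC mD.
have mfD : measurable_fun setT (f \_ D).
  by apply/(measurable_restrict f mD measurableT); exact: measurable_funS mf.
have fDM y : `|(f \_ D) y| <= M.
  rewrite patchE; case: ifP => // _.
  by rewrite [point](_ : _ = 0 :> R)// normr0 (le_trans _ (fM 0)).
have i1 : (mrestr leb mD).-integrable setT (EFin \o (f \_ D)).
  apply: measurable_bounded_integrable => //.
    by rewrite /= /mrestr setTI.
  exact: bounded_onT fDM.
have z2 : ae_eq (mrestr leb mDC) setT (EFin \o (f \_ D)) (cst 0%E).
  exists D; split => //; first by rewrite /= /mrestr setICr measure0.
  move=> y /= /not_implyP[_]; apply: contra_notP => nDy.
  by rewrite patchE memNset.
have mE : measurable_fun setT (EFin \o (f \_ D)) by exact/measurable_EFinP.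
have i2 : (mrestr leb mDC).-integrable setT (EFin \o (f \_ D)).
  apply/integrableP; split => //.
  rewrite (ae_eq_integral (cst 0%E))//; first by rewrite integral0.
  - exact: measurableT_comp.
  - by move: z2; apply: filterS => y zy _; have := zy I; rewrite /= => -[->]; rewrite normr0.
rewrite [RHS]Rintegral_mkcond /Rintegral; congr fine.
rewrite [RHS](_ : _ = \int[leb]_y (EFin \o (f \_ D)) y)%E//.
rewrite (@eq_measure_integral _ _ _ _
  (measure_add (mrestr leb mD) (mrestr leb mDC)) leb); last first.
  move=> A mA _; apply: (etrans _ (esym (measure_addE (mrestr leb mD) (mrestr leb mDC) A))).
  rewrite /= /mrestr -measureU.
  - by rewrite -setIUr setUv setIT.
  - exact: measurableI.
  - exact: measurableI.
  - by rewrite setIACA setICr setI0.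
rewrite integral_measure_add//.
rewrite [X in (_ + X)%E](ae_eq_integral (cst 0%E))// integral0 adde0.
apply: ae_eq_integral => //; first exact/measurable_EFinP.
exists (~` D); split => //; first by rewrite /= /mrestr setIC setICr measure0.
move=> y /= /not_implyP[_]; apply: contra_not => Dy.
by rewrite patchE mem_set.
Qed.

End integral_mrestr.

(** The image under [g] of Lebesgue measure restricted to [D]. The proofs are arguments of the
    definition so that the measure structures declared below can be attached to it. *)
Definition law (D : set BR) (g : BR -> BR) of measurable D
    & measurable_fun setT g & (leb D <= 1)%E :=
  fun A : set BR => leb (g @^-1` A `&` D).

Variables (D : set BR) (g : BR -> BR).
Hypothesis (mD : measurable D) (mg : measurable_fun setT g) (D1 : (leb D <= 1)%E).
Notation lawg := (law mD mg D1).

Let law0 : lawg set0 = 0%E.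
Proof. by rewrite /law preimage_set0 set0I measure0. Qed.

Let law_ge0 A : (0 <= lawg A)%E.
Proof. exact: measure_ge0. Qed.

Let law_sigma_additive : semi_sigma_additive lawg.
Proof.
move=> F mF tF mUF; rewrite /law preimage_bigcup.
apply: (@measure_semi_sigma_additive _ _ _ (mrestr leb mD) (fun n => g @^-1` F n)).
- by move=> n; rewrite -[X in measurable X]setTI; exact: mg.
- apply/trivIsetP => /= i j _ _ ij; rewrite -preimage_setI.
  by move/trivIsetP : tF => /(_ _ _ _ _ ij) ->//; rewrite preimage_set0.
- by rewrite -preimage_bigcup -[X in measurable X]setTI; exact: mg.
Qed.

HB.instance Definition _ := isMeasure.Build _ _ _ lawg law0 law_ge0 law_sigma_additive.

Let law_setT : (lawg setT <= 1)%E.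
Proof. by rewrite /law preimage_setT setTI. Qed.

HB.instance Definition _ := Measure_isSubProbability.Build _ _ _ lawg law_setT.

Lemma Rintegral_law (f : R -> R) (M : R) : measurable_fun setT f ->
  (forall y, `|f y| <= M) -> \int[lawg]_y f y = \int[leb]_(s in D) f (g s).
Proof.
move=> mf fM; have mfg : measurable_fun setT (f \o g) by exact: measurableT_comp.
have Dfin : (leb D < +oo)%E by exact: le_lt_trans D1 (ltry _).
rewrite -(@Rintegral_mrestr _ mD (f \o g) M)//; last by move=> s; exact: fM.
rewrite /Rintegral; congr fine.
rewrite -[LHS]/(\int[pushforward (mrestr leb mD) g]_y (f y)%:E)%E.
rewrite integral_pushforward//; first exact/measurable_EFinP.
rewrite preimage_setT; apply: measurable_bounded_integrable => //.
  by rewrite /= /mrestr setTI.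
by apply: (@bounded_onT _ _ _ M) => z; exact: fM.
Qed.

End restricted_law.

(** * Quantile functions of particle measures *)

Section quantile.
Variable R : realType.
Notation leb := (@lebesgue_measure R).
Variables (N : nat) (w y : 'I_N -> R).

(** The mass carried by the particles before index [k]; [k] runs through [nat] so that [cum N] is
    the total mass. *)
Definition cum (k : nat) : R := \sum_(i < N | (i < k)%N) w i.

(* After [squash] the quantiles lie in [-1, 1]: no tightness is needed, as mass
   escaping to infinity shows up as the limit values +-1. *)
Definition quantile (s : R) : R :=
  \big[Num.max/(-1)]_(i < N | cum i <= s) squash (y i).

Lemma quantile_homo s s' : s <= s' -> quantile s <= quantile s'.
Proof.
move=> ss'; apply/bigmax_leP; split; first exact: bigmax_ge_id.
by move=> i si; apply: le_bigmax_cond; exact: le_trans ss'.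
Qed.

Lemma quantile_norm s : `|quantile s| <= 1.
Proof.
rewrite ler_norml bigmax_ge_id/=; apply/bigmax_leP; split; first by lra.
by move=> i _; have := norm_squash_lt1 (y i); rewrite ltr_norml => /andP[_ /ltW].
Qed.

Hypothesis w0 : forall i, 0 <= w i.
Hypothesis w1 : \sum_(i < N) w i = 1.
Hypothesis ymono : forall i j : 'I_N, (i < j)%N -> y i <= y j.

Lemma cum0 : cum 0 = 0.
Proof. by rewrite /cum big_pred0. Qed.

Lemma cumS (i : 'I_N) : cum i.+1 = cum i + w i.
Proof.
rewrite /cum (bigD1 i)//= addrC; congr (_ + _); apply: eq_bigl => j.
by rewrite ltnS ltn_neqAle andbC.
Qed.

Lemma cumN : cum N = 1.
Proof. by rewrite /cum -w1; apply: eq_bigl => i; rewrite ltn_ord. Qed.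

Lemma le_cum (k l : nat) : (k <= l)%N -> cum k <= cum l.
Proof.
move=> kl; rewrite /cum !(big_mkcond (fun i : 'I_N => (i < _)%N))/=.
apply: ler_sum => i _; case: ifPn => [ik|_]; last by case: ifP.
by rewrite (leq_trans ik kl).
Qed.

Lemma cum_ge0 k : 0 <= cum k.
Proof. by rewrite -cum0 le_cum. Qed.

(** A later [j] with [cum j <= s] would give [cum i.+1 <= s]. So [i] is the last index in the
    maximum and, the positions being ordered, attains it. *)
Lemma quantileE (i : 'I_N) s : cum i <= s -> s < cum i.+1 ->
  quantile s = squash (y i).
Proof.
move=> si si1; apply/eqP; rewrite eq_le; apply/andP; split; last first.
  exact: le_bigmax_cond.
apply/bigmax_leP; split.
  by have := norm_squash_lt1 (y i); rewrite ltr_norml => /andP[/ltW].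
move=> j sj; apply: le_squash; have [ij|ji|/val_inj ->//] := ltngtP i j.
  by have := le_lt_trans (le_trans (le_cum ij) sj) si1; rewrite ltxx.
exact: ymono.
Qed.

(** The quantile transports Lebesgue measure on [[0, 1[] to the particle measure, in squashed
    coordinates. The constancy intervals are added one at a time. *)
Lemma Rintegral_quantile (f : R -> R) : C0 f ->
  \int[leb]_(s in `[0, 1[) squashed f (quantile s) = \sum_(i < N) w i * f (y i).
Proof.
move=> f0; have [M fM] := C0_bounded f0.
pose h s := squashed f (quantile s).
have mh : measurable_fun setT h.
  apply: measurableT_comp.
    exact: continuous_measurable_fun (squashed_continuous f0).
  by apply: nondecreasing_measurable => // s s'; exact: quantile_homo.
have ih (a b : R) : leb.-integrable `[a, b[ (EFin \o h).
  apply: measurable_bounded_integrable => //.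
  - by rewrite /= lebesgue_measure_itv/=; case: ifP => //= _; rewrite -EFinB ltry.
  - exact: measurable_funS mh.
  - by apply: (@bounded_onT _ _ _ M) => z; exact: squashed_bounded.
have key (k : nat) : (k <= N)%N ->
    \int[leb]_(s in `[0, cum k[) h s = \sum_(i < N | (i < k)%N) w i * f (y i).
  elim: k => [_|k IH kN].
    by rewrite cum0 set_itvco0 Rintegral_set0 big_pred0.
  have c0 := cum_ge0 k; have ck := le_cum (leqnSn k).
  have -> : `[0, cum k.+1[%classic = `[0, cum k[ `|` `[cum k, cum k.+1[ :> set R.
    apply/seteqP; split => s /=; rewrite !in_itv/=.
      by move=> /andP[s0 s1]; have [ks|sk] := leP (cum k) s; [right|left]; rewrite ?s0 ?s1.
    case=> /andP[s0 s1]; first by rewrite s0 (lt_le_trans s1).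
    by rewrite (le_trans c0).
  rewrite Rintegral_setU//; last 2 first.
  - apply: measurable_bounded_integrable => //; first exact: measurableU.
    + apply: le_lt_trans (measureU2 _ _ _) _ => //.
      by rewrite /= !lebesgue_measure_itv/=; do 2 case: ifP => //= _; rewrite ?adde0 ?add0e -?EFinB -?EFinD ltry.
    + exact: measurable_funS mh.
    + by apply: (@bounded_onT _ _ _ M) => z; exact: squashed_bounded.
  - apply/disj_setPS => s [] /=; rewrite !in_itv/= => /andP[_ sk] /andP[ks _].
    by have := lt_le_trans sk ks; rewrite ltxx.
  pose i := Ordinal kN.
  have -> : \int[leb]_(s in `[cum k, cum k.+1[) h s = w i * f (y i).
    transitivity (\int[leb]_(s in `[cum k, cum k.+1[) (f (y i))).
      apply: eq_Rintegral => s; rewrite inE/= in_itv/= => /andP[ks sk].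
      by rewrite /h (quantileE (i := i))// squashedE.
    rewrite Rintegral_cst// mulrC /= lebesgue_measure_itv/= (cumS i) lte_fin ltrDl.
    (* A particle of zero momentum has an empty interval, where the length formula takes its other
       branch. *)
    have := w0 i; rewrite le_eqVlt => /predU1P[<-|->]; first by rewrite ltxx/= !mul0r.
    by rewrite -EFinB/= addrAC subrr add0r.
  rewrite IH ?(ltnW kN)// [RHS](bigD1 i)//= addrC; congr (_ + _).
  by apply: eq_bigl => j; rewrite ltnS ltn_neqAle andbC.
have := key N (leqnn N); rewrite cumN => ->.
by apply: eq_bigl => i; rewrite ltn_ord.
Qed.

End quantile.

(** * Helly selection for monotone functions *)

Section Helly.
Variable R : realType.
Notation leb := (@lebesgue_measure R).
Notation BR := (measurableTypeR R).
Variable q : nat -> R -> R.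
Hypothesis q_homo : forall n s s', s <= s' -> q n s <= q n s'.
Hypothesis q_norm : forall n s, `|q n s| <= 1.
Hypothesis q_cvg : forall r : rat, cvgn (fun n => q n (ratr r)).

Let H (r : rat) : R := limn (fun n => q n (ratr r)).

Let H_cvg r : q n (ratr r) @[n --> \oo] --> H r.
Proof. exact: q_cvg. Qed.

Let H_norm r : `|H r| <= 1.
Proof. by apply: (cvg_norm_le (@H_cvg r)) => n; exact: q_norm. Qed.

Let S (s : R) : set R := [set H r | r in [set r : rat | ratr r < s]].

(** The left-continuous version of the limit at rationals, defined and monotone on the whole
    line. *)
Definition helly_limit (s : R) : R := sup (S s).
Notation Q := helly_limit.

Let S_sup s : has_sup (S s).
Proof.
split.
  have /rat_in_itvoo[r] : s - 1 < s by rewrite ltrBlDr ltrDl.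
  by rewrite in_itv/= => /andP[_ rs]; exists (H r), r.
by exists 1 => _ [r _ <-]; rewrite (le_trans (ler_norm _)).
Qed.

Let H_le_Q r s : ratr r < s -> H r <= Q s.
Proof. by move=> rs; apply: sup_upper_bound; [exact: S_sup|exists r]. Qed.

Lemma helly_limit_homo s s' : s <= s' -> Q s <= Q s'.
Proof.
move=> ss'; apply: sup_le_ub; first by case: (S_sup s).
by move=> _ [r rs <-]; apply: H_le_Q; exact: lt_le_trans ss'.
Qed.

Lemma measurable_helly_limit : measurable_fun setT Q.
Proof. by apply: nondecreasing_measurable => // s s'; exact: helly_limit_homo. Qed.

Let bad : set R := [set s | ~ (q n s @[n --> \oo] --> Q s)].

(** Without such a rational gap, the values [H r] to the right of [s] come arbitrarily close to
    [Q s], as those to the left do by definition; monotonicity then squeezes [q n s] to [Q s]. *)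
Let badP s : bad s -> exists rho : rat, Q s < ratr rho /\
  forall r : rat, s < ratr r -> ratr rho < H r.
Proof.
move=> bs; apply: contrapT => /forallNP nrho; apply: bs.
have Hr e : 0 < e -> exists2 r : rat, s < ratr r & H r < Q s + e.
  move=> e0; have /rat_in_itvoo[rho] : Q s < Q s + e by rewrite ltrDl.
  rewrite in_itv/= => /andP[Qr rQ]; apply: contrapT => nr.
  apply: (nrho rho); split => // r sr; apply: (lt_le_trans rQ).
  by rewrite leNgt; apply/negP => Hr; apply: nr; exists r.
apply/cvgrPdist_lt => e e0; have e20 : 0 < e / 2 by rewrite divr_gt0.
have [r sr Hre] := Hr _ e20.
have [_ [r' r's <-] Hr'] := sup_adherent e20 (S_sup s).
have h1 : \forall n \near \oo, q n (ratr r) < H r + e / 2.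
  by have /cvgr_lt := H_cvg (r := r); apply; rewrite ltrDl.
have h2 : \forall n \near \oo, H r' - e / 2 < q n (ratr r').
  by have /cvgr_gt := H_cvg (r := r'); apply; rewrite ltrBlDr ltrDl.
near=> n; rewrite ltr_norml.
have g1 : q n (ratr r) < H r + e / 2 by near: n; exact: h1.
have g2 : H r' - e / 2 < q n (ratr r') by near: n; exact: h2.
have k1 : q n s <= q n (ratr r) by apply: q_homo; exact: ltW.
have k2 : q n (ratr r') <= q n s by apply: q_homo; exact: ltW.
rewrite -/(Q s) in Hr'; lra.
Unshelve. all: by end_near. Qed.

(* Every discontinuity of the limit contains a rational gap, and gaps at distinct
   points are disjoint. *)
Lemma helly_ae : {ae leb, forall s, q n s @[n --> \oo] --> Q s}.
Proof.
have cbad : countable bad.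
  have /choice[rho Hrho] s : exists rho : rat, bad s -> Q s < ratr rho /\
      forall r : rat, s < ratr r -> ratr rho < H r.
    have [/badP[rho ?]|nb] := pselect (bad s); first by exists rho.
    by exists 0.
  apply/countable_injP; exists (pickle \o rho) => s s' /[!inE] bs bs' /=.
  move=> /(pcan_inj pickleK) ee.
  wlog ss' : s s' bs bs' ee / s < s'.
    move=> W; have [ss'|ss'|//] := ltgtP s s'; first exact: W.
    by apply/esym; apply: W.
  have /rat_in_itvoo[r] := ss'; rewrite in_itv/= => /andP[sr rs'].
  have [_ /(_ r sr) h1] := Hrho s bs; have [h2 _] := Hrho s' bs'.
  have := lt_trans (lt_le_trans h1 (H_le_Q rs')) h2.
  by rewrite ee ltxx.
exists bad; split; last by [].
  exact: countable_measurable.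
exact: countable_lebesgue_measure0.
Qed.

(** The levels whose limit quantile is a genuine point of the line. Levels with limit [+1] or [-1]
    carry the mass lost at infinity, so the limit law may have mass below 1. *)
Let D : set BR := `[0, 1[%classic `&` [set s | `|Q s| < 1].

Let mD : measurable D.
Proof.
apply: measurableI; first exact: measurable_itv.
have mQ : measurable_fun setT (fun s : R => `|Q s|).
  by apply: (measurableT_comp _ measurable_helly_limit); exact: normr_measurable.
rewrite (_ : [set s | _] = setT `&` (fun s : R => `|Q s|) @^-1` `]-oo, 1[).
  by apply: mQ => //; exact: measurable_itv.
by apply/seteqP; split => s /=; rewrite in_itv /=; [split|case].
Qed.

Let mg : measurable_fun setT (fun s : BR => unsquash (Q s) : BR).
Proof.
exact: (measurableT_comp (@measurable_unsquash R) measurable_helly_limit).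
Qed.

Let D1 : (leb D <= 1)%E.
Proof.
apply: (@le_trans _ _ (leb `[0, 1[%classic)).
  by apply: le_measure; rewrite ?inE; [exact: mD|exact: measurable_itv|exact: subIsetl].
by rewrite lebesgue_measure_itv/= lte_fin ltr01 oppr0 adde0.
Qed.

Definition helly_measure : subprobability BR R := law mD mg D1.

Lemma helly_measure_cvg (f : R -> R) : C0 f ->
  \int[leb]_(s in `[0, 1[) squashed f (q n s) @[n --> \oo] -->
  \int[helly_measure]_y f y.
Proof.
move=> f0; have [M fM] := C0_bounded f0.
have M0 : 0 <= M by exact: le_trans (normr_ge0 _) (fM 0).
(* Outside [D] the integrand is 0 by the convention of [squashed]. *)
have -> : \int[helly_measure]_y f y = \int[leb]_(s in `[0, 1[) squashed f (Q s).
  rewrite (Rintegral_law mD mg D1 (measurable_C0 f0) fM).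
  rewrite Rintegral_mkcondr; apply: eq_Rintegral => s _.
  rewrite /squashed patchE; case: ifPn.
    by rewrite inE/= => ->.
  by rewrite notin_setE/= => /negP/negbTE ->.
have msq : measurable_fun setT (squashed f).
  exact: continuous_measurable_fun (squashed_continuous f0).
apply: fine_cvg; rewrite fineK; last first.
  apply: integrable_fin_num => //; apply: measurable_bounded_integrable => //.
  - by rewrite /= lebesgue_measure_itv/= lte_fin ltr01 -EFinB ltry.
  - apply: (measurable_funS measurableT) => //.
    exact: measurableT_comp msq measurable_helly_limit.
  - by apply: (@bounded_onT _ _ _ M) => z; exact: squashed_bounded.
have [] := @dominated_convergence _ _ _ leb `[0, 1[%classic (measurable_itv _)
   (fun n s => (squashed f (q n s))%:E) (fun s => (squashed f (Q s))%:E) (cst M%:E).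
- move=> n; apply/measurable_EFinP; apply: (measurable_funS measurableT) => //.
  apply: measurableT_comp msq _.
  by apply: nondecreasing_measurable => // s s'; exact: q_homo.
- apply/measurable_EFinP; apply: (measurable_funS measurableT) => //.
  exact: measurableT_comp msq measurable_helly_limit.
- have [B [mB B0 HB]] := helly_ae; exists B; split => //.
  apply: subset_trans HB => s /=; apply: contra_not => qs _.
  apply: cvg_EFin; first exact: nearW.
  exact: squashed_cvg.
- apply: measurable_bounded_integrable => //.
  - by rewrite /= lebesgue_measure_itv/= lte_fin ltr01 -EFinB ltry.
  - by apply: (@bounded_onT _ _ _ M) => z; rewrite /= ger0_norm.
- by apply: aeW => s n _; rewrite lee_fin squashed_bounded.
by [].
Qed.

End Helly.

(** * Diagonal extraction *)

Section diagonal.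
Variable R : realType.

Lemma strictly_increasing_ge (f : nat -> nat) :
  (forall k l, (k < l)%N -> (f k < f l)%N) -> forall k, (k <= f k)%N.
Proof.
move=> fS; elim=> // k IH; exact: leq_ltn_trans IH (fS _ _ (ltnSn k)).
Qed.

Lemma cvg_subsequence (u : nat -> R) (l : R) (s : nat -> nat) :
  (forall i j, (i < j)%N -> (s i < s j)%N) ->
  u n @[n --> \oo] --> l -> u (s k) @[k --> \oo] --> l.
Proof.
move=> sS ul; apply: cvg_comp ul.
move=> A [n _ An]; exists n => // k /= nk; apply: An => /=.
exact: leq_trans nk (strictly_increasing_ge sS k).
Qed.

(** Iterated Bolzano-Weierstrass: [F (i, g)] refines the extraction [g] made so far so that the
    [i]-th sequence converges, and the diagonal of the nested extractions works for all [i]. *)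
Lemma diagonal_subsequence (u : nat -> nat -> R) :
  (forall i n, `|u i n| <= 1) ->
  exists2 s : nat -> nat, (forall k l, (k < l)%N -> (s k < s l)%N) &
    forall i, cvgn (fun k => u i (s k)).
Proof.
move=> u1.
have /choice[F HF] (ig : nat * (nat -> nat)) : exists f : nat -> nat,
    (forall k l, (k < l)%N -> (f k < f l)%N) /\
    cvgn (fun k => u ig.1 (ig.2 (f k))).
  have [|f fS fc] := @bolzano_weierstrass R (fun k => u ig.1 (ig.2 k)).
    by apply: (@bounded_onT _ _ _ 1) => k; exact: u1.
  exists f; split => // k l; rewrite !ltnNge => kl; apply: contra kl.
  by have := fS l k; rewrite leEnat => <-.
pose G := fix G i := match i with
  | 0%N => F (0%N, id) | S j => G j \o F (j.+1, G j) end.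
have GS i : forall k l, (k < l)%N -> (G i k < G i l)%N.
  elim: i => [|i IH] k l kl; first by have [+ _] := HF (0%N, id); exact.
  by apply: IH; have [+ _] := HF (i.+1, G i); exact.
have Gc i : cvgn (fun k => u i (G i k)).
  case: i => [|i]; first by have [] := HF (0%N, id).
  by have [] := HF (i.+1, G i).
(* Every later extraction is [G i] reindexed by some [H] with [k <= H k], so from index [i] on the
   diagonal inherits the limit found by [G i]. *)
have GH i d : exists H : nat -> nat, (forall k, (k <= H k)%N) /\
    forall k, G (i + d)%N k = G i (H k).
  elim: d => [|d [H [Hk HG]]]; first by exists id; split => // k; rewrite addn0.
  have [FS _] := HF ((i + d).+1, G (i + d)%N).
  exists (H \o F ((i + d).+1, G (i + d)%N)); split => k; last first.
    by rewrite addnS /= HG.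
  exact: leq_trans (strictly_increasing_ge FS k) (Hk _).
exists (fun k => G k k).
  have step k : (G k k < G k.+1 k.+1)%N.
    apply: GS; have [FS _] := HF (k.+1, G k).
    exact: leq_trans (strictly_increasing_ge FS k.+1).
  move=> k l; elim: l => // l IH; rewrite ltnS leq_eqVlt => /predU1P[->//|kl].
  exact: ltn_trans (IH kl) (step l).
move=> i; have /cvg_ex[l ul] := Gc i; apply/cvg_ex; exists l.
apply/cvgrPdist_lt => e e0; have /cvgrPdist_lt/(_ e e0)[n _ Hn] := ul.
exists (maxn i n) => // k /=; rewrite geq_max => /andP[ik nk].
have [H [Hk HG]] := GH i (k - i)%N; have := HG k; rewrite subnKC// => ->.
by apply: Hn => /=; exact: leq_trans nk (Hk k).
Qed.

End diagonal.

Section compactness.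
Variable R : realType.
Variable alpha : R.
Hypothesis alpha_gt0 : 0 < alpha.
Notation BR := (measurableTypeR R).
Variables x p : forall N : nat, 'I_N -> R -> R.
Hypothesis sol : forall N, (0 < N)%N -> particle_solution alpha (@x N) (@p N).

(** Index [n] means [n.+1] particles: momenta of no particle at all could not sum to 1. *)
Let S n (f : R -> R) t := particle_sum (@x n.+1) (@p n.+1) f t.
Let q n t := quantile (fun i => @p n.+1 i t) (fun i => @x n.+1 i t).

Let Sq n t (f : R -> R) : 0 <= t -> C0 f ->
  \int[@lebesgue_measure R]_(s in `[0, 1[) squashed f (q n t s) = S n f t.
Proof.
move=> t0 f0; have soln := sol (ltn0Sn n).
apply: Rintegral_quantile => //.
- by move=> i; exact: (momentum_ge0 alpha_gt0 soln).
- exact: (sum_momentum soln).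
- by move=> i j ij; apply/ltW; exact: (ps_order soln).
Qed.

Let helly_at (s : nat -> nat) (t : R) : 0 <= t ->
  (forall r : rat, cvgn (fun n => q (s n) t (ratr r))) ->
  exists m : subprobability BR R, forall f, C0 f ->
    S (s n) f t @[n --> \oo] --> \int[m]_y f y.
Proof.
move=> t0 qc.
exists (@helly_measure R (fun n => q (s n) t)
  (fun n => @quantile_norm R _ _ _) qc) => f f0.
have := @helly_measure_cvg R (fun n => q (s n) t)
  (fun n => @quantile_homo R _ _ _) (fun n => @quantile_norm R _ _ _) qc f f0.
by under eq_cvg do rewrite Sq//.
Qed.

Lemma time_equicontinuity (f : R -> R) : C0 f -> forall e : R, 0 < e ->
  exists2 d : R, 0 < d & forall n s t, 0 <= s -> 0 <= t -> `|t - s| <= d ->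
    `|S n f t - S n f s| <= e.
Proof.
move=> f0 e e0; have [M fM] := C0_bounded f0.
have M0 : 0 <= M by exact: le_trans (normr_ge0 _) (fM 0).
have e20 : 0 < e / 2 by rewrite divr_gt0.
have [d d0 Hd] := C0_uniformly_continuous f0 e20.
have c1 : 0 < cG alpha + 1 by rewrite ltr_wpDl ?cG_ge0.
have c2 : 0 < M * cDG alpha + 1 by rewrite ltr_wpDl ?mulr_ge0 ?cDG_ge0.
(* The first bound keeps displacements below [d], the second keeps the momentum part below [e / 2];
   adding 1 makes the denominators positive. *)
exists (Num.min (d / (cG alpha + 1)) (e / 2 / (M * cDG alpha + 1))).
  by rewrite lt_min !divr_gt0.
move=> n s t s0 t0; rewrite le_min => /andP[h1 h2].
apply: le_trans (particle_sum_lipschitz alpha_gt0 (sol (ltn0Sn n)) (e := e / 2)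
  s0 t0 fM _) _.
  move=> y z yz; apply: Hd; apply: le_trans yz _.
  move: h1; rewrite ler_pdivlMr// mulrDr mulr1 mulrC; apply: le_trans.
  by rewrite lerDl.
move: h2; rewrite ler_pdivlMr// mulrDr mulr1 => h2.
have := normr_ge0 (t - s); rewrite [M * _ * _]mulrC; lra.
Qed.

Lemma particle_compactness : exists (s : nat -> nat) (m : R -> subprobability BR R),
  (forall k l, (k < l)%N -> (s k < s l)%N) /\
  forall t f, 0 <= t -> C0 f -> S (s k) f t @[k --> \oo] --> \int[m t]_y f y.
Proof.
(* One extraction serves all pairs of a rational time [a] and a rational level [r], coded by natural
   numbers; a number that codes no pair gets the constant 0. *)
have [|s sS sc] := @diagonal_subsequence R (fun i n =>
    if (unpickle i : option (rat * rat)) is Some (a, r)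
    then q n (ratr a) (ratr r) else 0).
  by move=> i n; case: unpickle => [[a r]|]; rewrite ?normr0//; exact: quantile_norm.
have rat_cvg (a : rat) f : 0 <= ratr a :> R -> C0 f -> cvgn (fun k => S (s k) f (ratr a)).
  move=> a0 f0; have [|m Hm] := @helly_at s (ratr a) a0.
    by move=> r; have := sc (pickle (a, r)); rewrite pickleK.
  by apply/cvg_ex; exists (\int[m]_y f y); exact: Hm.
have pos (t : R) : 0 <= Num.max 0 t by rewrite le_max lexx.
(* [Num.max 0 t] makes the choice total over the reals. *)
have /choice[m Hm] t : exists m : subprobability BR R, forall f, C0 f ->
    S (s k) f (Num.max 0 t) @[k --> \oo] --> \int[m]_y f y.
  move: (Num.max 0 t) (pos t) => {}t t0.
  (* The further subsequence [tau], which depends on [t], only produces the candidate [m];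
     convergence is then shown along [s] itself. *)
  have [|tau tauS tauc] := @diagonal_subsequence R (fun i k =>
      if (unpickle i : option rat) is Some r then q (s k) t (ratr r) else 0).
    by move=> i n; case: unpickle => [r|]; rewrite ?normr0//; exact: quantile_norm.
  have [|m Hm] := @helly_at (s \o tau) t t0.
    by move=> r; have := tauc (pickle r); rewrite pickleK.
  exists m => f f0; apply/cvgrPdist_lt => e e0.
  have e40 : 0 < e / 4 by rewrite divr_gt0.
  have [d d0 Hd] := time_equicontinuity f0 e40.
  (* At a rational time [a] within [d] of [t], convergence along [s] is known. Three errors of at
     most [e / 4] separate [S (s k) f t] from the candidate. *)
  have /rat_in_itvoo[a] : t < t + d by rewrite ltrDl.
  rewrite in_itv/= => /andP[ta ad]; have a0 : 0 <= ratr a :> R by rewrite (le_trans t0) ?ltW.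
  have /cvg_ex[/= l al] := rat_cvg a f a0 f0.
  have close n : `|S n f t - S n f (ratr a)| <= e / 4.
    by apply: Hd => //; rewrite distrC ger0_norm; lra.
  have Ll : `|\int[m]_y f y - l| <= e / 4.
    have al' := cvg_subsequence tauS al.
    have dc : `|S (s (tau k)) f t - S (s (tau k)) f (ratr a)| @[k --> \oo] -->
        `|\int[m]_y f y - l| by apply: cvg_norm; apply: cvgB => //; exact: Hm.
    rewrite -(cvg_lim (@Rhausdorff R) dc); apply: limr_le.
      by apply/cvg_ex; eexists; exact: dc.
    by near=> k; exact: close.
  have /cvgrPdist_lt/(_ _ e40) := al; apply: filterS => k lk.
  have -> : \int[m]_y f y - S (s k) f t = (\int[m]_y f y - l) +
    (l - S (s k) f (ratr a)) - (S (s k) f t - S (s k) f (ratr a)) by ring.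
  rewrite (le_lt_trans (ler_normB _ _))//.
  have := ler_normD (\int[m]_y f y - l) (l - S (s k) f (ratr a)).
  have := close (s k); lra.
exists s, m; split => // t f t0 f0.
by have := Hm t f f0; rewrite (max_idPr t0).
Unshelve. all: by end_near. Qed.

End compactness.

(** * Limits of the pair interactions *)

Section Lipschitz_Green.
Variable R : realType.
Variable alpha : R.
Hypothesis alpha_gt0 : 0 < alpha.
Notation G := (Green alpha).
Notation DG := (dGreen alpha).

Lemma has_derivative_lipschitz (f f1 : R -> R) (M : R) :
  (forall z, has_derivative f z (f1 z)) -> (forall z, `|f1 z| <= M) ->
  forall a b, `|f a - f b| <= M * `|a - b|.
Proof.
move=> df f1M a b; wlog ab : a b / b <= a.
  by move=> H; have [/H//|/ltW/H] := leP b a; rewrite distrC (distrC b).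
have cf := has_derivative_continuous df.
have [c _ ->] := MVT_segment ab (fun z _ => df z) (continuous_subspaceT cf).
by rewrite normrM ler_wpM2r.
Qed.

(** For [|b| <= |a|] and [d = (|a| - |b|) / alpha], the difference is [Eabs b] times [1 - exp(- d)],
    and [1 - d <= exp(- d)]. *)
Lemma Eabs_lipschitz a b : `|Eabs alpha a - Eabs alpha b| <= alpha^-1 * `|a - b|.
Proof.
wlog ab : a b / `|b| <= `|a|.
  by move=> H; have [/H//|/ltW/H] := leP `|b| `|a|; rewrite distrC (distrC b).
have ba : Eabs alpha a <= Eabs alpha b.
  by rewrite ler_expR ler_wpM2r ?invr_ge0 ?(ltW alpha_gt0)// lerN2.
rewrite distrC ger0_norm ?subr_ge0//.
pose d := (`|a| - `|b|) / alpha.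
have d0 : 0 <= d by rewrite divr_ge0 ?subr_ge0// ltW.
have E : Eabs alpha a = Eabs alpha b * expR (- d).
  by rewrite /Eabs -expRD /d; congr expR; ring.
have h : 1 - d <= expR (- d) by have := expR_ge1Dx (- d).
have b1 := Eabs_le1 alpha_gt0 b; have b0 := Eabs_ge0 alpha b.
apply: (@le_trans _ _ d); first by rewrite E; nra.
rewrite /d mulrC ler_wpM2l ?invr_ge0 ?(ltW alpha_gt0)//.
exact: (le_trans (ler_norm _) (ler_dist_dist _ _)).
Qed.

Lemma Green_lipschitz a b : `|G a - G b| <= cG alpha / alpha * `|a - b|.
Proof.
rewrite !GreenE -mulrBr normrM (ger0_norm (cG_ge0 alpha_gt0)) -mulrA.
by rewrite ler_wpM2l ?cG_ge0// Eabs_lipschitz.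
Qed.

(** [(1 + r) exp(- r) <= 1] yields an explicit threshold; the added 1 makes it positive. *)
Lemma Eabs_decay (C e : R) : 0 <= C -> 0 < e -> exists2 B : R, 0 < B &
  forall d, B <= `|d| -> C * Eabs alpha d <= e.
Proof.
move=> C0 e0; exists (alpha * (C / e) + 1).
  by rewrite ltr_wpDl// mulr_ge0 ?divr_ge0// ltW.
move=> d Bd; have h : C / e <= `|d| / alpha.
  by rewrite ler_pdivlMr// mulrC (le_trans _ Bd)// lerDl.
have E0 := Eabs_gt0 alpha d.
have : Eabs alpha d * (1 + `|d| / alpha) <= 1.
  have := expR_ge1Dx (`|d| / alpha).
  rewrite -(ler_pM2l E0); move=> /le_trans; apply.
  by rewrite /Eabs mulNr mulrC expRxMexpNx_1.
rewrite ler_pdivrMr// in h => H.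
have d0 : 0 <= `|d| / alpha by rewrite divr_ge0// ltW.
nra.
Qed.

Lemma lipschitz_continuous (f : R -> R) (L : R) :
  (forall a b, `|f a - f b| <= L * `|a - b|) -> continuous f.
Proof.
move=> fL z; apply/cvgrPdist_lt => e e0.
have L1 : 0 < `|L| + 1 by rewrite ltr_wpDl.
have h : \forall y \near z, `|z - y| < e / (`|L| + 1).
  by apply: nbhsx_ballx; rewrite divr_gt0.
near=> y; apply: le_lt_trans (fL _ _) _.
have : `|z - y| < e / (`|L| + 1) by near: y; exact: h.
rewrite ltr_pdivlMr//; have := ler_norm L; have := normr_ge0 (z - y); nra.
Unshelve. all: by end_near. Qed.

Lemma C0_lipschitz (f : R -> R) (L : R) :
  (forall a b, `|f a - f b| <= L * `|a - b|) ->
  (forall e : R, 0 < e -> exists B : R, forall y, B < `|y| -> `|f y| <= e) -> C0 f.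
Proof.
move=> fL f0; split; first exact: lipschitz_continuous fL.
  apply/cvgrPdist_le => e e0; have [B HB] := f0 e e0.
  near=> y; rewrite sub0r normrN; apply: HB.
  by rewrite (lt_le_trans _ (ler_norm _))//; near: y; apply: nbhs_pinfty_gt; rewrite num_real.
apply/cvgrPdist_le => e e0; have [B HB] := f0 e e0.
near=> y; rewrite sub0r normrN; apply: HB.
rewrite -normrN (lt_le_trans _ (ler_norm _))// ltrNr.
by near: y; apply: nbhs_ninfty_lt; rewrite num_real.
Unshelve. all: by end_near. Qed.

Lemma Green_sub_lipschitz z a b :
  `|G (z - a) - G (z - b)| <= cG alpha / alpha * `|a - b|.
Proof.
apply: le_trans (Green_lipschitz _ _) _.
by rewrite (distrC a) [z - a - _](_ : _ = b - a)//; ring.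
Qed.

(** This lets weak-star convergence act on the pointwise values of [u]. *)
Lemma C0_Green z : C0 (fun y => G (z - y)).
Proof.
apply: (C0_lipschitz (Green_sub_lipschitz z)) => e e0.
have [B B0 HB] := Eabs_decay (cG_ge0 alpha_gt0) e0.
exists (B + `|z|) => y By; rewrite (le_trans (norm_Green alpha_gt0 _))//.
apply: HB; have : `|y| <= `|z| + `|z - y|.
  by rewrite -{1}(subKr z y) (le_trans (ler_normB _ _)).
lra.
Qed.

Variables (f f1 : R -> R) (A M M1 M2 : R).
Hypothesis fM : forall z, `|f z| <= M.
Hypothesis f1M : forall z, `|f1 z| <= M1.
Hypothesis fL : forall a b, `|f a - f b| <= M1 * `|a - b|.
Hypothesis f1L : forall a b, `|f1 a - f1 b| <= M2 * `|a - b|.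
Hypothesis f0 : forall z, A < `|z| -> f z = 0.
Hypothesis f10 : forall z, A < `|z| -> f1 z = 0.

Let M0 : 0 <= M. Proof. exact: le_trans (normr_ge0 _) (fM 0). Qed.
Let M10 : 0 <= M1. Proof. exact: le_trans (normr_ge0 _) (f1M 0). Qed.

Let lipschitz_mulr (u v : R -> R) (Mu Mv Lu Lv a a' : R) :
  `|u a'| <= Mu -> `|v a| <= Mv ->
  `|u a - u a'| <= Lu -> `|v a - v a'| <= Lv ->
  `|u a * v a - u a' * v a'| <= Mv * Lu + Mu * Lv.
Proof.
move=> hu hv hLu hLv.
have -> : u a * v a - u a' * v a' = v a * (u a - u a') + u a' * (v a - v a') by ring.
by rewrite (le_trans (ler_normD _ _))// !normrM lerD// ler_pM.
Qed.

Let D b a := (f a - f b) * DG (a - b).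

(** If [a] and [a'] lie on the same side of [b], the product rule applies, [DG] being Lipschitz
    there. Otherwise [|D b c| <= M1 cDG |c - b|] is used at both points, whose distances to [b] add
    up to [|a - a'|]. *)
Let D_lipschitz b a a' :
  `|D b a - D b a'| <= (M1 * cDG alpha + 2 * M * (cDG alpha / alpha)) * `|a - a'|.
Proof.
have c0 := cDG_ge0 alpha.
have side : (b < a /\ b < a') \/ (a < b /\ a' < b) ->
    `|DG (a - b) - DG (a' - b)| <= cDG alpha / alpha * `|a - a'|.
  move=> H; have -> : `|DG (a - b) - DG (a' - b)| =
      cDG alpha * `|Eabs alpha (a - b) - Eabs alpha (a' - b)|.
    rewrite -(ger0_norm c0) -normrM /dGreen /cDG; case: H => -[h h'].
      by rewrite !gtr0_sg ?subr_gt0// -normrN; congr `|_|; ring.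
    by rewrite !ltr0_sg ?subr_lt0//; congr `|_|; ring.
  rewrite -mulrA ler_wpM2l// (le_trans (Eabs_lipschitz _ _))//.
  by rewrite [a - b - _](_ : _ = a - a')//; ring.
have same : (b < a /\ b < a') \/ (a < b /\ a' < b) ->
    `|D b a - D b a'| <= (M1 * cDG alpha + 2 * M * (cDG alpha / alpha)) * `|a - a'|.
  move=> /side h.
  apply: le_trans (@lipschitz_mulr (fun a => f a - f b) (fun a => DG (a - b))
    (2 * M) (cDG alpha) (M1 * `|a - a'|) (cDG alpha / alpha * `|a - a'|) a a' _ _ _ _) _ => //.
  - rewrite (le_trans (ler_normB _ _))//; have := fM a'; have := fM b; lra.
  - exact: dGreen_le.
  - by rewrite [f a - _ - _](_ : _ = f a - f a')//; ring.
  - by rewrite le_eqVlt; apply/orP; left; apply/eqP; ring.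
have D_le c : `|D b c| <= M1 * cDG alpha * `|c - b|.
  by rewrite normrM mulrAC ler_pM// dGreen_le.
have opp : `|a - b| + `|a' - b| <= `|a - a'| ->
    `|D b a - D b a'| <= (M1 * cDG alpha + 2 * M * (cDG alpha / alpha)) * `|a - a'|.
  move=> h; rewrite (le_trans (ler_normB _ _))//.
  apply: le_trans (lerD (D_le a) (D_le a')) _; rewrite -mulrDr mulrDl.
  rewrite (le_trans (ler_wpM2l _ h)) ?mulr_ge0// lerDl.
  by rewrite !mulr_ge0// invr_ge0 ltW.
have [ab|ba] := leP a b.
  have [a'b|ba'] := ltP a' b.
    move: ab; rewrite le_eqVlt => /predU1P[ab|ab]; last by apply: same; right.
    by apply: opp; rewrite ab subrr normr0 add0r distrC.
  apply: opp; rewrite ler0_norm ?subr_le0// ger0_norm ?subr_ge0//.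
  by rewrite ler0_norm ?subr_le0 ?(le_trans ab)//; lra.
have [a'b|ba'] := leP a' b; last by apply: same; left.
apply: opp; rewrite gtr0_norm ?subr_gt0// ler0_norm ?subr_le0//.
by rewrite gtr0_norm ?subr_gt0 ?(le_lt_trans a'b)//; lra.
Qed.

Lemma CH_kernel_lipschitz : exists L : R, forall a a' b,
  `|CH_kernel alpha f f1 a b - CH_kernel alpha f f1 a' b| <= L * `|a - a'|.
Proof.
pose L1 := cG alpha * M2 + 2 * M1 * (cG alpha / alpha).
pose L2 := M1 * cDG alpha + 2 * M * (cDG alpha / alpha).
exists (2^-1 * L1 + 2^-1 * L2) => a a' b.
have h1 : `|(f1 a + f1 b) * G (a - b) - (f1 a' + f1 b) * G (a' - b)| <= L1 * `|a - a'|.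
  apply: le_trans (@lipschitz_mulr (fun a => f1 a + f1 b) (fun a => G (a - b))
    (2 * M1) (cG alpha) (M2 * `|a - a'|) (cG alpha / alpha * `|a - a'|) a a' _ _ _ _) _.
  - rewrite (le_trans (ler_normD _ _))//; have := f1M a'; have := f1M b; lra.
  - exact: Green_le.
  - by rewrite [f1 a + _ - _](_ : _ = f1 a - f1 a')//; ring.
  - rewrite (le_trans (Green_lipschitz _ _))//.
    by rewrite [a - b - _](_ : _ = a - a')//; ring.
  - by rewrite le_eqVlt /L1; apply/orP; left; apply/eqP; ring.
have h2 := D_lipschitz b a a'; rewrite -/L2 /D in h2.
have -> : CH_kernel alpha f f1 a b - CH_kernel alpha f f1 a' b =
   2^-1 * ((f1 a + f1 b) * G (a - b) - (f1 a' + f1 b) * G (a' - b)) -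
   2^-1 * ((f a - f b) * DG (a - b) - (f a' - f b) * DG (a' - b)).
  by rewrite /CH_kernel; ring.
rewrite (le_trans (ler_normB _ _))//.
have -> : (2^-1 * L1 + 2^-1 * L2) * `|a - a'| =
  2^-1 * (L1 * `|a - a'|) + 2^-1 * (L2 * `|a - a'|) by ring.
by apply: lerD; rewrite normrM (@ger0_norm _ 2^-1) ?invr_ge0// ler_wpM2l ?invr_ge0.
Qed.

Lemma CH_kernel_bounded a b :
  `|CH_kernel alpha f f1 a b| <= M1 * cG alpha + M * cDG alpha.
Proof.
have half (u v : R) : `|2^-1 * u * v| = 2^-1 * (`|u| * `|v|).
  by rewrite -mulrA normrM (@ger0_norm _ 2^-1) ?invr_ge0// normrM.
rewrite /CH_kernel (le_trans (ler_normB _ _))// !half.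
have h1 : `|f1 a + f1 b| * `|G (a - b)| <= (2 * M1) * cG alpha.
  rewrite ler_pM// ?Green_le// (le_trans (ler_normD _ _))//.
  by have := f1M a; have := f1M b; lra.
have h2 : `|f a - f b| * `|DG (a - b)| <= (2 * M) * cDG alpha.
  rewrite ler_pM// ?dGreen_le// (le_trans (ler_normB _ _))//.
  by have := fM a; have := fM b; lra.
lra.
Qed.

(** With [b] far outside the support, its own terms vanish. Either [a] is outside too and the kernel
    is 0, or [a] is in the support and [|a - b|] is large, so [G] and [DG] are small. *)
Lemma CH_kernel_decay (e : R) : 0 < e -> exists B : R, forall a b, B < `|b| ->
  `|CH_kernel alpha f f1 a b| <= e.
Proof.
move=> e0; pose C := M1 * cG alpha + M * cDG alpha.
have C0 : 0 <= C by rewrite addr_ge0// mulr_ge0// ?(cG_ge0 alpha_gt0) ?cDG_ge0.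
have [B B0 HB] := Eabs_decay C0 e0.
exists (`|A| + B) => a b Bb.
have Ab : A < `|b| by have := ler_norm A; lra.
rewrite /CH_kernel (f0 Ab) (f10 Ab) addr0 subr0.
have [Aa|aA] := ltP A `|a|.
  by rewrite (f0 Aa) (f10 Aa) mulr0 !mul0r subr0 normr0 ltW.
have Bab : B <= `|a - b|.
  have : `|b| <= `|a| + `|a - b| by rewrite -{1}(subKr a b) (le_trans (ler_normB _ _)).
  have := ler_norm A; lra.
apply: le_trans (HB _ Bab).
have h1 : `|f1 a * G (a - b)| <= M1 * (cG alpha * Eabs alpha (a - b)).
  by rewrite normrM ler_pM// norm_Green.
have h2 : `|f a * DG (a - b)| <= M * (cDG alpha * Eabs alpha (a - b)).
  by rewrite normrM ler_pM// norm_dGreen.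
have half (u v : R) : `|2^-1 * u * v| = 2^-1 * `|u * v|.
  by rewrite -mulrA normrM (@ger0_norm _ 2^-1) ?invr_ge0.
rewrite (le_trans (ler_normB _ _))// !half /C.
have := normr_ge0 (f1 a * G (a - b)); have := normr_ge0 (f a * DG (a - b)).
lra.
Qed.

End Lipschitz_Green.

(** * Double sums against a symmetric [C_0] kernel *)

Section kernel_limit.
Variable R : realType.
Notation BR := (measurableTypeR R).
Variable K : R -> R -> R.
Variable L : R.
Hypothesis KC : forall a b, K a b = K b a.
Hypothesis KL : forall a a' b, `|K a b - K a' b| <= L * `|a - a'|.
Hypothesis K0 : forall e : R, 0 < e -> exists B : R, forall a b, B < `|b| ->
  `|K a b| <= e.
Variable m : subprobability BR R.
Variable n : nat -> nat.
Variables w y : forall k, 'I_(n k) -> R.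
Hypothesis w0 : forall k i, 0 <= @w k i.
Hypothesis w1 : forall k, \sum_(i < n k) w i = 1.
Hypothesis cvg_m : forall f, C0 f ->
  \sum_(i < n k) w i * f (y i) @[k --> \oo] --> \int[m]_z f z.

Let mass_le1 : mass m <= 1. Proof. exact: mass_sub_le1. Qed.

Lemma C0_kernel b : C0 (K^~ b).
Proof.
apply: (@C0_lipschitz _ _ L); first by move=> a a'; exact: KL.
by move=> e e0; have [B HB] := K0 e0; exists B => a Ba; rewrite KC; exact: HB.
Qed.

Let kappa b := \int[m]_a K a b.
Let kappa_ k b := \sum_(i < n k) w i * K (y i) b.

Let kappa_le (b e : R) : (forall a, `|K a b| <= e) -> `|kappa b| <= e.
Proof.
move=> Ke; have e0 : 0 <= e by exact: le_trans (normr_ge0 _) (Ke 0).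
apply: le_trans (Rintegral_le_bound m (measurable_C0 (C0_kernel b)) Ke) _.
by rewrite ler_piMr.
Qed.

Let average_le k (c : 'I_(n k) -> R) (e : R) : (forall i, `|c i| <= e) ->
  `|\sum_(i < n k) w i * c i| <= e.
Proof.
move=> ce; rewrite (le_trans (ler_norm_sum _ _ _))// -[leRHS]mul1r -(w1 k) mulr_suml.
by apply: ler_sum => i _; rewrite normrM (ger0_norm (w0 i)) ler_wpM2l.
Qed.

Let kappa_lipschitz b b' : `|kappa b - kappa b'| <= L * `|b - b'|.
Proof.
have iK c : m.-integrable setT (EFin \o (K^~ c)).
  have [M KM] := C0_bounded (C0_kernel c).
  exact: integrable_bounded (measurable_C0 (C0_kernel c)) KM.
rewrite /kappa -RintegralB//.
have KL' a : `|K a b - K a b'| <= L * `|b - b'| by rewrite !(KC a); exact: KL.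
have e0 := le_trans (normr_ge0 _) (KL' 0).
apply: le_trans (Rintegral_le_bound m _ KL') _; last by rewrite ler_piMr.
by apply: measurable_funB; exact: measurable_C0 (C0_kernel _).
Qed.

Let kappa__lipschitz k b b' : `|kappa_ k b - kappa_ k b'| <= L * `|b - b'|.
Proof.
rewrite /kappa_ -sumrB; under eq_bigr do rewrite -mulrBr.
by apply: average_le => i; rewrite !(KC (y i)); exact: KL.
Qed.

Let C0_kappa : C0 kappa.
Proof.
apply: (C0_lipschitz kappa_lipschitz) => e e0; have [B HB] := K0 e0.
by exists B => b Bb; apply: kappa_le => a; exact: HB.
Qed.

(** Weak-star convergence gives the limit for each [b]. A common Lipschitz constant makes it uniform
    on a segment, and outside both averages are small by the uniform decay of [K]. *)
Let kappa_uniform (e : R) : 0 < e ->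
  \forall k \near \oo, forall b, `|kappa_ k b - kappa b| <= e.
Proof.
move=> e0; have e20 : 0 < e / 2 by rewrite divr_gt0.
have e40 : 0 < e / 4 by rewrite divr_gt0.
have [B HB] := K0 e20.
have L1 : 0 < `|L| + 1 by rewrite ltr_wpDl.
have cK : compact (`[- B, B]%classic : set R) by exact: segment_compact.
pose P (k : nat) (b : R) := `|kappa_ k b - kappa b| <= e.
have /compact_near_coveringP/(_ nat \oo P) := cK.
move=> /(_ _) H.
have : \forall k \near \oo, `[- B, B]%classic `<=` P k.
  apply: H => b _.
  have /cvgrPdist_lt/(_ _ e40) Hb := cvg_m (C0_kernel b).
  exists (ball b (e / 4 / (`|L| + 1)), [set k | `|kappa b - kappa_ k b| < e / 4]).
    by split => //; apply: nbhsx_ballx; rewrite divr_gt0.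
  move=> [c k] [/= bc kb]; rewrite /P.
  have h : L * `|b - c| <= e / 4.
    move: bc; rewrite /ball/= ltr_pdivlMr//.
    have := ler_norm L; have := normr_ge0 (b - c); nra.
  have h1 := le_trans (kappa__lipschitz k b c) h.
  have h2 := le_trans (kappa_lipschitz b c) h.
  have -> : kappa_ k c - kappa c = - (kappa b - kappa_ k b) -
    (kappa_ k b - kappa_ k c) + (kappa b - kappa c) by ring.
  rewrite (le_trans (ler_normD _ _))//.
  have := ler_normB (- (kappa b - kappa_ k b)) (kappa_ k b - kappa_ k c).
  rewrite normrN; lra.
apply: filterS => k Hk b; have [bB|Bb] := leP `|b| B.
  by apply: Hk; rewrite /= in_itv/= -ler_norml.
rewrite (le_trans (ler_normB _ _))//.
have h1 : `|kappa_ k b| <= e / 2 by apply: average_le => i; exact: HB.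
have h2 : `|kappa b| <= e / 2 by apply: kappa_le => a; exact: HB.
lra.
Qed.

Lemma kernel_limit :
  \sum_(j < n k) w j * \sum_(i < n k) w i * K (y i) (y j) @[k --> \oo] -->
  \int[m]_b \int[m]_a K a b.
Proof.
apply/cvgrPdist_le => e e0; have e20 : 0 < e / 2 by rewrite divr_gt0.
have /cvgrPdist_lt/(_ _ e20) h1 := cvg_m C0_kappa.
have h2 := kappa_uniform e20.
near=> k; rewrite -/(kappa_ k).
(* The first difference is weak-star convergence tested on [kappa]; the second is an average of
   uniformly small errors. *)
have -> : \int[m]_b \int[m]_a K a b - \sum_(j < n k) w j * kappa_ k (y j) =
   (\int[m]_b kappa b - \sum_(j < n k) w j * kappa (y j)) -
   \sum_(j < n k) w j * (kappa_ k (y j) - kappa (y j)).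
  under [X in _ - _ - X]eq_bigr do rewrite mulrBr.
  by rewrite sumrB /kappa; ring.
rewrite (le_trans (ler_normB _ _))//.
have g1 : `|\int[m]_b kappa b - \sum_(j < n k) w j * kappa (y j)| < e / 2.
  by near: k; exact: h1.
have g2 : `|\sum_(j < n k) w j * (kappa_ k (y j) - kappa (y j))| <= e / 2.
  apply: average_le => j.
  have : forall b, `|kappa_ k b - kappa b| <= e / 2 by near: k; exact: h2.
  exact.
lra.
Unshelve. all: by end_near. Qed.

End kernel_limit.

(** * Test functions *)

Section particle_integral.
Variable R : realType.
Notation BR := (measurableTypeR R).

Lemma integral_particle_measure (N : nat) (x p : 'I_N -> R -> R) (t : R)
    (f : R -> R) : (0 < N)%N -> (forall i, 0 <= p i t) -> measurable_fun setT f ->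
  (\int[particle_measure x p t]_y (f y)%:E = (particle_sum x p f t)%:E)%E.
Proof.
case: N x p => // n x p _ p0 mf.
(* Nonnegative momenta make the sum of weighted point masses a measure; [inord] indexes it by [nat],
   as a sum of measures requires. *)
pose m_ (k : nat) : {measure set BR -> \bar R} :=
  mscale (NngNum (p0 (inord k))) \d_(x (inord k) t : BR).
have -> : particle_measure x p t = msum m_ n.+1.
  apply/funext => A; rewrite /particle_measure /msum; apply: eq_bigr => i _.
  by rewrite /m_ /= /mscale /= inord_val.
have key (g : R -> R) : measurable_fun setT g -> (forall y, 0 <= g y) ->
    (\int[msum m_ n.+1]_y (g y)%:E = (\sum_(i < n.+1) p i t * g (x i t))%:E)%E.
  move=> mg g0; have mg' : measurable_fun setT (EFin \o g) by exact/measurable_EFinP.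
  rewrite ge0_integral_measure_sum//; last by move=> y _; rewrite lee_fin.
  rewrite -sumEFin; apply: eq_bigr => i _.
  rewrite /m_ ge0_integral_mscale//; last by move=> y _; rewrite lee_fin.
  by rewrite integral_dirac//= inord_val diracT mul1e.
(* The formula for a sum of measures concerns nonnegative integrands, hence the positive and
   negative parts. *)
rewrite integralE; under eq_integral do rewrite -/((EFin \o f)^\+%E _) funerpos.
under [X in (_ - X)%E]eq_integral do rewrite -/((EFin \o f)^\-%E _) funerneg.
rewrite !key; [|exact: measurable_funrneg|by move=> y; rewrite /funrneg le_max lexx orbT
  |exact: measurable_funrpos|by move=> y; rewrite /funrpos le_max lexx orbT].
rewrite -EFinB -sumrB /particle_sum; congr EFin; apply: eq_bigr => i _.
rewrite -mulrBr; congr (_ * _).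
by have /(congr1 (fun g => g (x i t))) := funrposBneg f.
Qed.

End particle_integral.

Section test_functions.
Variable R : realType.
Variable phi : R -> R -> R.
Hypothesis sphi : Cc_smooth_Omega phi.
Notation P w := (partial w phi).

Lemma partial_continuous w : continuous_Omega (P w).
Proof. by apply: continuous_OmegaP; have [/(_ w)[]] := sphi. Qed.

Lemma partial_Dx w t z : 0 <= t -> has_derivative (P w t) z (P (false :: w) t z).
Proof.
by move=> t0; apply: derivable_has_derivative; have [/(_ w)[_ + _] _] := sphi; exact.
Qed.

Lemma partial_Dt w t z : 0 < t ->
  has_derivative (fun s => P w s z) t (P (true :: w) t z).
Proof.
move=> t0; apply: is_deriv_Rplus_interior => //.
by have [/(_ w)[+ _ _] _] := sphi; move=> /(_ t z (ltW t0)).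
Qed.

Lemma partial_section_continuous w t : 0 <= t -> continuous (P w t).
Proof. by move=> t0; apply: has_derivative_continuous => z; exact: partial_Dx. Qed.

(** Induction on the word: differentiating a function that is locally 0 gives 0. One radius serves
    all derivatives. *)
Lemma partial_supp : exists2 A : R, 0 < A & forall w t z, 0 <= t ->
  A < `|z| \/ A < t -> P w t z = 0.
Proof.
have [_ /compact_closure_support[A0 HA0]] := sphi.
exists (`|A0| + 1); first by rewrite ltr_wpDl.
set A := _ + 1; have A0A : A0 < A by rewrite (le_lt_trans (ler_norm _))// ltrDl.
elim=> [|b w IH] t z t0 zt.
  apply: contrapT => /eqP phi0; apply: (HA0 (t, z)) => //.
  rewrite (lt_trans A0A)// prod_normE lt_max (ger0_norm t0).
  by case: zt => ->; rewrite ?orbT.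
have uniq f (s l l' : R) : has_derivative f s l -> has_derivative f s l' -> l = l'.
  by move=> /@derive_val <- /@derive_val <-.
case: b.
  have pos s y : 0 < s -> A < `|y| \/ A < s -> P (true :: w) s y = 0.
    move=> s0 ys; apply: uniq (partial_Dt w y s0) _.
    apply: (near_eq_is_derive _ (@has_derivative_const R 0 s)).
    have near0 : \forall r \near s, 0 < r by exact: lt_nbhsr.
    case: ys => ys.
      by near=> r; rewrite IH//; [apply/ltW; near: r; exact: near0|left].
    have nearA : \forall r \near s, A < r by exact: lt_nbhsr.
    by near=> r; rewrite IH//; [apply/ltW; near: r; exact: near0|right; near: r; exact: nearA].
  (* At [t = 0] the time derivative is one-sided; its vanishing follows from positive times by
     continuity. *)
  move: t0; rewrite le_eqVlt => /predU1P[t0|t0]; last exact: pos.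
  case: zt => zt; last by move: zt; rewrite -t0 ltNge /A addr_ge0.
  apply/eqP; rewrite -normr_le0; apply/ler_addgt0Pl => e e0; rewrite addr0.
  have [d d0 Hd] := partial_continuous (true :: w) z (lexx 0) e0.
  have d20 : 0 < d / 2 by rewrite divr_gt0.
  have := Hd (d / 2) z (ltW d20); rewrite sub0r normrN gtr0_norm// subrr normr0.
  rewrite (pos (d / 2) z d20 (or_introl zt)) subr0 -t0 => h; apply/ltW/h => //.
  by rewrite ltr_pdivrMr// ltr_pMr// ltr1n.
case: zt => zt; first exact: (has_derivative_supp (fun y => @partial_Dx w t y t0)
    (fun y yA => IH t y t0 (or_introl yA)) zt).
apply: uniq (partial_Dx w z t0) _.
have -> : P w t = cst 0 by apply/funext => y; rewrite IH//; right.
exact: has_derivative_const.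
Unshelve. all: by end_near. Qed.

Lemma partial_bounded w : exists2 M : R, 0 <= M &
  forall t z, 0 <= t -> `|P w t z| <= M.
Proof.
have [A A0 HA] := partial_supp.
pose K := `[0, A]%classic `*` `[- A, A]%classic : set (R * R).
have cK : compact K by apply: compact_setX; exact: segment_compact.
have KO : K `<=` @Omega R by move=> [t z] [/=]; rewrite in_itv/= => /andP[].
have cP : {within K, continuous (fun z : R * R => P w z.1 z.2)}.
  by apply: continuous_subspaceW KO _; have [/(_ w)[]] := sphi.
have /compact_bounded[M [_ HM]] := continuous_compact cP cK.
exists (`|M| + 1) => // t z t0.
have [zA|Az] := leP `|z| A; last by rewrite HA ?normr0//; left.
have [tA|At] := leP t A; last by rewrite HA ?normr0//; right.
apply: (HM (`|M| + 1)); first by rewrite (le_lt_trans (ler_norm _))// ltrDl.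
by exists (t, z) => //; split; rewrite /= in_itv/= ?t0// -ler_norml.
Qed.

Lemma C0_partial w t : 0 <= t -> C0 (P w t).
Proof.
move=> t0; have [A A0 HA] := partial_supp.
have H0 z : A < `|z| -> P w t z = 0 by move=> Az; apply: HA => //; left.
split; first exact: partial_section_continuous.
  exact: compact_support_cvgy H0.
exact: compact_support_cvgNy H0.
Qed.

End test_functions.

(** * The limiting solution *)

Section limit_measures.
Variable R : realType.
Variable alpha : R.
Hypothesis alpha_gt0 : 0 < alpha.
Notation BR := (measurableTypeR R).
Notation leb := (@lebesgue_measure R).
Variables x p : forall N : nat, 'I_N -> R -> R.
Hypothesis sol : forall N, (0 < N)%N -> particle_solution alpha (@x N) (@p N).
Variable s : nat -> nat.
Variable m : R -> subprobability BR R.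
Hypothesis cvg_m : forall t f, 0 <= t -> C0 f ->
  particle_sum (@x (s k).+1) (@p (s k).+1) f t @[k --> \oo] --> \int[m t]_y f y.
Notation G := (Green alpha).
Notation U t := (convolution G (m t)).

(** The particle estimate does not depend on [k] and passes to the limit. *)
Lemma limit_lipschitz (f : R -> R) (M L t r : R) : C0 f -> 0 <= t -> 0 <= r ->
  (forall y, `|f y| <= M) -> (forall y z, `|f y - f z| <= L * `|y - z|) -> 0 <= L ->
  `|\int[m t]_y f y - \int[m r]_y f y| <= (M * cDG alpha + L * cG alpha) * `|t - r|.
Proof.
move=> f0 t0 r0 fM fL L0.
apply: (cvg_norm_le (cvgB (cvg_m t0 f0) (cvg_m r0 f0))) => k.
rewrite mulrDl -(mulrA L); apply: (particle_sum_lipschitz alpha_gt0 (sol _)) => // y z yz.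
by rewrite (le_trans (fL y z))// ler_wpM2l.
Qed.

(** The constant of [limit_lipschitz] for the test function [G(z - .)], bounded by [cG] and
    Lipschitz with constant [cG / alpha]: it bounds the rate of change of [u] in time at a fixed
    point. *)
Definition U_speed := cG alpha * cDG alpha + cG alpha / alpha * cG alpha.

Lemma U_speed_ge0 : 0 <= U_speed.
Proof.
have ? := cG_ge0 alpha_gt0; have ? := cDG_ge0 alpha.
by rewrite addr_ge0// mulr_ge0// divr_ge0// ltW.
Qed.

Lemma U_lipschitz t r z : 0 <= t -> 0 <= r ->
  `|U t z - U r z| <= U_speed * `|t - r|.
Proof.
move=> t0 r0; apply: limit_lipschitz => //.
- exact: C0_Green.
- by move=> y; exact: Green_le.
- by move=> a b; exact: Green_sub_lipschitz.
- by rewrite divr_ge0 ?cG_ge0// ltW.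
Qed.

(** Functions in the unit ball of the bounded Lipschitz norm are bounded by 1 and 1-Lipschitz, so
    [limit_lipschitz] makes the distance Lipschitz in time with constant [cDG + cG]. *)
Lemma limit_BL_continuous : BL_continuous m.
Proof.
move=> t t0.
set C := cDG alpha + cG alpha.
have C_ge0 : 0 <= C by rewrite addr_ge0 ?cDG_ge0 ?cG_ge0.
have zero0 : C0 (fun=> 0 : R) by split; [move=> ?; exact: cvg_cst|exact: cvg_cst|exact: cvg_cst].
have ge0 r : (0 <= BL_dist (m r) (m t))%E.
  apply: ereal_sup_ubound; exists (fun=> 0) => /=.
    split => //; rewrite /sup_norm /lip_const.
    rewrite (_ : [set _ | _ in _] = [set 0%E]); last first.
      apply/seteqP; split => [_ [z _ <-]|_ ->] /=; first by rewrite normr0.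
      by exists 0 => //; rewrite normr0.
    rewrite (_ : [set _ | _ in _] = [set 0%E]); last first.
      apply/seteqP; split => [_ [z _ <-]|_ ->] /=; first by rewrite subrr normr0 mul0r.
      by exists (0, 1) => /=; rewrite ?subrr ?normr0 ?mul0r// eq_sym oner_neq0.
    by rewrite !ereal_sup1 add0e.
  by rewrite !Rintegral_cst// !mul0r subrr.
have le r : 0 <= r -> (BL_dist (m r) (m t) <= (C * `|r - t|)%:E)%E.
  move=> r0; apply: ge_ereal_sup => _ [f [f0 fBL] <-]; rewrite lee_fin.
  have sup0 : (0 <= sup_norm f)%E.
    by apply: le_trans (ereal_sup_ubound _); [|exists 0 => //]; rewrite lee_fin.
  have lip0 : (0 <= lip_const f)%E.
    apply: le_trans (ereal_sup_ubound _); last first.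
      by exists (0, 1) => //=; rewrite eq_sym oner_neq0.
    by rewrite lee_fin divr_ge0.
  have f1 y : `|f y| <= 1.
    rewrite -lee_fin (le_trans _ fBL)//.
    by apply: le_trans (leeDl _ lip0); apply: ereal_sup_ubound; exists y.
  have fL y z : `|f y - f z| <= 1 * `|y - z|.
    have [->|yz] := eqVneq y z; first by rewrite !subrr normr0 mulr0.
    rewrite -ler_pdivrMr ?normr_gt0 ?subr_eq0// -lee_fin (le_trans _ fBL)//.
    by apply: le_trans (leeDr _ sup0); apply: ereal_sup_ubound; exists (y, z).
  apply: le_trans (ler_norm _) _; rewrite /C -[cDG _]mul1r -[cG _]mul1r.
  exact: limit_lipschitz.
apply: (@squeeze_cvge _ _ _ _ (fun=> 0%E) _ (fun r => (C * `|r - t|)%:E)).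
- rewrite near_withinE; apply: nearW => r; rewrite /= in_itv/= andbT => r0.
  by rewrite ge0 le.
- exact: cvg_cst.
- apply: cvg_EFin; first exact: nearW.
  apply: cvg_within_filter.
  have ct : C * `|r - t| @[r --> t] --> C * `|t - t|.
    apply: cvgM; first exact: cvg_cst.
    by apply: cvg_norm; apply: cvgB; [exact: cvg_id|exact: cvg_cst].
  by move: ct; rewrite subrr normr0 mulr0.
Qed.

Lemma limit_holder : Cb_holder_H1 2^-1 (fun t => U t).
Proof.
split.
- by move=> t _; exact: in_H1_U.
(* [2 * U_speed] comes from integrating [w] against two measures of mass at most 1; the other factor
   compares the [H1] norm with the energy. *)
- pose D := (1 + (alpha ^+ 2)^-1) * (2 * U_speed).
  have a20 : 0 <= 1 + (alpha ^+ 2)^-1 by rewrite addr_ge0// invr_ge0 sqr_ge0.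
  have D0 : 0 <= D by rewrite mulr_ge0// mulr_ge0// U_speed_ge0.
  exists (Num.sqrt D) => r t r0 t0.
  apply: le_trans (H1_norm_U_sub_le alpha_gt0 _ _) _.
  rewrite lee_fin powR12_sqrt// -sqrtrM// ler_sqrt ?mulr_ge0 ?U_speed_ge0//.
  rewrite /D -mulrA ler_wpM2l//.
  apply: le_trans (ler_norm _) _; apply: le_trans (ler_normB _ _) _.
  have bd (mu : subprobability BR R) :
      `|\int[mu]_y (U r y - U t y)| <= U_speed * `|r - t|.
    apply: (@le_trans _ _ (U_speed * `|r - t| * mass mu)).
      apply: Rintegral_le_bound => [|z]; last exact: U_lipschitz.
      by apply: measurable_funB; exact: measurable_U.
    by rewrite ler_piMr ?mass_sub_le1// mulr_ge0// U_speed_ge0.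
  by apply: le_trans (lerD (bd _) (bd _)) _; lra.
- exists (Num.sqrt ((1 + (alpha ^+ 2)^-1) * cG alpha)) => t t0.
  have a20 : 0 <= 1 + (alpha ^+ 2)^-1 by rewrite addr_ge0// invr_ge0 sqr_ge0.
  apply: le_trans (H1_norm_U_le alpha_gt0 _) _.
  rewrite lee_fin ler_sqrt ?mulr_ge0 ?cG_ge0// ler_wpM2l//.
  apply: le_trans (ler_norm _) _.
  have cGmass (mu : subprobability BR R) : cG alpha * mass mu <= cG alpha.
    by rewrite ler_piMr ?mass_sub_le1 ?cG_ge0.
  apply: le_trans (cGmass (m t)).
  apply: Rintegral_le_bound; first exact: measurable_U.
  by move=> z; exact: le_trans (U_le alpha_gt0 _ _) (cGmass _).
Qed.

End limit_measures.

Section Rintegral_itv.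
Variable R : realType.
Notation leb := (@lebesgue_measure R).

(** Besides the convergence, the integrability of the limit matters: measurability in time of
    integrals against [m t] is obtained from the particle sums converging to them. *)
Lemma Rintegral_bounded_cvg (F : nat -> R -> R) (f : R -> R) (a b C : R) :
  (forall k, measurable_fun `[a, b] (F k)) ->
  (forall k t, t \in `[a, b] -> `|F k t| <= C) ->
  (forall t, t \in `[a, b] -> F k t @[k --> \oo] --> f t) ->
  leb.-integrable `[a, b] (EFin \o f) /\
  \int[leb]_(t in `[a, b]) F k t @[k --> \oo] --> \int[leb]_(t in `[a, b]) f t.
Proof.
move=> mF FC Ff.
have mf : measurable_fun `[a, b] f by apply: measurable_fun_cvg mF _ => t; exact: Ff.
have fin := compact_finite_measure (@segment_compact R a b).
have [] := @dominated_convergence _ _ _ leb `[a, b]%classic (measurable_itv _)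
   (fun k t => (F k t)%:E) (fun t => (f t)%:E) (cst C%:E).
- by move=> k; apply: measurableT_comp => //; exact: mF.
- exact: measurableT_comp.
- by apply: aeW => t tab; apply: cvg_EFin; [exact: nearW|exact: Ff].
- apply: measurable_bounded_integrable => //.
  by apply: (@bounded_onT _ _ _ `|C|) => z.
- by apply: aeW => t k tab; rewrite lee_fin FC.
move=> fi _ cvgF; split => //.
by apply: fine_cvg; rewrite fineK//; exact: integrable_fin_num.
Qed.

Lemma integrable_Rplus (f : R -> R) (a b : R) : 0 <= a -> continuous_Rplus f ->
  leb.-integrable `[a, b] (EFin \o f).
Proof.
move=> a0 cf; apply: continuous_compact_integrable; first exact: segment_compact.
exact: continuous_Rplus_within.
Qed.

Lemma Rintegral_Rplus_supp (f : R -> R) (T : R) : (forall t, T < t -> f t = 0) ->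
  \int[leb]_(t in `[0, +oo[) f t = \int[leb]_(t in `[0, T]) f t.
Proof.
move=> f0; rewrite Rintegral_mkcond [RHS]Rintegral_mkcond.
congr (Rintegral _ _ _); apply/funext => t; rewrite !patchE !mem_setE !in_itv/= andbT.
by case: (leP 0 t) => //= _; case: (leP t T) => // /f0.
Qed.

End Rintegral_itv.

Section limit_weak_form.
Variable R : realType.
Variable alpha : R.
Hypothesis alpha_gt0 : 0 < alpha.
Notation BR := (measurableTypeR R).
Notation leb := (@lebesgue_measure R).
Variables x p : forall N : nat, 'I_N -> R -> R.
Hypothesis sol : forall N, (0 < N)%N -> particle_solution alpha (@x N) (@p N).
Variable s : nat -> nat.
Variable m : R -> subprobability BR R.
Hypothesis cvg_m : forall t f, 0 <= t -> C0 f ->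
  particle_sum (@x (s k).+1) (@p (s k).+1) f t @[k --> \oo] --> \int[m t]_y f y.
Notation U t := (convolution (Green alpha) (m t)).
Notation DU t := (convolution (dGreen alpha) (m t)).
Variable phi : R -> R -> R.
Hypothesis sphi : Cc_smooth_Omega phi.

Let K t := CH_kernel alpha (phi t) (Dx phi t).
Let limit_term t := \int[m t]_y Dt phi t y + \int[m t]_b \int[m t]_a K t a b.
Let particle_term k t := particle_sum (@x (s k).+1) (@p (s k).+1) (Dt phi t) t
  + pair_sum (@x (s k).+1) (@p (s k).+1) (K t) t.

Let K_bounded : exists C : R, forall t a b, 0 <= t -> `|K t a b| <= C.
Proof.
have [M _ HM] := partial_bounded sphi [::].
have [M1 _ HM1] := partial_bounded sphi [:: false].
exists (M1 * cG alpha + M * cDG alpha) => t a b t0.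
by apply: CH_kernel_bounded => // z; [exact: (HM t z t0)|exact: (HM1 t z t0)].
Qed.

Let particle_term_cvg t : 0 <= t ->
  particle_term k t @[k --> \oo] --> limit_term t.
Proof.
move=> t0; apply: cvgD; first exact: cvg_m (C0_partial sphi [:: true] t0).
have [M _ HM] := partial_bounded sphi [::].
have [M1 _ HM1] := partial_bounded sphi [:: false].
have [M2 _ HM2] := partial_bounded sphi [:: false; false].
have [A _ HA] := partial_supp sphi.
have fM z : `|phi t z| <= M by exact: HM.
have f1M z : `|Dx phi t z| <= M1 by exact: HM1.
have fL := has_derivative_lipschitz (fun z => @partial_Dx _ _ sphi [::] t z t0) f1M.
have f1L := has_derivative_lipschitz (fun z => @partial_Dx _ _ sphi [:: false] t z t0)
  (fun z => HM2 t z t0).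
have f0 z : A < `|z| -> phi t z = 0 by move=> h; apply: (HA [::]) => //; left.
have f10 z : A < `|z| -> Dx phi t z = 0 by move=> h; apply: (HA [:: false]) => //; left.
have [L HL] := CH_kernel_lipschitz alpha_gt0 fM f1M fL f1L.
apply: (kernel_limit (K := K t) (@CH_kernelC _ _ _ _) HL
  (@CH_kernel_decay _ _ alpha_gt0 _ _ _ _ _ fM f1M f0 f10)
  (m := m t) (n := fun k => (s k).+1) (w := fun k i => @p (s k).+1 i t)
  (y := fun k i => @x (s k).+1 i t)).
- by move=> k i; apply: (momentum_ge0 alpha_gt0 (sol _)).
- by move=> k; exact: (sum_momentum (sol _)).
- by move=> f f_0; exact: cvg_m.
Qed.

(** [phi T = 0] removes the final term of the particle weak form; the initial pairing is left, with
    a minus sign. *)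
Let integral_limit_term T : 0 < T -> (forall z, phi T z = 0) ->
  leb.-integrable `[0, T] (EFin \o limit_term) /\
  - particle_sum (@x (s k).+1) (@p (s k).+1) (phi 0) 0 @[k --> \oo] -->
  \int[leb]_(t in `[0, T]) limit_term t.
Proof.
move=> T0 phiT.
have [M _ HM] := partial_bounded sphi [:: true].
have [C HC] := K_bounded.
have c w := partial_continuous sphi w.
have [||| fi F_cvg] := @Rintegral_bounded_cvg _ particle_term limit_term 0 T (M + C).
- move=> k; apply: subspace_continuous_measurable_fun => //.
  apply: continuous_Rplus_within => //.
  exact: (continuous_pair_sum_kernel (sol _) (c [::]) (c [:: true]) (c [:: false])).
- move=> k t; rewrite in_itv/= => /andP[t0 _].
  apply: le_trans (ler_normD _ _) _; apply: lerD.
    by apply: (particle_sum_le alpha_gt0 (sol _)) => // y; exact: (HM t y t0).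
  (* Read as an average of averages, the pair sum obeys the same bound as the kernel. *)
  rewrite /pair_sum -/(particle_sum _ _ (fun b => \sum_(i < (s k).+1) _) t).
  apply: (particle_sum_le alpha_gt0 (sol _)
    (f := fun b => particle_sum (@x (s k).+1) (@p (s k).+1) (K t ^~ b) t)) => // b.
  by apply: (particle_sum_le alpha_gt0 (sol _)) => // a; exact: HC.
- by move=> t; rewrite in_itv/= => /andP[t0 _]; exact: particle_term_cvg.
split => //; apply: cvg_trans F_cvg; apply: near_eq_cvg; apply: nearW => k.
rewrite (particle_weak_form (sol _) _ _ (c [::]) (c [:: true]) (c [:: false]) T0)//.
- rewrite [X in X - _](_ : _ = 0) ?sub0r//.
  by apply: big1 => i _; rewrite /= phiT mulr0.
- by move=> t z t0; exact: (partial_Dt sphi [::]).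
- by move=> t z t0; exact: (partial_Dx sphi [::] _ (ltW t0)).
Qed.

Let W t z := 3 / 2 * Dx phi t z - 1 / 2 * alpha ^+ 2 * Dx (Dx (Dx phi)) t z.

(** Provides the integrability in time of the [u^2] term, by continuity under the integral with a
    constant majorant on the bounded support of [W t]. *)
Let continuous_quadratic_term :
  continuous_Rplus (fun t => \int[leb]_z (W t z * U t z ^+ 2)).
Proof.
have [A A0 HA] := partial_supp sphi.
have [M M0 HM] := partial_bounded sphi [:: false].
have [M3 M30 HM3] := partial_bounded sphi [:: false; false; false].
have c0 : 0 <= 1 / 2 * alpha ^+ 2 by rewrite mulr_ge0 ?sqr_ge0// divr_ge0.
(* Extended to negative times, so that every [t] has a neighbourhood in which [g] is defined and
   continuous in time. *)
pose g t z := W (Num.max 0 t) z * U (Num.max 0 t) z ^+ 2.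
have m0 t : 0 <= Num.max 0 t :> R by rewrite le_max lexx.
have UG t z : `|U t z| <= cG alpha.
  apply: le_trans (U_le alpha_gt0 (m t) z) _.
  by rewrite ler_piMr ?mass_sub_le1 ?cG_ge0.
have WM t z : 0 <= t -> `|W t z| <= 3 / 2 * M + 1 / 2 * alpha ^+ 2 * M3.
  move=> t0; apply: le_trans (ler_normB _ _) _; apply: lerD.
    by rewrite normrM gtr0_norm// ler_wpM2l//; exact: (HM t z t0).
  by rewrite normrM (ger0_norm c0) ler_wpM2l//; exact: (HM3 t z t0).
have cW t : 0 <= t -> continuous (W t).
  move=> t0; apply: continuous_subr; apply: continuous_mulr; [exact: continuous_const| |
    exact: continuous_const|].
    exact: (@partial_section_continuous _ _ sphi [:: false] _ t0).
  exact: (@partial_section_continuous _ _ sphi [:: false; false; false] _ t0).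
have mg t : measurable_fun `[- A, A] (g t).
  apply: measurable_funTS; apply: measurable_funM.
    by apply: continuous_measurable_fun; exact: cW.
  by apply: measurable_funX; exact: measurable_U.
have gM t z : `|g t z| <= (3 / 2 * M + 1 / 2 * alpha ^+ 2 * M3) * cG alpha ^+ 2.
  rewrite normrM ler_pM// ?WM// normrX lerXn2r ?nnegrE ?cG_ge0//.
have fin := compact_finite_measure (@segment_compact R (- A) A).
have cg z : continuous (g ^~ z).
  have : continuous_Rplus (fun t => W t z * U t z ^+ 2).
    have cz : continuous_Rplus (fun=> z) by apply: continuous_RplusT => ?; exact: cvg_cst.
    apply: continuous_RplusM.
      apply: continuous_RplusD.
        apply: continuous_RplusM; first by apply: continuous_RplusT => ?; exact: cvg_cst.
        exact: continuous_Omega_curve (partial_continuous sphi [:: false]) cz.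
      apply: (@continuous_Rplus_comp _ _ -%R); last by move=> ?; exact: opp_continuous.
      apply: continuous_RplusM; first by apply: continuous_RplusT => ?; exact: cvg_cst.
      exact: continuous_Omega_curve (partial_continuous sphi [:: false; false; false]) cz.
    apply: (@continuous_Rplus_comp _ _ (fun r => r ^+ 2)); last exact: exprn_continuous.
    move=> t t0 e e0.
    have C0 : 0 < e / (U_speed alpha + 1) by rewrite divr_gt0// ltr_wpDl// U_speed_ge0.
    near=> r => r0.
    apply: le_lt_trans (U_lipschitz alpha_gt0 sol cvg_m _ t0 r0) _.
    apply: (@le_lt_trans _ _ ((U_speed alpha + 1) * `|t - r|)).
      by rewrite ler_wpM2r// lerDl.
    rewrite -ltr_pdivlMl ?ltr_wpDl ?U_speed_ge0// mulrC.
    by near: r; apply: (@cvgr_dist_lt _ _ _ (nbhs t)).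
  by move=> /continuous_RplusP.
have : continuous_Rplus (fun t => \int[leb]_(z in `[- A, A]) g t z).
  apply: continuous_RplusT => t.
  apply: (@continuity_under_integral _ _ _ leb g `[- A, A]%classic (measurable_itv _)
    (t - 1) (t + 1) _ _
    (cst ((3 / 2 * M + 1 / 2 * alpha ^+ 2 * M3) * cG alpha ^+ 2))).
  - move=> r _; apply: measurable_bounded_integrable => //; first exact: mg.
    exact: bounded_onT (gM r).
  - by apply: aeW => z _ r _; exact: cg.
  - apply: measurable_bounded_integrable => //.
    by apply: (@bounded_onT _ _ _ `|_|) => z; exact: lexx.
  - by move=> r _; apply: aeW => z _; exact: gM.
  - by rewrite inE/= in_itv/= ltrBlDr !ltrDl ltr01.
apply: eq_continuous_Rplus => t t0.
rewrite Rintegral_mkcond; apply: eq_Rintegral => z _; rewrite patchE mem_setE in_itv/=.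
rewrite /g (max_idPr t0) -ler_norml; case: leP => // Az.
rewrite /W (HA [:: false] t z t0 (or_introl Az) : Dx phi t z = 0).
rewrite (HA [:: false; false; false] t z t0 (or_introl Az) : Dx (Dx (Dx phi)) t z = 0).
by rewrite !mulr0 subrr mul0r.
Unshelve. all: by end_near. Qed.

Lemma limit_weak_form (m0 : {finite_measure set BR -> \bar R}) :
  (forall f, C0 f -> particle_sum (@x (s k).+1) (@p (s k).+1) f 0 @[k --> \oo] -->
    \int[m0]_y f y) ->
  \int[m0]_z phi 0 z
  + \int[leb]_(t in `[0, +oo[) \int[leb]_z
      ((Dt phi t z - alpha ^+ 2 * Dx (Dx (Dt phi)) t z) * U t z)
  + \int[leb]_(t in `[0, +oo[) \int[leb]_z
      ((3 / 2 * Dx phi t z - 1 / 2 * alpha ^+ 2 * Dx (Dx (Dx phi)) t z)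
       * U t z ^+ 2)
  + \int[leb]_(t in `[0, +oo[) \int[leb]_z
      (1 / 2 * alpha ^+ 2 * Dx phi t z * DU t z ^+ 2)
  = 0.
Proof.
move=> cvg0; have [A A0 HA] := partial_supp sphi.
(* [T] lies strictly beyond the support in time, so that [phi T] is already 0. *)
pose T := A + 1; have AT : A < T by rewrite ltrDl.
have T0 : 0 < T by exact: lt_trans AT.
have phi0 w t z : T < t -> partial w phi t z = 0.
  move=> Tt; apply: HA; first exact: ltW (lt_trans T0 Tt).
  by right; exact: lt_trans Tt.
have phiT z : phi T z = 0 by apply: (HA [::]); [exact: ltW|right].
have [ilim cvgF] := integral_limit_term T0 phiT.
(* The initial pairings have two limits, one by the assumption at time 0 and one by the particle
   weak form; they coincide. *)
have E0 : \int[m0]_z phi 0 z = - \int[leb]_(t in `[0, T]) limit_term t.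
  apply: cvg_uniqueR (cvg0 _ (C0_partial sphi [::] (lexx 0))) _.
  by move/cvgN: cvgF; under eq_cvg do rewrite opprK.
have zero (f g : R -> R) : (forall z, f z = 0) -> \int[leb]_z (f z * g z) = 0.
  by move=> f0; rewrite /Rintegral integral0_eq// => z _; rewrite f0 mul0r.
rewrite (@Rintegral_Rplus_supp _ _ T); last first.
  move=> t Tt; apply: zero => z.
  rewrite (phi0 [:: true] t z Tt : Dt phi t z = 0).
  by rewrite (phi0 [:: false; false; true] t z Tt : Dx (Dx (Dt phi)) t z = 0) mulr0 subrr.
rewrite (@Rintegral_Rplus_supp _ _ T); last first.
  move=> t Tt; apply: zero => z.
  rewrite (phi0 [:: false] t z Tt : Dx phi t z = 0).
  by rewrite (phi0 [:: false; false; false] t z Tt : Dx (Dx (Dx phi)) t z = 0) !mulr0 subrr.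
rewrite (@Rintegral_Rplus_supp _ _ T); last first.
  by move=> t Tt; apply: zero => z; rewrite (phi0 [:: false] t z Tt : Dx phi t z = 0) mulr0.
have f0 w t z : 0 <= t -> A < `|z| -> partial w phi t z = 0.
  by move=> t0 Az; apply: HA => //; left.
have d w t : 0 <= t ->
    forall z, has_derivative (partial w phi t) z (partial (false :: w) phi t z).
  by move=> t0 z; exact: partial_Dx.
have linE t : 0 <= t -> \int[leb]_z
    ((Dt phi t z - alpha ^+ 2 * Dx (Dx (Dt phi)) t z) * U t z) = \int[m t]_y Dt phi t y.
  move=> t0; apply: (convolution_helmholtz alpha_gt0 (m t) (d [:: true] t t0)
    (d [:: false; true] t t0)).
    exact: (@partial_section_continuous _ _ sphi [:: false; false; true] _ t0).
  by move=> z; exact: f0.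
(* The [u_x^2] term is solved for, so that its time integral splits into three integrals of
   functions already known to be integrable. *)
have quadE t : 0 <= t -> \int[leb]_z (1 / 2 * alpha ^+ 2 * Dx phi t z * DU t z ^+ 2) =
    limit_term t - \int[m t]_y Dt phi t y - \int[leb]_z (W t z * U t z ^+ 2).
  move=> t0.
  have H : \int[leb]_z (W t z * U t z ^+ 2) +
      \int[leb]_z (1 / 2 * alpha ^+ 2 * Dx phi t z * DU t z ^+ 2) =
      \int[m t]_b \int[m t]_a K t a b.
    apply: (convolution_CH alpha_gt0 (m t) (d [::] t t0) (d [:: false] t t0)
      (d [:: false; false] t t0)).
      exact: (@partial_section_continuous _ _ sphi [:: false; false; false] _ t0).
    by move=> z; exact: f0 [::] t z t0.
  by rewrite /limit_term -H (addrC (\int[m t]_y _)) addrK addrAC subrr add0r.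
have itv0 t : t \in `[0, T]%classic -> 0 <= t.
  by rewrite inE/= in_itv/= => /andP[].
have ilin : leb.-integrable `[0, T] (EFin \o (fun t => \int[m t]_y Dt phi t y)).
  have [M _ HM] := partial_bounded sphi [:: true].
  have [|||//] := @Rintegral_bounded_cvg _
    (fun k t => particle_sum (@x (s k).+1) (@p (s k).+1) (Dt phi t) t)
    (fun t => \int[m t]_y Dt phi t y) 0 T M.
  - move=> k; apply: subspace_continuous_measurable_fun => //.
    apply: continuous_Rplus_within => //.
    exact: (continuous_particle_sum (sol _) (partial_continuous sphi [:: true])).
  - move=> k t; rewrite in_itv/= => /andP[t0 _].
    by apply: (particle_sum_le alpha_gt0 (sol _)) => // y; exact: (HM t y t0).
  - move=> t; rewrite in_itv/= => /andP[t0 _].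
    exact: cvg_m (C0_partial sphi [:: true] t0).
have iquad := integrable_Rplus T (lexx 0) continuous_quadratic_term.
have -> : \int[leb]_(t in `[0, T]) \int[leb]_z
      ((Dt phi t z - alpha ^+ 2 * Dx (Dx (Dt phi)) t z) * U t z) =
    \int[leb]_(t in `[0, T]) \int[m t]_y Dt phi t y.
  by apply: eq_Rintegral => t /itv0; exact: linE.
have -> : \int[leb]_(t in `[0, T]) \int[leb]_z
      (1 / 2 * alpha ^+ 2 * Dx phi t z * DU t z ^+ 2) =
    \int[leb]_(t in `[0, T]) limit_term t - \int[leb]_(t in `[0, T]) \int[m t]_y Dt phi t y
    - \int[leb]_(t in `[0, T]) \int[leb]_z (W t z * U t z ^+ 2).
  have idiff := @integrableB _ _ _ leb _ (measurable_itv _) _ _ ilim ilin.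
  rewrite -RintegralB// -RintegralB//.
  by apply: eq_Rintegral => t /itv0; exact: quadE.
by rewrite E0 /W; ring.
Qed.

End limit_weak_form.

Lemma EFin_Rintegral_C0 (R : realType) (mu : {finite_measure set (measurableTypeR R) -> \bar R})
    (f : R -> R) : C0 f -> (\int[mu]_y (f y)%:E = (\int[mu]_y f y)%:E)%E.
Proof.
move=> f0; have [M fM] := C0_bounded f0.
have := integrable_bounded mu (measurable_C0 f0) fM.
by move=> fi; rewrite /Rintegral fineK//; exact: integrable_fin_num.
Qed.

Unset Implicit Arguments.
Set Strict Implicit.

Theorem theorem5p5 (R : realType) (alpha : R) (halpha : 0 < alpha)
    (m0 : {finite_measure set (measurableTypeR R) -> \bar R})
    (hm0 : m0 [set: measurableTypeR R] = 1%E)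
    (x p : forall N : nat, 'I_N -> R -> R)
    (hsol : forall N, (0 < N)%N -> particle_solution alpha (x N) (p N))
    (hinit : weak_star_cvg (fun N => particle_measure (x N) (p N) 0) m0) :
  exists (sigma : nat -> nat) (m : R -> subprobability (measurableTypeR R) R),
    [/\ (0 < sigma 0)%N /\ (forall i j, (i < j)%N -> (sigma i < sigma j)%N),
        BL_continuous m,
        forall t, 0 <= t ->
          weak_star_cvg
            (fun k => particle_measure (x (sigma k)) (p (sigma k)) t) (m t) &
        let u := fun t => convolution (Green alpha) (m t) in
        weak_CH_solution alpha (convolution (Green alpha) m0) m0 u /\
        Cb_holder_H1 2^-1 u].
Proof.
have [s [m [s_incr cvg_m]]] := particle_compactness halpha hsol.
have integralE k t f : 0 <= t -> C0 f ->
    (\int[particle_measure (x (s k).+1) (p (s k).+1) t]_y (f y)%:E =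
     (particle_sum (x (s k).+1) (p (s k).+1) f t)%:E)%E.
  move=> t0 f0; apply: integral_particle_measure => //; last exact: measurable_C0.
  by move=> i; apply: (momentum_ge0 halpha (hsol _ _)).
have cvg0 f : C0 f ->
    particle_sum (x (s k).+1) (p (s k).+1) f 0 @[k --> \oo] --> \int[m0]_y f y.
  move=> f0; have := hinit f f0; rewrite EFin_Rintegral_C0// => /fine_cvg.
  move=> /(@cvg_subsequence _ _ _ (fun k => (s k).+1) s_incr).
  by under eq_cvg do rewrite /= integralE//.
(* The shift by 1 matches the convention that index [n] stands for [n.+1] particles and makes the
   first index positive. *)
exists (fun k => (s k).+1), m; split.
- by split => // i j /s_incr.
- exact: (@limit_BL_continuous _ _ halpha _ _ hsol _ _ cvg_m).
- move=> t t0 f f0; rewrite EFin_Rintegral_C0//.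
  under eq_fun do rewrite integralE//.
  by apply: cvg_EFin; [exact: nearW|exact: cvg_m].
move=> u; split; last exact: (@limit_holder _ _ halpha _ _ hsol _ _ cvg_m).
split; first exact: is_helmholtz_U.
(* Both convolutions at [z] are limits of the same particle sums at time 0, tested on [G(z - .)]. *)
- apply/funext => z.
  exact: cvg_uniqueR (cvg_m _ _ (lexx 0) (C0_Green halpha z)) (cvg0 _ (C0_Green halpha z)).
exists (fun t => convolution (dGreen alpha) (m t)); split.
  by move=> t _; exact: is_weak_deriv_U.
by move=> phi sphi; exact: (@limit_weak_form _ _ halpha _ _ hsol _ _ cvg_m _ sphi _ cvg0).
Qed.
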